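(* Let $n\geq 1$ and let $V:\mathbb{R}^n\to\mathbb{R}$ be bounded and continuous with $V(x)>0$ for all $x\in\mathbb{R}^n$. Then there exists a constant $C>0$, independent of $t$ and of the initial data, such that the following holds. Let $(u_0,u_1)\in H^1(\mathbb{R}^n)\times L^2(\mathbb{R}^n)$ satisfy \[ K_0^2:=\int_{\mathbb{R}^n}\frac{|u_1(x)+u_0(x)|^2}{V(x)}\,dx<+\infty, \] and let $u\in C([0,\infty);H^1(\mathbb{R}^n))\cap C^1([0,\infty);L^2(\mathbb{R}^n))$ be the unique weak solution of the damped wave equation \[ u_{tt}-\Delta u+V(x)u+u_t=0\quad (t>0,\ x\in\mathbb{R}^n),\qquad u(0,x)=u_0(x),\quad u_t(0,x)=u_1(x)\quad (x\in\mathbb{R}^n). \] Then for all $t\geq 0$, \[ (1+t)^2E(t)\leq C\left(\|u_0\|^2+\|u_1\|^2+\|\nabla u_0\|^2+K_0^2\right), \] \[ (1+t)\|u(t,\cdot)\|^2\leq C\left(\|u_0\|^2+\|u_1\|^2+\|\nabla u_0\|^2+K_0^2\right). \]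
   Context: All functions are real-valued. $\|\cdot\|$ denotes the norm of $L^2(\mathbb{R}^n)$. The total energy is \[ E(t):=\frac12\int_{\mathbb{R}^n}\left(|u_t(t,x)|^2+|\nabla u(t,x)|^2+V(x)|u(t,x)|^2\right)dx. \] A weak solution is a function in the stated class satisfying the equation in the sense of distributions on $(0,\infty)\times\mathbb{R}^n$ and attaining the initial data; it is known that for every $(u_0,u_1)\in H^1(\mathbb{R}^n)\times L^2(\mathbb{R}^n)$ there is a unique one. *)

(* Defs.v *)
From HB Require Import structures.
From mathcomp Require Import all_boot all_order all_algebra.
From mathcomp Require Import all_classical all_reals all_analysis.
Set Implicit Arguments.
Unset Strict Implicit.
Unset Printing Implicit Defensive.
Import Order.TTheory GRing.Theory Num.Theory.
Import numFieldNormedType.Exports.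
Local Open Scope classical_set_scope.
Local Open Scope ring_scope.

Section measurable_rV.
Context {R : realType} {n : nat}.

Definition rV_coord (i : 'I_n) (x : 'rV[R]_n) : R := x ord0 i.

Let rV_set0 : g_sigma_preimage rV_coord set0.
Proof. exact: sigma_algebra0. Qed.

Let rV_setC A : g_sigma_preimage rV_coord A -> g_sigma_preimage rV_coord (~` A).
Proof. exact: sigma_algebraC. Qed.

Let rV_bigcup (F : _^nat) : (forall i, g_sigma_preimage rV_coord (F i)) ->
  g_sigma_preimage rV_coord (\bigcup_i (F i)).
Proof. exact: sigma_algebra_bigcup. Qed.

(* The sigma-algebra generated by the coordinates is the Borel sigma-algebra
   of R^n; every class of L^2(R^n) has a Borel representative. *)
HB.instance Definition _ :=
  @isMeasurable.Build (measure_tuple_display default_measure_display)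
    'rV[R]_n (g_sigma_preimage rV_coord) rV_set0 rV_setC rV_bigcup.

End measurable_rV.

Section lebesgue_rV.
Context {R : realType}.

Lemma measurable_rV_coord n (i : 'I_n) :
  measurable_fun [set: 'rV[R]_n] (rV_coord i).
Proof.
move=> _ Y mY; rewrite setTI; apply: sub_sigma_algebra => /=.
rewrite -bigcup_seq/=; exists i => /=; first by rewrite mem_index_enum.
by exists Y => //; rewrite setTI.
Qed.

Lemma measurable_fun_rVP d (T : measurableType d) n (f : T -> 'rV[R]_n) :
  measurable_fun [set: T] f <->
  forall i, measurable_fun [set: T] (rV_coord i \o f).
Proof.
split=> [mf i|mf]; first exact: measurableT_comp (measurable_rV_coord i) mf.
suff : @measurable _ 'rV[R]_n `<=` [set A | measurable (f @^-1` A)].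
  by move=> h _ A /h; rewrite setTI.
apply: smallest_sub => /=.
  split=> /=; first by rewrite preimage_set0.
  - by move=> A mA; rewrite setTD preimage_setC; exact: measurableC.
  - by move=> F mF; rewrite preimage_bigcup; exact: bigcupT_measurable.
rewrite -bigcup_seq; apply: bigcup_sub => i _ _ [B mB <-] /=.
by have := mf i measurableT B mB; rewrite !setTI comp_preimage.
Qed.

Definition rV_cons n (p : measurableTypeR R * 'rV[R]_n) : 'rV[R]_n.+1 :=
  \row_i oapp (p.2 ord0) p.1 (unlift ord0 i).

Lemma measurable_rV_cons n : measurable_fun setT (@rV_cons n).
Proof.
apply/measurable_fun_rVP => i.
have [j ->|->] := unliftP ord0 i.
  rewrite (_ : _ \o _ = rV_coord j \o snd).
    exact: measurableT_comp (measurable_rV_coord j) measurable_snd.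
  by apply/funext => p; rewrite /= /rV_coord mxE liftK.
rewrite (_ : _ \o _ = fst); first exact: measurable_fst.
by apply/funext => p; rewrite /= /rV_coord mxE unlift_none.
Qed.

HB.instance Definition _ n :=
  isMeasurableFun.Build _ _ _ _ (@rV_cons n) (@measurable_rV_cons n).

Definition rV_uncons n (x : 'rV[R]_n.+1) : measurableTypeR R * 'rV[R]_n :=
  (rV_coord ord0 x, \row_i x ord0 (lift ord0 i)).

Lemma measurable_rV_uncons n : measurable_fun setT (@rV_uncons n).
Proof.
apply/measurable_fun_pair; first exact: measurable_rV_coord.
apply/measurable_fun_rVP => i.
rewrite (_ : _ \o _ = rV_coord (lift ord0 i)); first exact: measurable_rV_coord.
by apply/funext => x; rewrite /= /rV_coord mxE.
Qed.

Lemma rV_consK n : cancel (@rV_cons n) (@rV_uncons n).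
Proof.
case=> x y; congr pair; first by rewrite /rV_coord mxE unlift_none.
by apply/rowP => i; rewrite !mxE liftK.
Qed.

Section rV_cons_measure.
Local Open Scope ereal_scope.
Context n (m : {sigma_finite_measure set 'rV[R]_n -> \bar R}).

Definition rV_cons_measure : set 'rV[R]_n.+1 -> \bar R :=
  pushforward (lebesgue_measure \x m) (@rV_cons n).

Let rV_cons_measure0 : rV_cons_measure set0 = 0.
Proof. exact: measure0. Qed.

Let rV_cons_measure_ge0 A : 0 <= rV_cons_measure A.
Proof. exact: measure_ge0. Qed.

Let rV_cons_measure_sigma_additive : semi_sigma_additive rV_cons_measure.
Proof. exact: measure_semi_sigma_additive. Qed.

HB.instance Definition _ := isMeasure.Build _ _ _ rV_cons_measure
  rV_cons_measure0 rV_cons_measure_ge0 rV_cons_measure_sigma_additive.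

Let rV_cons_measure_sigma_finite : sigma_finite setT rV_cons_measure.
Proof.
pose l : {sigma_finite_measure set (measurableTypeR R) -> \bar R} :=
  lebesgue_measure.
have /sigma_finiteP[F [TF ndF Foo]] := sigma_finiteT l.
have /sigma_finiteP[G [TG ndG Goo]] := sigma_finiteT m.
exists (fun k => @rV_uncons n @^-1` (F k `*` G k)).
  rewrite -preimage_bigcup (_ : \bigcup_k _ = setT) ?preimage_setT//.
  apply/seteqP; split=> // -[x y] _.
  have [a _ Fx] : (\bigcup_k F k) x by rewrite -TF.
  have [b _ Gy] : (\bigcup_k G k) y by rewrite -TG.
  exists (maxn a b) => //; split => /=.
    by move: x Fx; exact/subsetPset/ndF/leq_maxl.
  by move: y Gy; exact/subsetPset/ndG/leq_maxr.
move=> k; have [mF lF] := Foo k; have [mG lG] := Goo k.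
have mFG : measurable (F k `*` G k) by exact: measurableX.
split; first by rewrite -[X in measurable X]setTI; exact: measurable_rV_uncons.
rewrite /rV_cons_measure /pushforward (_ : _ @^-1` _ = F k `*` G k).
  by rewrite product_measure1E// lte_mul_pinfty// ge0_fin_numE.
by apply/funext => p; rewrite /preimage/mkset rV_consK.
Qed.

HB.instance Definition _ := Measure_isSigmaFinite.Build _ _ _
  rV_cons_measure rV_cons_measure_sigma_finite.

End rV_cons_measure.

(* Lebesgue measure on R^n, as an n-fold product of one-dimensional ones. *)
Fixpoint lebesgue_rV n : {sigma_finite_measure set 'rV[R]_n -> \bar R} :=
  match n with
  | 0 => \d_(0 : 'rV[R]_0)
  | k.+1 => rV_cons_measure (lebesgue_rV k)
  end.

Lemma lebesgue_rV_box n (A : 'I_n -> set R) :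
  (forall i, measurable (A i)) ->
  lebesgue_rV n [set x | forall i, A i (x ord0 i)] =
  (\prod_(i < n) lebesgue_measure (A i))%E.
Proof.
elim: n A => [|n IHn] A mA.
  rewrite big_ord0 /= diracE mem_set//=; by case.
rewrite big_ord_recl -IHn; last by move=> i; exact: mA.
rewrite /= /rV_cons_measure /pushforward -product_measure1E//; last first.
- rewrite [X in measurable X](_ : _ =
      \bigcap_(i in [set: 'I_n]) (rV_coord i @^-1` A (lift ord0 i))).
    apply: fin_bigcap_measurable => // i _.
    by rewrite -[X in measurable X]setTI; exact: measurable_rV_coord.
  by apply/seteqP; split=> x /= h i; [move=> _|]; exact: h.
- exact: mA.
congr ((_ \x _)%E _); apply/seteqP; split=> -[x y] /=.
  move=> h; split; first by have := h ord0; rewrite mxE unlift_none.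
  by move=> i; have := h (lift ord0 i); rewrite mxE liftK.
move=> [h0 h] i; rewrite mxE.
by have [j ->|->] := unliftP ord0 i => //=; exact: h.
Qed.

End lebesgue_rV.

Section test_functions.
Context {R : realType} {E : normedModType R}.

Definition iter_derive (vs : seq E) (f : E -> R) : E -> R :=
  foldr (fun v g => 'D_v g) f vs.

(* C^oo: all iterated directional derivatives are Frechet differentiable. *)
Definition smooth (f : E -> R) : Prop :=
  forall (vs : seq E) (x : E), differentiable (iter_derive vs f) x.

Definition supp (f : E -> R) : set E := closure [set x | f x != 0].

Definition test_function (D : set E) (f : E -> R) : Prop :=
  [/\ smooth f, compact (supp f) & supp f `<=` D].

End test_functions.

Section Sobolev.
Context {R : realType} {n : nat}.
Local Notation mu := (@lebesgue_rV R n).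

(* The norm of the normed module 'rV[R]_n is the sup norm. *)
Definition euclid (v : 'rV[R]_n) : R := Num.sqrt (\sum_(i < n) v ord0 i ^+ 2).

Definition L2 (f : 'rV[R]_n -> R) : Prop := f \in Lfun mu 2%:E.

Definition L2norm (f : 'rV[R]_n -> R) : \bar R := 'N[mu]_2%:E[EFin \o f].

Definition weak_gradient (f : 'rV[R]_n -> R) (Df : 'rV[R]_n -> 'rV[R]_n) :=
  forall (i : 'I_n) (psi : 'rV[R]_n -> R), test_function setT psi ->
    \int[mu]_x (f x * 'D_(delta_mx ord0 i) psi x) =
    - \int[mu]_x (Df x ord0 i * psi x).

(* f belongs to H^1(R^n) and Df represents its gradient. *)
Definition H1 (f : 'rV[R]_n -> R) (Df : 'rV[R]_n -> 'rV[R]_n) : Prop :=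
  [/\ L2 f, forall i, L2 (fun x => Df x ord0 i) & weak_gradient f Df].

Definition H1norm (f : 'rV[R]_n -> R) (Df : 'rV[R]_n -> 'rV[R]_n) : \bar R :=
  ((L2norm f ^+ 2 + L2norm (euclid \o Df) ^+ 2) `^ 2^-1)%E.

(* In the next three definitions a map from [0, +oo[ into L^2 or H^1 is given by
   representatives, one for each time; its values at negative times play no
   role. *)
Definition continuous_L2 (u : R -> 'rV[R]_n -> R) : Prop :=
  forall t, 0 <= t -> L2 (u t) /\
    L2norm (u s \- u t) @[s --> within `[0, +oo[ (nbhs t)] --> 0%E.

Definition continuous_H1 (u : R -> 'rV[R]_n -> R)
    (Du : R -> 'rV[R]_n -> 'rV[R]_n) : Prop :=
  forall t, 0 <= t -> H1 (u t) (Du t) /\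
    H1norm (u s \- u t) (Du s \- Du t) @[s --> within `[0, +oo[ (nbhs t)]
      --> 0%E.

(* u is in C^1([0, +oo[; L^2) with derivative ut; t^' excludes s = t. *)
Definition C1_L2 (u ut : R -> 'rV[R]_n -> R) : Prop :=
  [/\ continuous_L2 u, continuous_L2 ut &
    forall t, 0 <= t ->
      L2norm (fun x => (s - t)^-1 * (u s x - u t x) - ut t x)
        @[s --> within `[0, +oo[ t^'] --> 0%E].

End Sobolev.

Section damped_wave.
Context {R : realType} {n : nat}.
Local Notation mu := (@lebesgue_rV R n).
Local Notation spacetime := (R * 'rV[R]_n)%type.

Definition dt (phi : spacetime -> R) : spacetime -> R := 'D_(1, 0) phi.

Definition dx (i : 'I_n) (phi : spacetime -> R) : spacetime -> R :=
  'D_(0, delta_mx ord0 i) phi.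

Definition laplacian (phi : spacetime -> R) (z : spacetime) : R :=
  \sum_(i < n) dx i (dx i phi) z.

(* The distribution on ]0, +oo[ x R^n defined by u in C([0, +oo[; L^2) is
   phi |-> \int_0^oo (\int u(t, x) phi(t, x) dx) dt; the formal adjoint of the
   damped wave operator is applied to phi. The inner integrand is a product of
   two L^2 functions, and the inner integral is continuous in t and vanishes
   outside a compact subset of ]0, +oo[. *)
Definition damped_wave_distr (V : 'rV[R]_n -> R) (u : R -> 'rV[R]_n -> R) :=
  forall phi : spacetime -> R, test_function [set z : spacetime | 0 < z.1] phi ->
    \int[lebesgue_measure]_(t in `]0, +oo[)
      \int[mu]_x (u t x * (dt (dt phi) (t, x) - laplacian phi (t, x)
                           + V x * phi (t, x) - dt phi (t, x))) = 0.

Record weak_solution (V u0 u1 : 'rV[R]_n -> R) (u ut : R -> 'rV[R]_n -> R)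
    (Du : R -> 'rV[R]_n -> 'rV[R]_n) : Prop := {
  weak_solution_H1 : continuous_H1 u Du;
  weak_solution_C1 : C1_L2 u ut;
  weak_solution_eq : damped_wave_distr V u;
  weak_solution_u0 : u 0 = u0 %[ae mu];
  weak_solution_u1 : ut 0 = u1 %[ae mu] }.

Definition energy (V : 'rV[R]_n -> R) (u ut : R -> 'rV[R]_n -> R)
    (Du : R -> 'rV[R]_n -> 'rV[R]_n) (t : R) : \bar R :=
  ((2^-1)%:E * \int[mu]_x
    (ut t x ^+ 2 + euclid (Du t x) ^+ 2 + V x * u t x ^+ 2)%:E)%E.

Definition K0_sq (V u0 u1 : 'rV[R]_n -> R) : \bar R :=
  (\int[mu]_x ((u1 x + u0 x) ^+ 2 / V x)%:E)%E.

Definition data_sq (V u0 u1 : 'rV[R]_n -> R) (Du0 : 'rV[R]_n -> 'rV[R]_n) :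
    \bar R :=
  (L2norm u0 ^+ 2 + L2norm u1 ^+ 2 + L2norm (euclid \o Du0) ^+ 2
   + K0_sq V u0 u1)%E.

End damped_wave.

(* Main.v *)
(* Let a(f, g) = (grad f, grad g) + (V f, g) and 2E = a(u, u) + |u_t|^2. Testing
   the equation with theta(t) psi(x), and approximating H^1 functions by test
   functions (cut-off and mollification), gives for every w in H^1 and s > 0
     d/ds (u_t(s), w) = - a(u(s), w) - (u_t(s), w).
   As u_t is only in L^2, w = u_t is not allowed. But by symmetry of a,
   Phi_h(t) = (u_t(t), u(t + h)) - (u_t(t + h), u(t)) solves Phi_h' = - Phi_h, and
   the limit h -> 0 of Phi_h / h yields the exact law 2E + (u_t, u) = c e^{-t},
   hence E' = - |u_t|^2.
   With y = |u|^2, Y(t) = int_0^t y and e = 2E, the functional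
     G = (t + t^2/2) e + (1 + t) y / 2 - Y / 2 + c (2 + t) e^{-t}
   satisfies G' = (t + t^2/2) e' <= 0, so both estimates follow from a bound on Y.
   For that, integrate the equation in time,
     (u_t + u)(t) = (u_1 + u_0) - int_0^t A u  with  (A f, g) = a(f, g),
   pair with u(t) and integrate over [0, T]: with w = int_0^T u this gives
     y(T) / 2 + Y(T) - y(0) / 2 = (u_1 + u_0, w) - a(w, w) / 2 <= K_0^2 / 2,
   the last step being Young's inequality under the integral. Integrals of
   H^1-valued functions are avoided by using Riemann sums. *)
Require Import Defs.
From HB Require Import structures.
From mathcomp Require Import all_boot all_order all_algebra.
From mathcomp Require Import all_classical all_reals all_analysis.
From mathcomp Require Import measurable_realfun ring lra.
Set Implicit Arguments.
Unset Strict Implicit.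
Unset Printing Implicit Defensive.
Import Order.TTheory GRing.Theory Num.Theory.
Import numFieldNormedType.Exports.
Local Open Scope classical_set_scope.
Local Open Scope ring_scope.

(** * Semi-inner products and calculus on the line *)

(** The elements of [LfunType] are functions, not classes, so a pairing can vanish on a nonzero
    element; everything is therefore phrased with semi-inner products. The decay argument is
    abstract and uses no completeness: it differentiates only scalar functions of time and forms
    only finite sums of states. The weight 1/V reaches it through a single inequality, namely that
    (u_1 + u_0, w) - a(w, w)/2 never exceeds K_0^2/2; in other words, K_0 bounds the norm of u_1 +
    u_0 dual to a. On the concrete side the obstacle is regularity in time. The pairing (u_t, phi)
    is a priori only continuous, and a lemma of du Bois-Reymond type turns the distributional
    identity into a derivative at every positive time. Passing from test functions to H^1 must
    preserve that derivative, so it is done on increments, with estimates uniform over the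
    approximants. The functional G comes from the conservation law multiplied by 1 + t: the term (1
    + t)(u_t, u) is half of (1 + t) y', and integrating by parts leaves y alone to be controlled in
    time average. *)

Lemma cvg_dist_le {R : realFieldType} {T : Type} (F : set_system T) {FF : Filter F}
    (f B : T -> R) (l : R) :
  (forall s, `|f s - l| <= B s) -> B s @[s --> F] --> 0 -> f s @[s --> F] --> l.
Proof.
move=> fB B0; apply/cvgrPdistC_le => e e0.
move/cvgrPdistC_le : B0 => /(_ e e0); apply: filterS => s; rewrite subr0; apply: le_trans.
by rewrite (le_trans (fB s))// ler_norm.
Qed.

Section semi_inner_product.
Context {R : realType} {X : lmodType R}.

Record semi_inner (ip : X -> X -> R) : Prop := {
  semi_innerC : forall x y, ip x y = ip y x;
  semi_inner_lin : forall c x y z, ip (c *: x + y) z = c * ip x z + ip y z;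
  semi_inner_ge0 : forall x, 0 <= ip x x }.

Definition snorm (ip : X -> X -> R) (x : X) : R := Num.sqrt (ip x x).

Variable ip : X -> X -> R.
Hypothesis sip : semi_inner ip.

Lemma siDl x y z : ip (x + y) z = ip x z + ip y z.
Proof. by rewrite -[x]scale1r (semi_inner_lin sip) mul1r scale1r. Qed.

Lemma si0l z : ip 0 z = 0.
Proof. by have := siDl 0 0 z; rewrite addr0 => /eqP; rewrite -subr_eq0 opprD addNKr oppr_eq0
  => /eqP. Qed.

Lemma siZl c x z : ip (c *: x) z = c * ip x z.
Proof. by rewrite -[c *: x]addr0 (semi_inner_lin sip) si0l addr0. Qed.

Lemma siNl x z : ip (- x) z = - ip x z.
Proof. by rewrite -scaleN1r siZl mulN1r. Qed.

Lemma siBl x y z : ip (x - y) z = ip x z - ip y z.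
Proof. by rewrite siDl siNl. Qed.

Lemma siDr x y z : ip z (x + y) = ip z x + ip z y.
Proof. by rewrite !(semi_innerC sip z) siDl. Qed.

Lemma siZr c x z : ip z (c *: x) = c * ip z x.
Proof. by rewrite !(semi_innerC sip z) siZl. Qed.

Lemma siBr x y z : ip z (x - y) = ip z x - ip z y.
Proof. by rewrite !(semi_innerC sip z) siBl. Qed.

Lemma snorm_ge0 x : 0 <= snorm ip x.
Proof. exact: sqrtr_ge0. Qed.

Lemma sqr_snorm x : snorm ip x ^+ 2 = ip x x.
Proof. by rewrite sqr_sqrtr ?(semi_inner_ge0 sip). Qed.

Lemma snormN x : snorm ip (- x) = snorm ip x.
Proof. by rewrite /snorm siNl (semi_innerC sip) siNl opprK. Qed.

Lemma cauchy_schwarz x y : `|ip x y| <= snorm ip x * snorm ip y.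
Proof.
have pos c : 0 <= ip x x - 2 * c * ip x y + c ^+ 2 * ip y y.
  have := semi_inner_ge0 sip (x - c *: y).
  rewrite siBl !siBr !siZl !siZr (semi_innerC sip y x).
  by congr (_ <= _); ring.
rewrite -(@ler_pXn2r _ 2)// ?nnegrE ?mulr_ge0 ?snorm_ge0//.
rewrite exprMn !sqr_snorm real_normK ?num_real//.
have [yy0|yy0] := eqVneq (ip y y) 0.
  suff -> : ip x y = 0 by rewrite yy0 expr0n mulr0.
  apply: contrapT => /eqP xy0.
  (* When [y] has seminorm zero, [pos] bounds an affine function of [c] from below; at this [c] its
     value is -1. *)
  have := pos ((ip x x + 1) / (2 * ip x y)).
  rewrite yy0 mulr0 addr0.
  have -> : 2 * ((ip x x + 1) / (2 * ip x y)) * ip x y = ip x x + 1 by field.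
  by lra.
have yy_gt0 : 0 < ip y y by rewrite lt_neqAle eq_sym yy0 (semi_inner_ge0 sip).
(* The minimiser of the quadratic polynomial in [c]. *)
have := pos (ip x y / ip y y).
have -> : ip x x - 2 * (ip x y / ip y y) * ip x y + (ip x y / ip y y) ^+ 2 * ip y y =
  (ip x x * ip y y - ip x y ^+ 2) / ip y y by field.
by rewrite pmulr_lge0 ?invr_gt0// subr_ge0.
Qed.

Lemma ler_snormD x y : snorm ip (x + y) <= snorm ip x + snorm ip y.
Proof.
rewrite -(@ler_pXn2r _ 2)// ?nnegrE ?addr_ge0 ?snorm_ge0//.
rewrite sqr_snorm siDl !siDr (semi_innerC sip y x) sqrrD !sqr_snorm.
have := le_trans (ler_norm _) (cauchy_schwarz x y); lra.
Qed.

Lemma snorm_distC x y : snorm ip (x - y) = snorm ip (y - x).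
Proof. by rewrite -snormN opprB. Qed.

Lemma ip_cvg {T : Type} (F : set_system T) (FF : Filter F)
    (f g : T -> X) (x y : X) :
  snorm ip (f s - x) @[s --> F] --> 0 -> snorm ip (g s - y) @[s --> F] --> 0 ->
  ip (f s) (g s) @[s --> F] --> ip x y.
Proof.
move=> fx gy.
pose B s := snorm ip (f s - x) * snorm ip (g s - y) + snorm ip x * snorm ip (g s - y)
   + snorm ip (f s - x) * snorm ip y.
have B0 : B s @[s --> F] --> 0.
  rewrite [X in _ --> X](_ : 0 = 0 * 0 + snorm ip x * 0 + 0 * snorm ip y); last first.
    by rewrite !mulr0 mul0r !addr0.
  by apply: cvgD; [apply: cvgD|]; apply: cvgM => //; exact: cvg_cst.
apply: (cvg_dist_le _ B0) => s.
have -> : ip (f s) (g s) - ip x y =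
  ip (f s - x) (g s - y) + ip x (g s - y) + ip (f s - x) y.
  rewrite !siBl !siBr; ring.
rewrite (le_trans (ler_normD _ _))// lerD ?cauchy_schwarz//.
by rewrite (le_trans (ler_normD _ _))// lerD ?cauchy_schwarz.
Qed.

End semi_inner_product.

Lemma is_derive1_slope {R : realType} (f : R -> R) (x d : R) :
  is_derive x 1 f d <-> (s - x)^-1 * (f s - f x) @[s --> x^'] --> d.
Proof.
split.
  move=> /is_derive1_caratheodory[g [fg /continuous_withinNx cg <-]].
  apply: cvg_trans cg; apply: near_eq_cvg.
  near=> s; rewrite fg mulrCA mulVf ?mulr1// subr_eq0.
  by near: s; exact: nbhs_dnbhs_neq.
move=> fd; apply/is_derive1_caratheodory.
exists (fun z => if z == x then d else (z - x)^-1 * (f z - f x)); split.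
- move=> z; have [->|zx] := eqVneq z x; first by rewrite !subrr mulr0.
  by rewrite mulrAC mulVf ?mul1r// subr_eq0.
- apply/continuous_withinNx; rewrite eqxx.
  apply: cvg_trans fd; apply: near_eq_cvg.
  near=> s; rewrite ifF//; apply/negbTE.
  by near: s; exact: nbhs_dnbhs_neq.
- by rewrite eqxx.
Unshelve. all: by end_near. Qed.

Lemma cvg_dnbhs_shift {R : realFieldType} (h t : R) :
  s + h @[s --> t^'] --> (t + h)^'.
Proof.
move=> A /nbhs_ballP[r r0 rA]; apply/nbhs_ballP; exists r => // s /= ts st.
apply: rA; last by rewrite (inj_eq (addIr h)).
by move: ts; rewrite /ball/= opprD addrACA subrr addr0.
Qed.

(** A product rule in which [p] is only continuous in norm: its contribution is the derivative of
    the scalar function whose second argument is frozen at [q x]. This suits p = u_t, which can be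
    differentiated in time only after pairing with a fixed vector. *)
Lemma ip_is_derive {R : realType} {X : lmodType R} (ip : X -> X -> R)
    (sip : semi_inner ip) (p q : R -> X) (x d : R) (q' : X) :
  snorm ip (p s - p x) @[s --> x] --> 0 ->
  is_derive x 1 (fun s => ip (p s) (q x)) d ->
  snorm ip ((s - x)^-1 *: (q s - q x) - q') @[s --> x^'] --> 0 ->
  is_derive x 1 (fun s => ip (p s) (q s)) (d + ip (p x) q').
Proof.
move=> cp /is_derive1_slope dp dq; apply/is_derive1_slope.
have {}cp : snorm ip (p s - p x) @[s --> x^'] --> 0.
  by apply: cvg_trans cp; exact/cvg_app/cvg_within.
have E s : (s - x)^-1 * (ip (p s) (q s) - ip (p x) (q x)) =
    (s - x)^-1 * (ip (p s) (q x) - ip (p x) (q x)) +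
      ip (p s) ((s - x)^-1 *: (q s - q x)).
  by rewrite (siZr sip) (siBr sip) -mulrDr; congr (_ * _); ring.
by rewrite (eq_cvg _ _ E); apply: cvgD => //; exact: (ip_cvg sip).
Qed.

(** Choosing [a] to the left of the interval of interest makes the primitive differentiable, hence
    continuous, at the left end of that interval as well. *)
Lemma primitive_exists {R : realType} (f : R -> R) (a : R) : continuous f ->
  exists F : R -> R, forall x, a < x -> is_derive x 1 F (f x).
Proof.
move=> cf.
exists (fun x => \int[lebesgue_measure]_(t in `[a, x]) f t)%R => x ax.
have [] := @continuous_FTC1_closed R f a x (x + 1) _ _ ax (cf x).
- by rewrite ltrDl.
- apply: continuous_compact_integrable; first exact: segment_compact.
  exact: continuous_subspaceT.
- by move=> dF Fx; split; [exact: dF | rewrite -derive1E; exact: Fx].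
Qed.

(** Heine's theorem for a pseudometric on the line, such as the seminorm distance between two values
    of a curve. Only [t] is confined to the segment. *)
Lemma uniform_on_segment {R : realType} (D : R -> R -> R) (T eps : R) :
  (forall s t, 0 <= D s t) -> (forall s t, D s t = D t s) ->
  (forall s t r, D s r <= D s t + D t r) ->
  (forall t, D s t @[s --> t] --> 0) -> 0 < eps ->
  exists2 d : R, 0 < d & forall s t : R, 0 <= t <= T -> `|s - t| < d -> D s t <= eps.
Proof.
move=> D_ge0 DC Dtri Dc eps0.
have /compact_near_coveringP := @segment_compact R 0 T.
move=> /(_ R (0^'+) (fun d t => forall s, `|s - t| < d -> D s t <= eps) _).
move=> H; have {H} : \forall d \near 0^'+, `[0, T] `<=`
    (fun t => forall s, `|s - t| < d -> D s t <= eps).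
  apply: H => t _.
  have e20 : 0 < eps / 2 by rewrite divr_gt0.
  have /cvgrPdistC_le/(_ _ e20)/nbhs_ballP[r /= r0 rU] := Dc t.
  have r20 : 0 < r / 2 by rewrite divr_gt0.
  exists (ball t (r / 2), [set d | 0 < d < r / 2]) => /=.
    split; first exact: nbhsx_ballx.
    near=> d => /=; apply/andP; split=> //; near: d; exact: nbhs_right_lt.
  move=> [t' d] /= [tt' /andP[d0 dr]] s st'.
  have B r' : ball t r r' -> D r' t <= eps / 2.
    by move=> /rU /=; rewrite subr0 ger0_norm.
  rewrite (le_trans (Dtri _ t _))// [leRHS]splitr lerD//.
    apply: B; rewrite /ball/= (_ : t - s = (t - t') - (s - t')); last by ring.
    rewrite (le_lt_trans (ler_normB _ _))// [ltRHS]splitr ltrD//.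
    exact: lt_trans dr.
  rewrite DC; apply: B; rewrite /ball/= (lt_trans tt')//.
  by rewrite ltr_pdivrMr// mulr_natr mulr2n ltrDl.
move=> H; have [d [d0 dP]] := filter_ex (filterI (nbhs_right_gt (0 : R)) H).
by exists d => // s t t0T; apply: dP; rewrite /= in_itv.
Unshelve. all: by end_near. Qed.

(** * Decay for an abstract damped wave equation *)

Section damped_wave_hilbert.
Context {R : realType} {X Y : lmodType R}.
Variables (ip : X -> X -> R) (a : Y -> Y -> R) (iota : Y -> X).
Hypotheses (sip : semi_inner ip) (sa : semi_inner a).
Hypothesis iotaD : forall c x y, iota (c *: x + y) = c *: iota x + iota y.
Variables (U : R -> Y) (v : R -> X) (K : R).
Local Notation u := (fun t => iota (U t)).
Hypothesis Uc : forall t, snorm a (U s - U t) @[s --> t] --> 0.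
Hypothesis uc : forall t, snorm ip (u s - u t) @[s --> t] --> 0.
Hypothesis vc : forall t, snorm ip (v s - v t) @[s --> t] --> 0.
Hypothesis ud : forall t : R, 0 < t ->
  snorm ip ((s - t)^-1 *: (u s - u t) - v t) @[s --> t^'] --> 0.
(** All test vectors lie on the trajectory itself, at a time [tau] that may differ from [s]; this
    covers both the shifted pairings and the Riemann sums. *)
Hypothesis wave : forall s tau : R, 0 < s -> 0 <= tau ->
  is_derive s 1 (fun s => ip (v s) (u tau))
    (- a (U s) (U tau) - ip (v s) (u tau)).
Hypothesis K0_ge0 : 0 <= K.
(** The supremum over [y] of the left-hand side is half the squared norm of [v 0 + u 0] dual to [a].
    With K = K_0^2, the bound will come from Young's inequality with weight V. *)
Hypothesis K0_dual : forall y : Y,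
  ip (v 0 + u 0) (iota y) - 2^-1 * a y y <= 2^-1 * K.

(** The quadratic quantities are kept with two time arguments because the conservation law arises
    from comparing different times. On the diagonal, [e] is twice the energy and [F] is the quantity
    that decays exactly like e^{-t}. *)
Let k s t := ip (v s) (u t).
Let m s t := ip (v s) (v t).
Let al s t := a (U s) (U t).
Let F t := al t t + m t t + k t t.
Let e t := al t t + m t t.
Let y t := ip (u t) (u t).

Lemma diag_continuous (Z : lmodType R) (b : Z -> Z -> R) (sb : semi_inner b)
    (f g : R -> Z) :
  (forall t, snorm b (f s - f t) @[s --> t] --> 0) ->
  (forall t, snorm b (g s - g t) @[s --> t] --> 0) ->
  continuous (fun t => b (f t) (g t)).
Proof. by move=> fc gc t; apply: (ip_cvg sb). Qed.

Lemma snorm_shift_cvg (Z : lmodType R) (b : Z -> Z -> R) (f : R -> Z) (h t : R) :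
  (forall t, snorm b (f s - f t) @[s --> t] --> 0) ->
  snorm b (f (s + h) - f (t + h)) @[s --> t] --> 0.
Proof.
move=> fc; apply: (@cvg_comp _ _ _ (fun s : R => s + h) (fun s => snorm b (f s - f (t + h)))
  (nbhs t) (nbhs (t + h))); last exact: fc.
by apply: cvgD; [exact: cvg_id|exact: cvg_cst].
Qed.

(** Freezing the second factor means testing the equation with u(t + h), which lies in the energy
    space; the velocity enters only through the difference quotient of u. *)
Lemma wave_deriv_shiftr (h t : R) : 0 <= h -> 0 < t ->
  is_derive t 1 (fun s => k s (s + h)) (- al t (t + h) - k t (t + h) + m t (t + h)).
Proof.
move=> h0 t0; apply: (@ip_is_derive _ _ ip sip v (fun s => u (s + h))).
- exact: vc.
- by apply: wave => //; rewrite addr_ge0// ltW.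
- have th0 : 0 < t + h by rewrite ltr_wpDr.
  have := cvg_comp _ _ (cvg_dnbhs_shift (h := h) (t := t)) (ud th0).
  have E (s : R) : s - t = s + h - (t + h) by ring.
  by under [in X in _ -> X]eq_fun do rewrite E.
Qed.

Lemma wave_deriv_shiftl (h t : R) : 0 <= h -> 0 < t ->
  is_derive t 1 (fun s => k (s + h) s) (- al (t + h) t - k (t + h) t + m (t + h) t).
Proof.
move=> h0 t0; apply: (@ip_is_derive _ _ ip sip (fun s => v (s + h)) u).
- exact: snorm_shift_cvg.
- have th0 : 0 < t + h by rewrite ltr_wpDr.
  have := wave th0 (ltW t0) => H.
  have := @is_derive1_comp R _ (fun s => s + h) t _ 1 H.
  rewrite mulr1; apply.
  have : is_derive t 1 (fun s : R => s + h) (1 + 0) by apply: is_deriveD.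
  by rewrite addr0.
- exact: ud.
Qed.

Let expF0 (s t : R) : 0 < s -> s <= t -> expR t * F t = expR s * F s.
Proof.
move=> s0 st.
pose Phi h r := expR r * (k r (r + h) - k (r + h) r).
have Phic (h : R) : 0 <= h -> Phi h t = Phi h s.
  move=> h0.
  have dPhi (r : R) : 0 < r -> is_derive r 1 (Phi h) 0.
    move=> r0.
    have := is_deriveM (is_derive_expR r)
      (is_deriveB (wave_deriv_shiftr h0 r0) (wave_deriv_shiftl h0 r0)).
    move=> D; apply: is_derive_eq D _.
    rewrite /GRing.scale/= /al /m (semi_innerC sa (U (r + h))) (semi_innerC sip (v (r + h))).
    rewrite [X in X * expR r](_ : _ = k r (r + h) - k (r + h) r)//.
    by ring.
  have [||c _] := @MVT_segment R (Phi h) (fun=> 0) s t st.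
  - move=> r /itvP rs; apply: dPhi; rewrite (lt_le_trans s0)//; by rewrite rs.
  - apply: derivable_within_continuous => r; rewrite in_itv/= => /andP[sr _].
    by have := dPhi r (lt_le_trans s0 sr); move=> [].
  - by rewrite mul0r => /eqP; rewrite subr_eq0 => /eqP.
(* The derivative of the antisymmetric difference at h = 0, with [r] fixed: the motion of u in the
   first term gives [m], the equation in the second gives [al] + [k]. *)
have dPsi (r : R) : 0 < r -> is_derive r 1 (fun s => k r s - k s r) (F r).
  move=> r0.
  have := is_deriveB (ip_is_derive sip (p := fun=> v r) (q := u) (x := r) (d := 0) _ _ (ud r0))
     (wave r0 (ltW r0)).
  have H0 : snorm ip (v r - v r) @[s --> r] --> 0.
    rewrite subrr /snorm (si0l sip) sqrtr0; exact: cvg_cst.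
  move=> /(_ H0 (is_derive_cst _ _ _)) D; apply: is_derive_eq D _.
  by rewrite /F /al /m /k; ring.
(* The limit is one-sided because [Phic] is available for h >= 0 only. *)
have lim (r : R) : 0 < r -> h^-1 * Phi h r @[h --> 0^'+] --> expR r * F r.
  move=> r0.
  have /is_derive1_slope := dPsi _ r0; rewrite subrr => H.
  have H2 : (h + r - r)^-1 * (k r (h + r) - k (h + r) r - 0) @[h --> 0^'] --> F r.
    have S := @cvg_dnbhs_shift R r 0; rewrite add0r in S.
    exact: (cvg_comp _ _ S H).
  have H3 : expR r * ((h + r - r)^-1 * (k r (h + r) - k (h + r) r - 0)) @[h --> 0^'+] -->
    expR r * F r.
    apply: cvgM; first exact: cvg_cst.
    move=> A /H2; rewrite /nbhs/= /at_right /dnbhs /within/=.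
    by apply: filterS => z zA z0; apply: zA; rewrite gt_eqF.
  move: H3; rewrite (@eq_cvg _ _ _ _ (fun h => h^-1 * Phi h r))// => h.
  by rewrite addrK subr0 mulrCA (addrC h).
have L1 := lim _ s0; have L2 := lim _ (lt_le_trans s0 st).
apply: (cvg_unique _ L2) => //.
apply: cvg_trans L1; apply: near_eq_cvg.
near=> h; rewrite Phic//; near: h; exact: nbhs_right_ge.
Unshelve. all: by end_near. Qed.

Let kc : continuous (fun t => k t t).
Proof. exact: (@diag_continuous X ip sip v u vc uc). Qed.

Let ec : continuous e.
Proof.
by move=> t; apply: cvgD;
  [exact: (diag_continuous sa Uc Uc)|exact: (diag_continuous sip vc vc)].
Qed.

Let yc : continuous y.
Proof. exact: (@diag_continuous X ip sip u u uc uc). Qed.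

Let FE (t : R) : 0 <= t -> F t = expR (- t) * F 0.
Proof.
move=> t0; suff : expR t * F t = F 0.
  by move=> <-; rewrite mulrA -expRD addNr expR0 mul1r.
have [->|t_neq0] := eqVneq t 0; first by rewrite expR0 mul1r.
have t_gt0 : 0 < t by rewrite lt_neqAle eq_sym t_neq0.
(* The equation holds at positive times; time 0 is reached by continuity. *)
have Fc : expR s * F s @[s --> 0^'+] --> F 0.
  rewrite -[X in _ --> X]mul1r -expR0; apply: cvgM.
    apply: cvg_at_right_filter; exact: continuous_expR.
  apply: cvg_at_right_filter; apply: cvgD; [exact: ec|exact: kc].
apply: (cvg_unique _ _ Fc) => //.
apply: cvg_near_cst.
near=> s; rewrite (@expF0 s t)//.
by near: s; apply: nbhs_right_le.
Unshelve. all: by end_near. Qed.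

Let dk (t : R) : 0 < t -> is_derive t 1 (fun t => k t t) (- al t t - k t t + m t t).
Proof.
move=> t0; have := wave_deriv_shiftr (lexx 0) t0.
by rewrite addr0; under eq_fun do rewrite addr0.
Qed.

Let dy (t : R) : 0 < t -> is_derive t 1 y (2 * k t t).
Proof.
move=> t0.
have D1 : is_derive t 1 (fun s => ip (u t) (u s)) (ip (u t) (v t)).
  have := ip_is_derive sip (p := fun=> u t) (q := u) (x := t) (d := 0) _ _ (ud t0).
  move=> D; rewrite -[X in is_derive _ _ _ X]add0r; apply: D.
    rewrite subrr /snorm (si0l sip) sqrtr0; exact: cvg_cst.
have D2 : is_derive t 1 (fun s => ip (u s) (u t)) (ip (u t) (v t)).
  by under eq_fun do rewrite (semi_innerC sip).
have := ip_is_derive sip (uc t) D2 (ud t0).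
by move=> D; apply: is_derive_eq D _; rewrite /k (semi_innerC sip) ; ring.
Qed.

Let de (t : R) : 0 < t -> is_derive t 1 e (- 2 * m t t).
Proof.
move=> t0.
(* Neither [al] nor [m] is known to be differentiable on its own. By [FE] their sum equals e^{-t}
   F(0) - k(t, t), and this expression is. *)
have D : is_derive t 1 (fun s => expR (- s) * F 0 - k s s) (- 2 * m t t).
  have D1 : is_derive t 1 (fun s : R => expR (- s)) (expR (- t) * -1).
    by apply: is_derive1_comp; exact: is_deriveNid.
  have := is_deriveB (is_deriveM D1 (is_derive_cst (F 0) t 1)) (dk t0).
  move=> D; apply: is_derive_eq D _.
  rewrite /GRing.scale/= mulr0 add0r.
  have := FE (ltW t0); rewrite /F => E.
  rewrite mulrN1 mulrN (mulrC (F 0)) -E; ring.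
apply/is_derive1_slope; move/is_derive1_slope : D; apply: cvg_trans.
apply: near_eq_cvg.
have E0 (r : R) : 0 < r -> e r = expR (- r) * F 0 - k r r.
  by move=> r0; rewrite -FE ?ltW// /F /e addrK.
near=> s; rewrite !E0//.
by near: s; apply: nbhs_dnbhs; exact: lt_nbhsr.
Unshelve. all: by end_near. Qed.

Let e_nincr (s t : R) : 0 <= s -> s <= t -> e t <= e s.
Proof.
move=> s0 st.
have [||c _ E] := @MVT_segment R e (fun c => - 2 * m c c) s t st.
- move=> r /[!in_itv]/= /andP[sr _]; apply: de; exact: le_lt_trans sr.
- exact: continuous_subspaceT.
- rewrite -subr_le0 E mulNr mulNr oppr_le0 !mulr_ge0 ?subr_ge0//.
  exact: (semi_inner_ge0 sip).
Qed.

(* The identity k(t,t) + y(t) = <u'(0) + u(0), u(t)> - int_0^t a(U s, U t) ds,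
   discretized on the grid j h. *)
Let riemann_step (T d om : R) (B : R) (N : nat) (h := T / N.+1%:R) : 0 < T ->
  (forall s t, 0 <= t <= T -> `|s - t| <= h -> snorm a (U s - U t) <= om) ->
  (forall t, 0 <= t <= T -> snorm a (U t) <= B) ->
  forall i : nat, (i <= N.+1)%N ->
  k (i%:R * h) (i%:R * h) + y (i%:R * h) <=
    ip (v 0 + u 0) (u (i%:R * h)) - h * \sum_(j < i) al (j%:R * h) (i%:R * h)
    + T * om * B.
Proof.
move=> T0 Uom UB i iN.
have h0 : 0 < h by rewrite divr_gt0.
have ihT (j : nat) : (j <= N.+1)%N -> 0 <= j%:R * h <= T.
  move=> jN; apply/andP; split; first by rewrite mulr_ge0 ?ler0n ?ltW.
  by rewrite /h mulrCA ger_pMr// ler_pdivrMr// mul1r ler_nat.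
set t := i%:R * h.
have t0T : 0 <= t <= T by exact: ihT.
have t0 : 0 <= t by case/andP : t0T.
have om0 : 0 <= om.
  by apply: le_trans (Uom 0 0 _ _); rewrite ?snorm_ge0// ?lexx ?subrr ?normr0 ltW.
(* The test vector u(t) stays fixed while s runs over the grid points up to t. On each cell the mean
   value theorem produces al(c, t), which differs from the value at the left grid point by at most
   om B. *)
pose P s := ip (v s) (u t) + ip (u s) (u t).
have dP (s : R) : 0 < s -> is_derive s 1 P (- al s t).
  move=> s0.
  have D2 : is_derive s 1 (fun r => ip (u r) (u t)) (ip (u t) (v s)).
    under eq_fun do rewrite (semi_innerC sip).
    have D := ip_is_derive sip (p := fun=> u t) (q := u) (x := s) (d := 0) _ _ (ud s0).
    rewrite -[X in is_derive _ _ _ X]add0r; apply: D.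
    rewrite subrr /snorm (si0l sip) sqrtr0; exact: cvg_cst.
  have := is_deriveD (wave s0 t0) D2; move=> D; apply: is_derive_eq D _.
  by rewrite (semi_innerC sip (v s)) subrK.
have Pc : continuous P.
  have c0 (w : X) (r : R) : snorm ip (w - w) @[_ --> r] --> 0.
    by rewrite subrr /snorm (si0l sip) sqrtr0; exact: cvg_cst.
  by move=> r; apply: cvgD; apply: (ip_cvg sip) => //; exact: c0.
have step (j : nat) : (j < i)%N ->
    P (j.+1%:R * h) - P (j%:R * h) <= h * (om * B) - h * al (j%:R * h) t.
  move=> ji.
  have jj : j%:R * h < j.+1%:R * h by rewrite ltr_pM2r// ltr_nat.
  have jT : 0 <= j%:R * h <= T by apply: ihT; rewrite (leq_trans _ iN)// ltnW.
  have j0 : 0 <= j%:R * h by case/andP : jT.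
  have [||c + ->] := @MVT_segment R P (fun c => - al c t) _ _ (ltW jj).
  - move=> r /[!in_itv]/= /andP[sr _]; apply: dP; exact: le_lt_trans sr.
  - exact: continuous_subspaceT.
  - rewrite in_itv/= => /andP[jc cj].
    rewrite (_ : j.+1%:R * h - j%:R * h = h); last by rewrite -natr1; ring.
    rewrite mulrC -mulrBr ler_pM2l// lerNl opprB lerBlDr -lerBlDl.
    rewrite /al -(siBl sa).
    rewrite (le_trans (ler_norm _))// (le_trans (cauchy_schwarz sa _ _))//.
    rewrite ler_pM ?snorm_ge0// ?UB// snorm_distC// Uom//.
    by rewrite ger0_norm ?subr_ge0// lerBlDl -[X in _ <= _ + X]mul1r -mulrDl natr1.
have tel : P t - P 0 = \sum_(j < i) (P (j.+1%:R * h) - P (j%:R * h)).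
  by rewrite -(big_mkord xpredT (fun j => P (j.+1%:R * h) - P (j%:R * h))) telescope_sumr// mul0r.
have -> : k t t + y t = P 0 + (P t - P 0) by rewrite [RHS]addrC subrK.
rewrite tel (siDl sip) -[X in _ <= X]addrA lerD2l.
apply: (@le_trans _ _ (\sum_(j < i) (h * (om * B) - h * al (j%:R * h) t))).
  by apply: ler_sum => j _; exact: step.
rewrite sumrB big_const_ord iter_addr_0 -mulr_sumr [leLHS]addrC lerD2l.
have B0 : 0 <= B by apply: le_trans (UB 0 _); rewrite ?snorm_ge0// lexx ltW.
have -> : h * (om * B) *+ i = t * (om * B) by rewrite -mulr_natl mulrA.
rewrite -(mulrA T); apply: ler_wpM2r; first exact: mulr_ge0.
by case/andP : t0T.
Qed.

(** Summing [riemann_step] over the grid produces the triangular double sum of h^2 al(jh, ih) over j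
    < i. By symmetry it is a(w, w)/2 for the Riemann sum w, up to the diagonal, so that [K0_dual]
    applies to w; the diagonal and the moduli of continuity vanish with the mesh. *)
Let y_int (T : R) (Q : R -> R) : 0 < T ->
  (forall t : R, -1 < t -> is_derive t 1 Q (y t)) ->
  2^-1 * y T + (Q T - Q 0) <= 2^-1 * y 0 + 2^-1 * K.
Proof.
move=> T0 dQ.
pose N t := 2^-1 * y t + Q t.
have dN (t : R) : 0 < t -> is_derive t 1 N (k t t + y t).
  move=> t0; have t1 : -1 < t by rewrite (lt_trans _ t0)// ltrN10.
  have := is_deriveD (is_deriveZ 2^-1 (dy t0)) (dQ _ t1) => D.
  by apply: is_derive_eq D _; rewrite /GRing.scale/= mulrA mulVf ?mul1r.
have Nc (t : R) : 0 <= t -> {for t, continuous N}.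
  move=> t0; apply: cvgD; first by apply: cvgM; [exact: cvg_cst|exact: yc].
  have t1 : -1 < t by rewrite (lt_le_trans _ t0)// ltrN10.
  by apply: differentiable_continuous; apply/derivable1_diffP; have [] := dQ _ t1.
suff: N T - N 0 <= 2^-1 * K by rewrite /N; lra.
have [B B0 UB] : exists2 B, 0 < B & forall t, 0 <= t <= T -> snorm a (U t) <= B.
  have alc : {within `[0, T], continuous (fun t => al t t)}.
    by apply: continuous_subspaceT; exact: (diag_continuous sa Uc Uc).
  have [c _ cP] := EVT_max (ltW T0) alc.
  (* The added 1 keeps [B] positive, since it will occur in denominators. *)
  exists (snorm a (U c) + 1); first by rewrite ltr_wpDl ?snorm_ge0.
  move=> t tT; apply: (@le_trans _ _ (snorm a (U c))); last by rewrite lerDl.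
  by rewrite ler_sqrt ?(semi_inner_ge0 sa)// cP// in_itv.
apply/ler_addgt0Pr => eps eps0.
(* Added up over all cells, the error h T om B of [riemann_step] becomes T^2 om B = eps/4. *)
pose om := eps / (4 * T ^+ 2 * B).
have om0 : 0 < om by rewrite divr_gt0// !mulr_gt0// exprn_gt0.
pose g t := k t t + y t.
have gc : continuous g by move=> t; apply: cvgD; [exact: kc|exact: yc].
have [d1 d10 dU] : exists2 d : R, 0 < d & forall s t : R, 0 <= t <= T -> `|s - t| < d ->
    snorm a (U s - U t) <= om.
  apply: (@uniform_on_segment R (fun s t => snorm a (U s - U t))) => //.
  - by move=> *; exact: snorm_ge0.
  - by move=> *; exact: snorm_distC.
  - by move=> s t r; rewrite -(subrKA (U t)) ler_snormD.
have [d2 d20 dg] : exists2 d : R, 0 < d & forall s t : R, 0 <= t <= T -> `|s - t| < d ->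
    `|g s - g t| <= eps / (4 * T).
  apply: (@uniform_on_segment R (fun s t => `|g s - g t|)) => //.
  - by move=> *; exact: distrC.
  - by move=> s t r; rewrite -(subrKA (g t)) ler_normD.
  - move=> t; rewrite -(normr0 R) -(subrr (g t)); apply: cvg_norm.
    by apply: cvgB; [exact: gc|exact: cvg_cst].
  - by rewrite divr_gt0 ?mulr_gt0.
(* The third bound controls the diagonal terms h^2 a(U, U)/2, whose sum is at most h T B^2/2 <=
   eps/4. Together with the contributions of [om] and of the modulus of [g], the error is at most 3
   eps/4. *)
pose d := Num.min (Num.min d1 d2) (eps / (2 * T * B ^+ 2)).
have d0 : 0 < d by rewrite !lt_min d10 d20 divr_gt0// !mulr_gt0// exprn_gt0.
pose M := Num.truncn (T / d).
pose h := T / M.+1%:R.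
have h0 : 0 < h by rewrite divr_gt0.
have : h < d.
  rewrite /h ltr_pdivrMr// mulrC -ltr_pdivrMr//.
  by rewrite truncnS_gt// divr_ge0// ltW.
rewrite !lt_min => /andP[/andP[hd1 hd2] hd3].
have ihT (j : nat) : (j <= M.+1)%N -> 0 <= j%:R * h <= T.
  move=> jN; apply/andP; split; first by rewrite mulr_ge0 ?ler0n ?ltW.
  by rewrite /h mulrCA ger_pMr// ler_pdivrMr// mul1r ler_nat.
pose w n := \sum_(i < n) h *: U (i%:R * h).
have iota0 : iota 0 = 0.
  by have := iotaD (-1) 0 0; rewrite scaler0 addr0 scaleN1r addNr.
(* Passing from w_n to w_n + h U(t) changes a(w, w)/2 by h a(w_n, U(t)) + h^2 a(U(t), U(t))/2. The
   first term is the sum appearing in [riemann_step]; the second is the diagonal error. *)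
have claim (n : nat) : (n <= M.+1)%N -> N (n%:R * h) - N 0 <=
    ip (v 0 + u 0) (iota (w n)) - 2^-1 * a (w n) (w n) +
    n%:R * (2^-1 * h ^+ 2 * B ^+ 2 + h * (eps / (4 * T)) + h * (T * om * B)).
  elim: n => [_|n IH nM].
    by rewrite /w big_ord0 iota0 mul0r subrr (semi_innerC sip) (si0l sip) (si0l sa) mul0r
      mulr0 subr0 addr0.
  have {IH} := IH (ltnW nM).
  set t := n%:R * h.
  have tt : n.+1%:R * h = t + h by rewrite -natr1 mulrDl mul1r.
  have t0T : 0 <= t <= T by apply: ihT; exact: ltnW.
  have t0 : 0 <= t by case/andP : t0T.
  have E1 : N (t + h) - N t <= h * (g t + eps / (4 * T)).
    have th : t < t + h by rewrite ltrDl.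
    have [||c + ->] := @MVT_segment R N g _ _ (ltW th).
    - move=> r /[!in_itv]/= /andP[sr _]; apply: dN; exact: le_lt_trans sr.
    - apply: continuous_in_subspaceT => r /[!inE] /=; rewrite in_itv/= => /andP[tr _].
      by apply: Nc; exact: le_trans tr.
    - rewrite in_itv/= => /andP[tc ct].
      rewrite addrAC subrr add0r mulrC ler_pM2l// -lerBlDl (le_trans (ler_norm _))//.
      by apply: dg => //; rewrite ger0_norm ?subr_ge0// (le_lt_trans _ hd2)// lerBlDl.
  have E2 := @riemann_step T 1 om B M T0 _ UB n (ltnW nM).
  have {}E2 : g t <= ip (v 0 + u 0) (u t) - h * \sum_(j < n) al (j%:R * h) t + T * om * B.
    apply: E2 => s r rT sr; apply: dU => //; exact: le_lt_trans hd1.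
  have wS : w n.+1 = h *: U t + w n by rewrite /w big_ord_recr/= addrC.
  have awU : a (w n) (U t) = h * \sum_(j < n) al (j%:R * h) t.
    rewrite /w mulr_sumr; elim: (n) => [|q IHq]; first by rewrite !big_ord0 (si0l sa).
    by rewrite !big_ord_recr/= (siDl sa) (siZl sa) IHq.
  rewrite tt wS iotaD (siDr sip) (siZr sip) (siDl sa) !(siDr sa) !(siZl sa) !(siZr sa).
  rewrite (semi_innerC sa (U t) (w n)) awU -[n.+1%:R]natr1.
  set S := \sum_(j < n) _ in E2 awU *.
  have E3 : a (U t) (U t) <= B ^+ 2.
    by rewrite -(sqr_snorm sa); apply: lerXn2r; rewrite ?nnegrE ?snorm_ge0 ?UB// ltW.
  have E4 := ler_wpM2l (ltW h0) E2.
  have E5 : 2^-1 * h ^+ 2 * a (U t) (U t) <= 2^-1 * h ^+ 2 * B ^+ 2.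
    by rewrite ler_wpM2l// mulr_ge0// sqr_ge0.
  move: E1 E4 E5; set q1 := N (t + h); set q2 := N t; set q3 := N 0.
  set q4 := ip _ (iota (w n)); set q5 := ip _ (iota (U t)); set q6 := a (w n) (w n).
  set q7 := a (U t) (U t).
  by lra.
have := claim M.+1 (leqnn _).
have hT : M.+1%:R * h = T by rewrite /h mulrCA divff ?mulr1.
rewrite hT => /le_trans; apply.
have := K0_dual (w M.+1); set q := _ - _ => qK; apply: lerD => //.
rewrite !mulrDr expr2.
have -> : M.+1%:R * (2^-1 * (h * h) * B ^+ 2) = h * (2^-1 * T * B ^+ 2) by rewrite -hT; ring.
have -> : M.+1%:R * (h * (eps / (4 * T))) = eps / 4 by rewrite mulrA hT; field; rewrite gt_eqF.
have -> : M.+1%:R * (h * (T * om * B)) = eps / 4.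
  by rewrite mulrA hT /om; field; rewrite !gt_eqF.
have : h * (2^-1 * T * B ^+ 2) <= eps / 4.
  apply: (@le_trans _ _ (eps / (2 * T * B ^+ 2) * (2^-1 * T * B ^+ 2))).
    by apply: ler_wpM2r; [rewrite !mulr_ge0 ?sqr_ge0// ltW|exact: ltW].
  by rewrite le_eqVlt; apply/orP; left; apply/eqP; field; rewrite !gt_eqF.
by lra.
Qed.

Let D := y 0 + m 0 0 + al 0 0 + K.

(** Monotonicity of [G] bounds both (T + T^2/2) e(T) and (1 + T) y(T)/2 by 7 D. With e(T) <= D the
    two claims hold with 15 D, and 30 is a round value above it. *)
Lemma damped_wave_decay (T : R) : 0 <= T ->
  (1 + T) ^+ 2 * (al T T + m T T) <= 30 * D /\ (1 + T) * y T <= 30 * D.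
Proof.
have y0 t : 0 <= y t by exact: (semi_inner_ge0 sip).
have m0 t : 0 <= m t t by exact: (semi_inner_ge0 sip).
have a0 t : 0 <= al t t by exact: (semi_inner_ge0 sa).
have k0 : `|k 0 0| <= 2^-1 * (m 0 0 + y 0).
  apply: (le_trans (cauchy_schwarz sip _ _)).
  have := sqr_ge0 (snorm ip (v 0) - snorm ip (u 0)).
  by rewrite sqrrB !(sqr_snorm sip) -/(m 0 0) -/(y 0); lra.
have F0D : `|F 0| <= 3 / 2 * D.
  rewrite /F /D (le_trans (ler_normD _ _))// ger0_norm ?addr_ge0//.
  move: K0_ge0 (k0) (y0 0) (m0 0) (a0 0); lra.
move: (F0D); rewrite ler_norml => /andP[F0l F0r].
have D0 : 0 <= D by rewrite /D !addr_ge0.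
rewrite le_eqVlt => /predU1P[<-|T0].
  rewrite addr0 expr1n !mul1r; split; have := K0_ge0; have := y0 0; have := m0 0; have := a0 0;
  rewrite /D; lra.
have [Q dQ] := primitive_exists (-1) yc.
(* The derivative of the first weight and y' = 2k produce (1 + t)(e + k) = (1 + t) e^{-t} F(0),
   which the last term cancels because the derivative of (2 + t) e^{-t} is -(1 + t) e^{-t}. The
   remaining y/2 is cancelled by Q/2. *)
pose G t := (t + 2^-1 * t ^+ 2) * e t + 2^-1 * (1 + t) * y t - 2^-1 * Q t
   + F 0 * ((2 + t) * expR (- t)).
have dG (t : R) : 0 < t -> is_derive t 1 G ((t + 2^-1 * t ^+ 2) * (- 2 * m t t)).
  move=> t0; have t1 : -1 < t by rewrite (lt_trans _ t0)// ltrN10.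
  have D1 : is_derive t 1 (fun s : R => expR (- s)) (expR (- t) * -1).
    by apply: is_derive1_comp; exact: is_deriveNid.
  have H1 : is_derive t 1 (fun s : R => s + 2^-1 * s ^+ 2) (1 + t).
    have := is_deriveD (is_derive_id t 1) (is_deriveZ 2^-1 (is_deriveX 2 (is_derive_id t 1))).
    move=> H; apply: is_derive_eq H _; rewrite /GRing.scale/= expr1; by field.
  have H2 : is_derive t 1 (fun s : R => 2^-1 * (1 + s)) 2^-1.
    have := is_deriveZ 2^-1 (is_deriveD (is_derive_cst (1:R) t 1) (is_derive_id t 1)).
    by move=> H; apply: is_derive_eq H _; rewrite /GRing.scale/= add0r mulr1.
  have H3 : is_derive t 1 (fun s : R => 2 + s) 1.
    have := is_deriveD (is_derive_cst (2:R) t 1) (is_derive_id t 1).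
    by move=> H; apply: is_derive_eq H _; rewrite add0r.
  have := is_deriveD (is_deriveB (is_deriveD (is_deriveM H1 (de t0)) (is_deriveM H2 (dy t0)))
     (is_deriveZ 2^-1 (dQ _ t1))) (is_deriveZ (F 0) (is_deriveM H3 D1)).
  move=> H; apply: is_derive_eq H _; rewrite /GRing.scale/=.
  have -> : e t = expR (- t) * F 0 - k t t by rewrite -FE ?ltW// /F /e addrK.
  by field.
have Gc (t : R) : 0 <= t -> {for t, continuous G}.
  move=> t0; have t1 : -1 < t by rewrite (lt_le_trans _ t0)// ltrN10.
  have Qc : {for t, continuous Q}.
    by apply: differentiable_continuous; apply/derivable1_diffP; have [] := dQ _ t1.
  have idc : s @[s --> t] --> t by exact: cvg_id.
  have cc (c : R) : c @[_ --> t] --> c by exact: cvg_cst.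
  apply: cvgD; last first.
    apply: cvgM; first exact: cc.
    apply: cvgM; first by apply: cvgD.
    apply: (@cvg_comp _ _ _ (fun s : R => - s) expR _ (nbhs (- t))); last exact: continuous_expR.
    exact: cvgN.
  apply: cvgB; last by apply: cvgM.
  apply: cvgD.
    apply: cvgM; last exact: ec.
    apply: cvgD => //; apply: cvgM => //; exact: exprn_continuous.
  apply: cvgM; last exact: yc.
  by apply: cvgM => //; apply: cvgD.
have GT : G T <= G 0.
  have [||c + E] := @MVT_segment R G (fun t => (t + 2^-1 * t ^+ 2) * (- 2 * m t t)) _ _ (ltW T0).
  - by move=> r /[!in_itv]/= /andP[sr _]; exact: dG.
  - apply: continuous_in_subspaceT => r /[!inE] /=; rewrite in_itv/= => /andP[tr _].
    exact: Gc.
  - rewrite in_itv/= => /andP[c0 cT].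
    rewrite -subr_le0 E subr0 mulNr mulrN mulNr oppr_le0 !mulr_ge0 ?addr_ge0 ?mulr_ge0 ?sqr_ge0//.
    exact: ltW.
have yT := y_int T0 dQ.
have eT := e_nincr (lexx 0) (ltW T0).
have ex : 0 <= (2 + T) * expR (- T) <= 2.
  apply/andP; split; first by rewrite mulr_ge0 ?expR_ge0 ?addr_ge0// ltW.
  rewrite expRN ler_pdivrMr ?expR_gt0//.
  have := expR_ge1Dx T; lra.
have Fex : - (3 * D) <= F 0 * ((2 + T) * expR (- T)).
  move: ex; set q := (2 + T) * _ => /andP[q0 q2].
  have : (3 / 2 * D + F 0) * q >= 0 by rewrite mulr_ge0//; lra.
  have : (3 / 2 * D) * q <= (3 / 2 * D) * 2 by rewrite ler_wpM2l// mulr_ge0// divr_ge0.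
  by lra.
have G0 : G 0 = 2^-1 * y 0 - 2^-1 * Q 0 + 2 * F 0.
  by rewrite /G oppr0 expR0; field.
move: GT; rewrite G0 /G => GT.
have yD : y 0 <= D by rewrite /D; have := K0_ge0; have := m0 0; have := a0 0; lra.
have eD : e 0 <= D by rewrite /D /e; have := K0_ge0; have := y0 0; lra.
have KD : K <= D by rewrite /D; have := y0 0; have := m0 0; have := a0 0; lra.
have e0 : 0 <= e T by rewrite addr_ge0.
have h1 : 0 <= (T + 2^-1 * (T * T)) * e T.
  by rewrite mulr_ge0// addr_ge0 ?mulr_ge0// ltW.
have h2 : 0 <= 2^-1 * (1 + T) * y T by rewrite !mulr_ge0// addr_ge0// ltW.
rewrite -/(e T).
have -> : (1 + T) ^+ 2 * e T = e T + 2 * ((T + 2^-1 * (T * T)) * e T) by field.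
have -> : (1 + T) * y T = 2 * (2^-1 * (1 + T) * y T) by field.
move: GT yT; rewrite expr2; have := y0 T.
by split; lra.
Qed.

End damped_wave_hilbert.

(** * Smooth functions and cut-offs *)

Section smooth_closure.
Context {R : realType} {E : normedModType R}.
Implicit Types f g : E -> R.

(** [smooth] quantifies over lists of directions. Induction on the list is done here once, and a
    smoothness proof reduces to exhibiting a class of functions invariant under differentiation. *)
Lemma smooth_coind (S : (E -> R) -> Prop) :
  (forall f, S f -> forall x, differentiable f x) ->
  (forall f v, S f -> S ('D_v f)) -> forall f, S f -> smooth f.
Proof.
move=> Sdiff SD f Sf vs x; apply: Sdiff; elim: vs => [//|v vs IH] /=.
exact: SD.
Qed.

Lemma smooth_differentiable f x : smooth f -> differentiable f x.
Proof. by move=> /(_ [::] x). Qed.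

Lemma smooth_continuous f : smooth f -> continuous f.
Proof. by move=> sf x; apply/differentiable_continuous/smooth_differentiable. Qed.

Lemma smooth_derive f v : smooth f -> smooth ('D_v f).
Proof.
by move=> sf vs x; have := sf (rcons vs v) x; rewrite /iter_derive foldr_rcons.
Qed.

Lemma smooth_cst (c : R) : smooth (cst c : E -> R).
Proof.
apply: (@smooth_coind (fun f => exists c, f = cst c)); last by exists c.
  by move=> _ [d ->] x; exact: differentiable_cst.
by move=> _ v [d ->]; exists 0; apply/funext => x; rewrite derive_cst.
Qed.

(** Derivatives of products and inverses mix several operations, so no single operation gives an
    invariant class for [smooth_coind]. The whole algebra generated by the smooth functions does, by
    the Leibniz and quotient rules. *)
Inductive smooth_alg : (E -> R) -> Prop :=
| smooth_alg_base f : smooth f -> smooth_alg f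
| smooth_algD f g : smooth_alg f -> smooth_alg g -> smooth_alg (f + g)
| smooth_algM f g : smooth_alg f -> smooth_alg g -> smooth_alg (f * g)
| smooth_algV f : smooth_alg f -> (forall x, f x != 0) ->
    smooth_alg (fun x => (f x)^-1).

Lemma smooth_alg_smooth f : smooth_alg f -> smooth f.
Proof.
have Sdiff g : smooth_alg g -> forall x, differentiable g x.
  elim => {g} [g sg x|g h _ dg _ dh x|g h _ dg _ dh x|g _ dg g0 x].
  - exact: smooth_differentiable.
  - exact: differentiableD.
  - exact: differentiableM.
  - exact: differentiableV.
apply: smooth_coind => // g v; elim => {g} [g sg|g h sg Dg sh Dh|g h sg Dg sh Dh|g sg Dg g0].
- exact/smooth_alg_base/smooth_derive.
- rewrite (_ : 'D_v _ = 'D_v g + 'D_v h); first exact: smooth_algD.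
  apply/funext => x; rewrite deriveD//; exact/diff_derivable/Sdiff.
- rewrite (_ : 'D_v _ = g * 'D_v h + h * 'D_v g).
    by apply: smooth_algD; exact: smooth_algM.
  apply/funext => x; rewrite deriveM//; exact/diff_derivable/Sdiff.
- rewrite (_ : 'D_v _ = (cst (-1) * 'D_v g) * ((fun x => (g x)^-1) * (fun x => (g x)^-1))).
    apply: smooth_algM; last by apply: smooth_algM; exact: smooth_algV.
    apply: smooth_algM => //; exact/smooth_alg_base/smooth_cst.
  apply/funext => x; rewrite deriveV//; last exact/diff_derivable/Sdiff.
  by rewrite /GRing.scale/= -[RHS]/(-1 * 'D_v g x * ((g x)^-1 * (g x)^-1)); field.
Qed.

Lemma smoothD f g : smooth f -> smooth g -> smooth (f + g).
Proof. by move=> *; apply/smooth_alg_smooth/smooth_algD; exact: smooth_alg_base. Qed.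

Lemma smoothM f g : smooth f -> smooth g -> smooth (f * g).
Proof. by move=> *; apply/smooth_alg_smooth/smooth_algM; exact: smooth_alg_base. Qed.

Lemma smoothV f : smooth f -> (forall x, f x != 0) -> smooth (fun x => (f x)^-1).
Proof. by move=> *; apply/smooth_alg_smooth/smooth_algV => //; exact: smooth_alg_base. Qed.

Lemma smoothZ (c : R) f : smooth f -> smooth (fun x => c * f x).
Proof. by move=> sf; apply: (smoothM (smooth_cst c) sf). Qed.

Lemma smooth_prod n (F : 'I_n -> E -> R) : (forall i, smooth (F i)) ->
  smooth (fun x => \prod_(i < n) F i x).
Proof.
move=> sF; rewrite (_ : (fun x => _) = \prod_(i < n) F i).
  apply: (big_ind smooth) => //; [exact: smooth_cst|exact: smoothM].
apply/funext => x; elim/big_ind2 : _ => // g a h b -> -> //.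
Qed.

End smooth_closure.

Lemma diff_affine {R : realType} {E F : normedModType R} (l : E -> F) (c : F) (x : E) :
  linear l -> continuous l -> is_diff x (fun x => l x + c) l.
Proof.
move=> ll lc; pose lM := GRing.isLinear.Build _ _ _ _ _ ll.
pose L : {linear E -> F} := HB.pack l lM.
have dL : is_diff x (L : E -> F) L.
  by split; [exact: linear_differentiable|exact: diff_lin].
have := is_diffD dL (@is_diff_cst _ _ _ c x).
by rewrite addr0.
Qed.

Lemma derive_comp_affine {R : realType} {E F : normedModType R}
    (l : E -> F) (c : F) (f : F -> R) (x v : E) : linear l -> continuous l ->
  differentiable f (l x + c) ->
  'D_v (fun x => f (l x + c)) x = 'D_(l v) f (l x + c).
Proof.
move=> ll lc df; have [dl dlE] := diff_affine c x ll lc.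
have -> : (fun x => f (l x + c)) = f \o (fun x => l x + c) by [].
rewrite deriveE; last exact: differentiable_comp.
by rewrite diff_comp//= dlE deriveE.
Qed.

Lemma smooth_comp_affine {R : realType} {E F : normedModType R}
    (l : E -> F) (c : F) (f : F -> R) : linear l -> continuous l ->
  smooth f -> smooth (fun x => f (l x + c)).
Proof.
move=> ll lc sf.
apply: (@smooth_coind _ _ (fun g => exists2 f, smooth f & g = fun x => f (l x + c))).
- move=> _ [g sg ->] x; apply: differentiable_comp; last exact: smooth_differentiable.
  by have [] := diff_affine c x ll lc.
- move=> _ v [g sg ->]; exists ('D_(l v) g); first exact: smooth_derive.
  by apply/funext => x; rewrite derive_comp_affine//; exact: smooth_differentiable.
- by exists f.
Qed.

Section smooth_line.
Context {R : realType}.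

Lemma derive_line (f : R -> R) (x v d : R) : is_derive x 1 f d -> 'D_v f x = d * v.
Proof.
move=> df; have dfx : differentiable f x by apply/derivable1_diffP; have [] := df.
by rewrite deriveE// diff1E// derive1E; have [_ ->] := df; rewrite mulrC.
Qed.

(** On the line, a directional derivative is a scalar multiple of the ordinary one; the invariant
    class therefore consists of all multiples of elements of [S]. *)
Lemma smooth_line (S : (R -> R) -> Prop) :
  (forall f, S f -> exists2 df, S df & forall x : R, is_derive x 1 f (df x)) ->
  forall f, S f -> smooth f.
Proof.
move=> SD f Sf.
apply: (@smooth_coind _ _ (fun g => exists c f, S f /\ g = fun x => c * f x)).
- move=> _ [c [g [Sg ->]]] x; have [dg _ dgE] := SD _ Sg.
  have dgx : differentiable g x by apply/derivable1_diffP; have [] := dgE x.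
  exact: differentiableM (differentiable_cst _ _) dgx.
- move=> _ v [c [g [Sg ->]]]; have [dg Sdg dgE] := SD _ Sg.
  exists (c * v), dg; split=> //; apply/funext => x.
  rewrite (@derive_line _ x v (c * dg x)); by ring.
- by exists 1, f; split=> //; apply/funext => x; rewrite mul1r.
Qed.

(** Term by term, t^i <= i! e^t for t >= 0. *)
Lemma poly_expR_bound (p : {poly R}) :
  exists2 C, 0 <= C & forall t : R, 0 <= t -> `|p.[t]| <= C * expR t.
Proof.
exists (\sum_(i < size p) `|p`_i| * i`!%:R).
  by apply: sumr_ge0 => i _; rewrite mulr_ge0.
move=> t t0; rewrite horner_coef mulr_suml (le_trans (ler_norm_sum _ _ _))//.
apply: ler_sum => i _; rewrite normrM -mulrA ler_wpM2l//.
rewrite ger0_norm ?exprn_ge0// mulrC -ler_pdivrMr ?ltr0n ?fact_gt0//.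
case: (nat_of_ord i) => [|k]; first by rewrite expr0 divr1 (le_trans _ (expR_ge1Dx t))// lerDl.
by rewrite (le_trans _ (expR_ge1Dxn k t0))// lerDr.
Qed.

(* The functions P(1/x) e^{-1/x}, extended by 0 to x <= 0, are closed under
   differentiation. *)
Definition flat (p : {poly R}) (x : R) : R :=
  if 0 < x then p.[x^-1] * expR (- x^-1) else 0.

Lemma flat_derive (p : {poly R}) (x : R) :
  is_derive x 1 (flat p) (flat ('X^2 * (p - p^`())) x).
Proof.
have [x0|x0|->] := ltrgt0P x.
- have D1 : is_derive x 1 (fun x : R => x^-1) (- x ^- 2).
    have := @is_deriveV R id x 1 1 (lt0r_neq0 x0) (is_derive_id x 1).
    by rewrite /GRing.scale/= mulr1.
  have D2 : is_derive x 1 (fun x : R => p.[x^-1]) (p^`().[x^-1] * - x ^- 2).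
    exact: is_derive1_comp.
  have D3 : is_derive x 1 (fun x : R => expR (- x^-1)) (expR (- x^-1) * x ^- 2).
    have := @is_derive1_comp R expR (fun x : R => - x^-1) x (expR (- x^-1)) (x ^- 2) _ _.
    apply.
    by have := is_deriveN D1; rewrite opprK.
  have D := is_deriveM D2 D3.
  apply: (@near_eq_is_derive _ _ _ (fun x : R => p.[x^-1] * expR (- x^-1))).
    near=> y; rewrite /flat ifT//; near: y; exact: lt_nbhsr.
  apply: is_derive_eq D _.
  rewrite /GRing.scale/= /flat x0 !hornerE/=; field; exact: lt0r_neq0.
- rewrite /flat (ltNge 0 x) (ltW x0)/=.
  apply: (@near_eq_is_derive _ _ _ (cst 0)).
  near=> y; rewrite /flat ifF//; apply/negbTE; rewrite -leNgt ltW//.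
  by near: y; exact: lt_nbhsl.
- rewrite /flat ltxx; apply/is_derive1_slope.
  (* With t = 1/s, the bound on p(t) t^2 says that |p(1/s)| e^{-1/s} <= C s^2. One power of s is
     lost in the difference quotient, which still tends to 0. *)
  have [C C0 CP] := poly_expR_bound (p * 'X^2).
  apply: (@cvg_dist_le _ _ _ _ _ (fun s : R => C * `|s|)); last first.
    rewrite -[X in _ --> X](mulr0 C); apply: cvgM; first exact: cvg_cst.
    have H : `|s| @[s --> (0 : R)] --> `|0 : R| by apply: cvg_norm; exact: cvg_id.
    by rewrite normr0 in H; exact: cvg_within_filter H.
  move=> s; rewrite ltxx !subr0; case: ifPn => [s0|]; last first.
    by rewrite mulr0 normr0 mulr_ge0.
  have := CP s^-1; rewrite invr_ge0 => /(_ (ltW s0)).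
  rewrite !hornerE/= => H.
  rewrite (gtr0_norm s0) expRN normrM (@ger0_norm _ (expR _)^-1) ?invr_ge0 ?expR_ge0//.
  rewrite ler_pdivrMr ?expR_gt0//; move: H.
  rewrite !normrM (@gtr0_norm _ s^-1) ?invr_gt0// ler_pdivrMr//.
  by rewrite mulrC mulrAC.
Unshelve. all: by end_near. Qed.

Lemma smooth_flat p : smooth (flat p).
Proof.
apply: (@smooth_line (fun f => exists p, f = flat p)); last by exists p.
move=> _ [q ->]; exists (flat ('X^2 * (q - q^`()))); first by eexists.
by move=> x; exact: flat_derive.
Qed.

Lemma flat1_ge0 x : 0 <= flat 1 x.
Proof. by rewrite /flat; case: ifP => // _; rewrite hornerE mul1r expR_ge0. Qed.

Lemma flat1_gt0 x : 0 < x -> 0 < flat 1 x.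
Proof. by rewrite /flat => ->; rewrite hornerE mul1r expR_gt0. Qed.

Lemma flat_eq0 p (x : R) : x <= 0 -> flat p x = 0.
Proof. by rewrite /flat ltNge => ->. Qed.

Lemma smooth_reparam (f : R -> R) (b c : R) : smooth f -> smooth (fun x => f (b * x + c)).
Proof.
move=> sf; apply: (@smooth_comp_affine _ _ _ ( *:%R b) c f) => //.
  by move=> k y z; exact: linearP.
exact: scaler_continuous.
Qed.

Definition bump (x : R) : R := flat 1 (1 - x) * flat 1 (1 + x).

Lemma smooth_bump : smooth bump.
Proof.
rewrite (_ : bump = (fun x => flat 1 (-1 * x + 1)) * (fun x => flat 1 (1 * x + 1))).
  by apply: smoothM; exact/smooth_reparam/smooth_flat.
by apply/funext => x; rewrite /bump -[RHS]/(flat 1 (-1 * x + 1) * flat 1 (1 * x + 1));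
  congr (flat _ _ * flat _ _); ring.
Qed.

Lemma bump_ge0 x : 0 <= bump x.
Proof. by rewrite mulr_ge0 ?flat1_ge0. Qed.

Lemma bump_eq0 (x : R) : 1 <= `|x| -> bump x = 0.
Proof.
rewrite ler_normr => /orP[|] x1; rewrite /bump.
  by rewrite flat_eq0 ?mul0r//; lra.
by rewrite (@flat_eq0 _ (1 + x)) ?mulr0//; lra.
Qed.

Lemma bumpN x : bump (- x) = bump x.
Proof. by rewrite /bump opprK mulrC. Qed.

Definition step (x : R) : R := flat 1 x / (flat 1 x + flat 1 (1 - x)).

Let step_den (x : R) : 0 < flat 1 x + flat 1 (1 - x).
Proof.
have [x0|x0] := ltP 0 x; first by rewrite ltr_pwDl ?flat1_gt0 ?flat1_ge0.
by rewrite ltr_wpDl ?flat1_gt0 ?flat1_ge0//; lra.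
Qed.

Lemma smooth_step : smooth step.
Proof.
have s1 : smooth (fun x : R => flat 1 (1 - x)).
  rewrite (_ : (fun _ => _) = (fun x => flat 1 (-1 * x + 1))).
    exact/smooth_reparam/smooth_flat.
  by apply/funext => x; rewrite mulN1r addrC.
apply: (@smoothM _ _ (flat 1) (fun x => (flat 1 x + flat 1 (1 - x))^-1)).
  exact: smooth_flat.
apply: (@smoothV _ _ (flat 1 + (fun x => flat 1 (1 - x)))).
  exact: smoothD (smooth_flat _) s1.
by move=> x; rewrite gt_eqF// step_den.
Qed.

Lemma step_ge0 x : 0 <= step x.
Proof. by rewrite divr_ge0 ?flat1_ge0// ltW ?step_den. Qed.

Lemma step_le1 x : step x <= 1.
Proof. by rewrite ler_pdivrMr ?step_den// mul1r lerDl flat1_ge0. Qed.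

Lemma step_eq0 (x : R) : x <= 0 -> step x = 0.
Proof. by move=> x0; rewrite /step flat_eq0 ?mul0r. Qed.

Lemma step_eq1 (x : R) : 1 <= x -> step x = 1.
Proof.
move=> x1; rewrite /step (@flat_eq0 _ (1 - x)) ?subr_le0// addr0 divff// gt_eqF//.
by rewrite flat1_gt0// (lt_le_trans _ x1).
Qed.

End smooth_line.

(** * Supports and test functions *)

Section supports.
Context {R : realType} {E : normedModType R}.
Implicit Types f g : E -> R.

Lemma supp_closed_sub f (K : set E) : closed K -> (forall x, f x != 0 -> K x) ->
  supp f `<=` K.
Proof.
move=> /closure_id cK fK; rewrite [X in _ `<=` X]cK.
by apply: closureS => x /fK.
Qed.

Lemma supp_neq0 f x : f x != 0 -> supp f x.
Proof. by move=> fx; exact: subset_closure. Qed.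

Lemma notin_supp f x : ~ supp f x -> f x = 0.
Proof. by move=> fx; apply: contrapT => /eqP/supp_neq0. Qed.

Lemma supp_derive f v : supp ('D_v f) `<=` supp f.
Proof.
apply: supp_closed_sub; first exact: closed_closure.
move=> x; apply: contraNP => fx; apply/eqP.
have o : open (~` supp f) by apply: closed_openC; exact: closed_closure.
have : \near x, f x = cst 0 x.
  have := open_nbhs_nbhs (conj o fx : open_nbhs x (~` supp f)).
  by apply: filterS => y; exact: notin_supp.
by move=> /near_eq_derive ->; rewrite derive_cst.
Qed.

Lemma test_function_sub (D K : set E) f : smooth f -> compact K -> closed K ->
  (forall x, f x != 0 -> K x) -> K `<=` D -> test_function D f.
Proof.
move=> sf cK clK fK KD; have sK := supp_closed_sub clK fK.
split=> //; last exact: subset_trans KD.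
exact: subclosed_compact (@closed_closure _ _) cK sK.
Qed.

Lemma test_function_derive D f v : test_function D f -> test_function D ('D_v f).
Proof.
move=> [sf cf fD]; apply: (@test_function_sub _ (supp f)) => //.
- exact: smooth_derive.
- exact: closed_closure.
- by move=> x h; apply: (@supp_derive f v); exact: supp_neq0.
Qed.

Lemma test_functionM D f g : smooth f -> test_function D g -> test_function D (f * g).
Proof.
move=> sf [sg cg gD]; apply: (@test_function_sub _ (supp g)) => //.
- exact: smoothM.
- exact: closed_closure.
- by move=> x; rewrite mulf_eq0 negb_or => /andP[_]; exact: supp_neq0.
Qed.

Lemma test_functionZ D (c : R) f : test_function D f -> test_function D (fun x => c * f x).
Proof. exact: (test_functionM (smooth_cst c)). Qed.

Lemma test_functionD D f g : test_function D f -> test_function D g ->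
  test_function D (f + g).
Proof.
move=> [sf cf fD] [sg cg gD]; apply: (@test_function_sub _ (supp f `|` supp g)).
- exact: smoothD.
- exact: compactU.
- by apply: closedU; exact: closed_closure.
- move=> x fg; have [f0|] := eqVneq (f x) 0; last by left; exact: supp_neq0.
  by right; apply: supp_neq0; have fgE : (f + g) x = f x + g x by []; rewrite fgE f0 add0r in fg.
- by move=> x [/fD|/gD].
Qed.

Lemma test_function_bounded D f : test_function D f ->
  exists2 M, 0 <= M & forall x, `|f x| <= M.
Proof.
move=> [sf cf _].
have : bounded_set (f @` supp f).
  apply: compact_bounded; apply: continuous_compact => //.
  by apply: continuous_subspaceT; exact: smooth_continuous.
move=> [M [_ MP]]; exists (`|M| + 1); first by rewrite addr_ge0.
move=> x; have [sx|/notin_supp ->] := pselect (supp f x); last first.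
  by rewrite normr0 addr_ge0.
by apply: (MP (`|M| + 1)); [rewrite (le_lt_trans (ler_norm M))// ltrDl|exists x].
Qed.

End supports.

(** * Test functions on R^n: mean value and Taylor estimates, boxes *)

Section test_rV.
Context {R : realType} {n : nat}.
Implicit Types (f : 'rV[R]_n -> R) (x y h : 'rV[R]_n).

Lemma rV_coord_le_norm x i : `|x ord0 i| <= `|x|.
Proof.
rewrite [leRHS]mx_normrE.
exact: (le_bigmax _ (fun ij : 'I_1 * 'I_n => `|x ij.1 ij.2|) (ord0, i)).
Qed.

Lemma rV_norm_le x (M : R) : 0 <= M -> (forall i, `|x ord0 i| <= M) -> `|x| <= M.
Proof.
move=> M0 xM; rewrite [leLHS]mx_normrE; apply: bigmax_le => // -[i j] _ /=.
by rewrite (ord1 i).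
Qed.

Lemma derive_coordE f x h : differentiable f x ->
  'D_h f x = \sum_i h ord0 i * 'D_(delta_mx ord0 i) f x.
Proof.
move=> df; rewrite deriveE// [in LHS](row_sum_delta h) linear_sum/=.
by apply: eq_bigr => i _; rewrite linearZ/= deriveE.
Qed.

Lemma line_is_derive f x h (s : R) : smooth f ->
  is_derive s 1 (fun s : R => f (x + s *: h)) ('D_h f (x + s *: h)).
Proof.
move=> sf; have df : differentiable f (s *: h + x) by exact: smooth_differentiable.
have ll : linear (fun s : R => s *: h) by move=> u y z; rewrite scalerDl scalerA.
have lc : continuous (fun s : R => s *: h) by move=> z; apply: scalel_continuous.
have dc : differentiable (fun s : R => f (s *: h + x)) s.
  by apply: differentiable_comp => //; have [] := diff_affine x s ll lc.
under eq_fun do rewrite addrC.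
rewrite addrC; split; first exact: diff_derivable.
by rewrite (@derive_comp_affine _ _ _ _ x f s 1 ll lc)//= scale1r.
Qed.

Lemma line_MVT f x h : smooth f ->
  exists2 c : R, 0 <= c <= 1 & f (x + h) - f x = 'D_h f (x + c *: h).
Proof.
move=> sf; have [||c] := @MVT_segment R (fun s => f (x + s *: h)) (fun s =>
  'D_h f (x + s *: h)) 0 1 ler01.
- by move=> s _; exact: line_is_derive.
- apply: derivable_within_continuous => s _.
  by have [] := @line_is_derive f x h s sf.
- rewrite in_itv/= => c01; rewrite scale1r scale0r addr0 subr0 mulr1 => ->.
  by exists c.
Qed.

Lemma test_function_lipschitz D f : test_function D f ->
  exists2 L, 0 <= L & forall x y, `|f x - f y| <= L * `|x - y|.
Proof.
move=> tf; have [sf _ _] := tf.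
have /choice[M MP] : forall i : 'I_n, exists M, 0 <= M /\
    forall x, `|'D_(delta_mx ord0 i) f x| <= M.
  move=> i; have [M M0 MP] := test_function_bounded (test_function_derive (delta_mx ord0 i) tf).
  by exists M.
exists (\sum_i M i); first by apply: sumr_ge0 => i _; have [] := MP i.
move=> x y; have [c _] := line_MVT y (x - y) sf; rewrite [y + _]addrC subrK => ->.
rewrite derive_coordE; last exact: smooth_differentiable.
rewrite mulr_suml (le_trans (ler_norm_sum _ _ _))//; apply: ler_sum => i _.
rewrite normrM mulrC ler_pM//; first by have [] := MP i.
exact: rV_coord_le_norm.
Qed.

(** The mean value theorem on the segment turns the increment into a derivative at an intermediate
    point. The partial derivatives are test functions again, hence Lipschitz, which yields the
    second factor |h|. The uniform constant is what makes convolutions differentiable. *)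
Lemma test_function_taylor D f : test_function D f ->
  exists2 C, 0 <= C &
    forall x h, `|f (x + h) - f x - 'D_h f x| <= C * `|h| ^+ 2.
Proof.
move=> tf; have [sf _ _] := tf.
have /choice[M MP] : forall i : 'I_n, exists M, 0 <= M /\
    forall x y, `|'D_(delta_mx ord0 i) f x - 'D_(delta_mx ord0 i) f y| <= M * `|x - y|.
  move=> i; have [M M0 MP] := test_function_lipschitz (test_function_derive (delta_mx ord0 i) tf).
  by exists M.
exists (\sum_i M i); first by apply: sumr_ge0 => i _; have [] := MP i.
move=> x h; have [c /andP[c0 c1] ->] := line_MVT x h sf.
rewrite !derive_coordE; try exact: smooth_differentiable.
rewrite -sumrB mulr_suml (le_trans (ler_norm_sum _ _ _))//; apply: ler_sum => i _.
have [M0 ML] := MP i.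
rewrite -mulrBr normrM expr2 mulrA mulrC ler_pM//; last exact: rV_coord_le_norm.
rewrite (le_trans (ML _ _))// addrAC subrr add0r ler_wpM2l//.
by rewrite normrZ ger0_norm// ler_piMl.
Qed.

Lemma smooth_coord_prod (g : 'I_n -> R -> R) : (forall i, smooth (g i)) ->
  smooth (fun x => \prod_(i < n) g i (x ord0 i)).
Proof.
move=> sg; apply: smooth_prod => i.
have -> : (fun x : 'rV[R]_n => g i (x ord0 i)) = (fun x => g i (x ord0 i + 0)).
  by apply/funext => x; rewrite addr0.
apply: (@smooth_comp_affine _ _ _ (fun x : 'rV[R]_n => x ord0 i) 0 (g i) _ _ (sg i)).
  by move=> k y z; rewrite !mxE.
by move=> z; apply: coord_continuous.
Qed.

Lemma box_compact (M : R) : compact [set x : 'rV[R]_n | forall i, `|x ord0 i| <= M].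
Proof.
rewrite (_ : mkset _ = [set x : 'rV[R]_n | forall i, `[- M, M]%classic (x ord0 i)]).
  by apply: (@rV_compact R n (fun=> `[- M, M]%classic)) => i; exact: segment_compact.
by apply/seteqP; split => x /= xM i; have := xM i; rewrite /= in_itv/= ler_norml.
Qed.

Lemma box_closed (M : R) : closed [set x : 'rV[R]_n | forall i, `|x ord0 i| <= M].
Proof. by apply: compact_closed; [exact: norm_hausdorff|exact: box_compact]. Qed.

Lemma test_function_box (f : 'rV[R]_n -> R) (M : R) : smooth f ->
  (forall x, f x != 0 -> forall i, `|x ord0 i| <= M) -> test_function setT f.
Proof.
move=> sf fM; apply: (@test_function_sub _ _ _ [set x : 'rV[R]_n | forall i,
  `|x ord0 i| <= M]) => //.
  exact: box_compact.
exact: box_closed.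
Qed.

Lemma test_function_supp_box D f : test_function D f ->
  exists2 M, 0 <= M & forall x, f x != 0 -> `|x| <= M.
Proof.
move=> [_ /compact_bounded[M [_ MP]] _]; exists (`|M| + 1); first by rewrite addr_ge0.
move=> x /supp_neq0; apply: MP.
by rewrite (le_lt_trans (ler_norm M))// ltrDl.
Qed.

End test_rV.

(** * Lebesgue measure on R^n and L^2 *)

Section borel_rV.
Context {R : realType} {n : nat}.
Local Notation rV := 'rV[R]_n.

Lemma measurable_rV_forall (A : 'I_n -> set R) : (forall i, measurable (A i)) ->
  measurable [set x : rV | forall i, A i (x ord0 i)].
Proof.
move=> mA; rewrite (_ : mkset _ =
    \bigcap_(i in [set: 'I_n]) (rV_coord i @^-1` A i)).
  apply: fin_bigcap_measurable => // i _.
  by rewrite -[X in measurable X]setTI; apply: measurable_rV_coord => //; exact: mA.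
by apply/seteqP; split=> x /= h i; [move=> _|]; exact: h.
Qed.

(** The sigma-algebra is generated by the coordinates, so the link with the topology is made by
    hand: an open set is the union of the countably many boxes with rational centre and half-side
    1/(k + 1) that it contains. *)
Lemma open_measurable_rV (U : set rV) : open U -> measurable U.
Proof.
move=> oU.
pose box (p : 'rV[rat]_n * nat) := [set x : rV | forall i,
  `](ratr (p.1 ord0 i) - p.2.+1%:R^-1), (ratr (p.1 ord0 i) + p.2.+1%:R^-1)[%classic (x ord0 i)].
have -> : U = \bigcup_p (if `[< box p `<=` U >] then box p else set0).
  apply/seteqP; split=> [x Ux|x [p _]]; last by case: ifPn => // /asboolP; exact.
  have := open_nbhs_nbhs (conj oU Ux : open_nbhs x U).
  move=> /nbhs_ballP[e /= e0 eU].
  (* A box of half-side 1/(k + 1) that contains x has all its points within 2/(k + 1) of x. *)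
  have [k _ ke] : exists2 k : nat, True & 2 * k.+1%:R^-1 < e.
    exists (Num.truncn (2 / e)) => //.
    by rewrite ltr_pdivrMr ?ltr0n// mulrC -ltr_pdivrMr// truncnS_gt// divr_ge0// ltW.
  have /choice[q qx] : forall i : 'I_n, exists q : rat,
      x ord0 i - k.+1%:R^-1 < ratr q < x ord0 i + k.+1%:R^-1.
    move=> i.
    have : x ord0 i - k.+1%:R^-1 < x ord0 i + k.+1%:R^-1.
      by rewrite ltrBlDr -addrA ltrDl addr_gt0.
    move=> /rat_in_itvoo[q]; rewrite in_itv/= => H; exists q; exact: H.
  exists (\row_i q i, k) => //.
  rewrite ifT; first by move=> i /=; rewrite mxE in_itv/=; case/andP: (qx i) => q1 q2;
    rewrite ltrBlDr q2 -ltrBlDr q1.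
  apply/asboolP => y /= yb; apply: eU; rewrite mx_norm_ball /ball_/=.
  apply: le_lt_trans ke; apply: rV_norm_le; first by rewrite mulr_ge0.
  move=> i; have := yb i; rewrite !mxE/= in_itv/= => /andP[y1 y2].
  have /andP[q1 q2] := qx i; rewrite ler_norml.
  move: y1 y2 q1 q2; set d := k.+1%:R^-1; set r := ratr _.
  by move=> y1 y2 q1 q2; apply/andP; split; lra.
apply: countable_bigcupT_measurable => [|p]; first exact: countableP.
case: ifPn => // _; apply: (@measurable_rV_forall (fun i =>
  `](ratr (p.1 ord0 i) - p.2.+1%:R^-1), (ratr (p.1 ord0 i) + p.2.+1%:R^-1)[%classic)) => i.
exact: measurable_itv.
Qed.

Lemma continuous_measurable_rV (f : rV -> R) : continuous f ->
  measurable_fun [set: rV] f.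
Proof.
move=> /continuousP cf.
apply: (measurability _ (RGenOInfty.measurableE R)) => _ [_ [a ->] <-].
by rewrite setTI; apply: open_measurable_rV; apply: cf; exact: interval_open.
Qed.

Lemma measurable_test_function D (f : rV -> R) : test_function D f ->
  measurable_fun [set: rV] f.
Proof. by move=> [sf _ _]; apply: continuous_measurable_rV; exact: smooth_continuous. Qed.

Lemma measurable_sub_rV : measurable_fun [set: rV * rV] (fun p => p.1 - p.2).
Proof.
apply/measurable_fun_rVP => i.
rewrite (_ : _ \o _ = fun p : rV * rV => rV_coord i p.1 - rV_coord i p.2).
  apply: measurable_funB; apply: measurableT_comp => //; exact: measurable_rV_coord.
by apply/funext => p; rewrite /rV_coord/= !mxE.
Qed.

End borel_rV.

Section lebesgue_rV_integral.
Context {R : realType}.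
Local Open Scope ereal_scope.

Lemma integral_rV_prod n (g : 'I_n -> R -> R) :
  (forall i, measurable_fun [set: R] (g i)) -> (forall i s, (0 <= g i s)%R) ->
  \int[@lebesgue_rV R n]_x (\prod_(i < n) g i (x ord0 i))%:E =
  \prod_(i < n) \int[lebesgue_measure]_s (g i s)%:E.
Proof.
elim: n g => [|n IH] g mg g0.
  rewrite big_ord0 /=; under eq_integral do rewrite big_ord0.
  by rewrite integral_dirac// diracT mul1e.
have mprod m (h : 'I_m -> R -> R) : (forall i, measurable_fun [set: R] (h i)) ->
    measurable_fun [set: 'rV[R]_m] (fun x : 'rV[R]_m => \prod_(i < m) h i (x ord0 i))%R.
  move=> mh; apply: measurable_prod => i _.
  by apply: measurableT_comp => //; exact: measurable_rV_coord.
rewrite big_ord_recl -IH; [|by move=> i; exact: mg|by []].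
rewrite /= /rV_cons_measure ge0_integral_pushforward//=; last first.
- by move=> y _; rewrite lee_fin prodr_ge0.
- by apply/measurable_EFinP; exact: mprod.
rewrite preimage_setT.
have E (p : measurableTypeR R * 'rV[R]_n) : (\prod_(i < n.+1) g i (rV_cons p ord0 i) =
   g ord0 p.1 * \prod_(i < n) g (lift ord0 i) (p.2 ord0 i))%R.
  rewrite /= big_ord_recl mxE unlift_none/=; congr (_ * _)%R.
  by apply: eq_bigr => i _; rewrite mxE liftK.
under eq_integral do rewrite E.
rewrite fubini_tonelli1//=; last 2 first.
- apply/measurable_EFinP; apply: measurable_funM.
    by apply: (measurableT_comp (mg ord0)); exact: measurable_fst.
  have mp := mprod n (fun i => g (lift ord0 i)) (fun i => mg _).
  by apply: (measurableT_comp mp); exact: measurable_snd.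
- by move=> p; rewrite lee_fin mulr_ge0// prodr_ge0.
rewrite /fubini_F/=.
under eq_integral => s _.
  under eq_integral do rewrite EFinM.
  rewrite ge0_integralZl//; last 3 first.
  - by apply/measurable_EFinP; exact: (mprod n (fun i => g (lift ord0 i)) (fun i => mg _)).
  - by move=> x _; rewrite lee_fin prodr_ge0.
  - by rewrite lee_fin.
  over.
rewrite ge0_integralZr//.
- by apply/measurable_EFinP; exact: mg.
- by move=> s _; rewrite lee_fin.
- by apply: integral_ge0 => x _; rewrite lee_fin prodr_ge0.
Qed.

(** Translation invariance in one dimension is enough: the mollifiers on R^n are products of
    functions of one coordinate, and [integral_rV_prod] splits their integrals. *)
Lemma integral_shift_continuous (g : R -> R) (c : R) : continuous g ->
  (forall x, (0 <= g x)%R) ->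
  \int[lebesgue_measure]_x (g (x - c)%R)%:E = \int[lebesgue_measure]_x (g x)%:E.
Proof.
move=> cg g0.
pose F (x : R) := (x - c)%R.
have dF (x : R) : is_derive x 1%R F 1%R.
  have := is_deriveB (is_derive_id x 1%R) (is_derive_cst c x 1%R).
  by rewrite subr0.
have F1 : F^`()%classic = cst 1%R.
  by apply/funext => x; rewrite derive1E; have [_ ->] := dF x.
rewrite (@increasing_ge0_integration_by_substitutionT _ F g)//.
- by rewrite F1; apply: eq_integral => x _ /=; rewrite mulr1.
- by move=> x y xy; rewrite ltrD2r.
- by rewrite F1 => x; exact: cst_continuous.
- by rewrite F1; exact: is_cvg_cst.
- by rewrite F1; exact: is_cvg_cst.
- apply/cvgrNyPle => A; near=> x; rewrite /F lerBlDr.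
  by near: x; apply: nbhs_ninfty_le; exact: num_real.
- apply/cvgryPge => A; near=> x; rewrite /F lerBrDr.
  by near: x; apply: nbhs_pinfty_ge; exact: num_real.
Unshelve. all: by end_near. Qed.

End lebesgue_rV_integral.

Section L2_space.
Context d (T : measurableType d) (R : realType).
Variable mu : {measure set T -> \bar R}.
Local Notation X := (LfunType mu (lee1n 2)).

Definition L2ip (f g : X) : R := \int[mu]_x (f x * g x).

Lemma Lfun2_integrableM (f g : T -> R) : f \in Lfun mu 2%:E -> g \in Lfun mu 2%:E ->
  mu.-integrable setT (EFin \o (fun x => f x * g x)).
Proof. by move=> f2 g2; apply/Lfun1_integrable; exact: Lfun2_mul_Lfun1. Qed.

Lemma L2ip_semi_inner : semi_inner L2ip.
Proof.
split.
- by move=> f g; apply: eq_Rintegral => x _; rewrite mulrC.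
- move=> c f g h; rewrite /L2ip.
  rewrite -RintegralZl//; last by apply: Lfun2_integrableM; exact: LfunP.
  rewrite -RintegralD//; last 2 first.
  + have := integrableZl measurableT c (Lfun2_integrableM (LfunP f) (LfunP h)).
    by under eq_fun do rewrite -EFinM.
  + by apply: Lfun2_integrableM; exact: LfunP.
  by apply: eq_Rintegral => x _; rewrite mulrDl mulrA.
- by move=> f; apply: Rintegral_ge0 => x _; rewrite -expr2 sqr_ge0.
Qed.

Let norm_sqr (f : T -> R) x : (`|(f x)%:E| `^ 2)%E = (f x ^+ 2)%:E.
Proof.
rewrite -[LHS]/((`|f x| `^ 2)%:E) powR_mulrn// -normrX ger0_norm// sqr_ge0//.
Qed.

Lemma Lnorm2E (f : T -> R) : f \in Lfun mu 2%:E ->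
  ('N[mu]_2%:E[EFin \o f] = (Num.sqrt (\int[mu]_x (f x * f x)%R))%:E)%E.
Proof.
move=> f2; have fi := Lfun2_integrableM f2 f2.
have E : (\int[mu]_x `|(f x)%:E| `^ 2 = (\int[mu]_x (f x * f x)%R)%:E)%E.
  rewrite /Rintegral fineK; last exact: integrable_fin_num.
  by apply: eq_integral => x _; rewrite norm_sqr expr2.
rewrite unlock /Lnorm E -[LHS]/((_ `^ 2^-1)%:E) powR12_sqrt//.
by apply: Rintegral_ge0 => x _; rewrite -expr2 sqr_ge0.
Qed.

Lemma L2_of_sqr (f : T -> R) : measurable_fun setT f ->
  (\int[mu]_x (f x ^+ 2)%:E < +oo)%E -> f \in Lfun mu 2%:E.
Proof.
move=> mf fi; rewrite inE; apply/andP; split; rewrite inE//=.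
rewrite /finite_norm unlock /Lnorm poweR_lty//.
by under eq_integral => x _ do rewrite [X in (`|X| `^ _)%E]/= norm_sqr.
Qed.

Lemma Lfun2_measurable (f : T -> R) : f \in Lfun mu 2%:E -> measurable_fun setT f.
Proof. by rewrite inE => /andP[]; rewrite inE. Qed.

Lemma Lfun2_lin (c : R) (f g : T -> R) : f \in Lfun mu 2%:E -> g \in Lfun mu 2%:E ->
  (fun x => c * f x + g x) \in Lfun mu 2%:E.
Proof.
move=> f2 g2; have [_ /(_ c f g f2 g2)] := Lfun_submod_closed mu (lee1n 2).
by [].
Qed.

Lemma Lfun2B (f g : T -> R) : f \in Lfun mu 2%:E -> g \in Lfun mu 2%:E ->
  (fun x => f x - g x) \in Lfun mu 2%:E.
Proof.
move=> f2 g2; have := Lfun2_lin (-1) g2 f2.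
by under eq_fun do rewrite mulN1r addrC.
Qed.

Lemma L2_bounded_mul (h q : T -> R) (M : R) : measurable_fun setT h ->
  (forall x, `|h x| <= M) -> q \in Lfun mu 2%:E -> (fun x => h x * q x) \in Lfun mu 2%:E.
Proof.
move=> mh hM q2; have mq := Lfun2_measurable q2.
apply: L2_of_sqr; first exact: measurable_funM.
have := integrableZl measurableT (M ^+ 2) (Lfun2_integrableM q2 q2).
move=> /integrableP[_]; apply: le_lt_trans; apply: ge0_le_integral => //.
- by move=> x _; rewrite lee_fin sqr_ge0.
- by apply/measurable_EFinP; apply: measurable_funX; exact: measurable_funM.
- apply: measurableT_comp => //; apply: measurable_funeM.
  by apply/measurable_EFinP; exact: measurable_funM.
- move=> x _; rewrite /= lee_fin; apply: le_trans (ler_norm _);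
  rewrite exprMn -expr2 ler_wpM2r ?sqr_ge0//.
  by rewrite -(real_normK (num_real (h x))) lerXn2r ?nnegrE// (le_trans _ (hM x)).
Qed.

Lemma integral_indicZ (c : R) (A : set T) : measurable A -> 0 <= c ->
  (\int[mu]_x (c%:E * (\1_A x)%:E) = c%:E * mu A)%E.
Proof.
move=> mA c0; rewrite ge0_integralZl ?lee_fin//.
- by rewrite integral_indic// setIT.
- by apply/measurable_EFinP; exact: measurable_indic.
Qed.

End L2_space.

(** * Density of test functions in L^2 *)

Section test_function_dense.
Context {R : realType} {n : nat}.
Local Notation mu := (@lebesgue_rV R n).
Local Notation rV := 'rV[R]_n.

(** Squared L^2 distance as an extended real: approximation can then be discussed for measurable
    functions, without a proof of square integrability attached to each of them. *)
Definition dist2 (f g : rV -> R) : \bar R := (\int[mu]_x ((f x - g x) ^+ 2)%:E)%E.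

Lemma measurable_dist2 (f g : rV -> R) : measurable_fun setT f -> measurable_fun setT g ->
  measurable_fun setT (fun x => ((f x - g x) ^+ 2)%:E).
Proof.
by move=> mf mg; apply/measurable_EFinP; apply: measurable_funX; exact: measurable_funB.
Qed.

(** Distances are squared, hence the factor 2, from (p + q)^2 <= 2 p^2 + 2 q^2. *)
Lemma dist2_triangle (f g h : rV -> R) : measurable_fun setT f ->
  measurable_fun setT g -> measurable_fun setT h ->
  (dist2 f h <= 2%:E * (dist2 f g + dist2 g h))%E.
Proof.
move=> mf mg mh; rewrite /dist2.
rewrite -ge0_integralD//; last 4 first.
- by move=> x _; rewrite lee_fin sqr_ge0.
- exact: measurable_dist2.
- by move=> x _; rewrite lee_fin sqr_ge0.
- exact: measurable_dist2.
rewrite -ge0_integralZl//; last 2 first.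
- by apply: emeasurable_funD; exact: measurable_dist2.
- by move=> x _; rewrite -EFinD lee_fin addr_ge0 ?sqr_ge0.
apply: ge0_le_integral => //.
- by move=> x _; rewrite lee_fin sqr_ge0.
- exact: measurable_dist2.
- by apply: measurable_funeM; apply: emeasurable_funD; exact: measurable_dist2.
- move=> x _; rewrite -EFinD -EFinM lee_fin.
  have := sqr_ge0 ((f x - g x) - (g x - h x)).
  rewrite -subr_ge0; congr (_ <= _); ring.
Qed.

Lemma dist2_dominated (f_ : nat -> rV -> R) (f g : rV -> R) :
  (forall k, measurable_fun setT (f_ k)) -> measurable_fun setT f ->
  mu.-integrable setT (EFin \o g) ->
  (forall x, f_ k x @[k --> \oo] --> f x) ->
  (forall k x, (f_ k x - f x) ^+ 2 <= g x) ->
  (dist2 (f_ k) f @[k --> \oo] --> 0)%E.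
Proof.
move=> mf_ mf ig f_f fg.
case: (@dominated_convergence _ _ _ mu setT measurableT
  (fun k x => ((f_ k x - f x) ^+ 2)%:E) (cst 0%E) (EFin \o g)) => [k||||| _ _].
- exact: measurable_dist2.
- exact: measurable_cst.
- apply: aeW => x _; apply: cvg_EFin; first exact: nearW.
  rewrite -[X in _ --> X](expr0n R 2)/= -(subrr (f x)).
  have H : f_ k x - f x @[k --> \oo] --> f x - f x by apply: cvgB => //; exact: cvg_cst.
  exact: (cvg_comp _ _ H (@exprn_continuous _ 2 _)).
- exact: ig.
- by apply: aeW => k x _; rewrite /= ger0_norm ?sqr_ge0// lee_fin.
- by rewrite /= integral0.
Qed.

Lemma ecvg0_le (F : nat -> \bar R) (e : R) : (F k @[k --> \oo] --> 0)%E -> 0 < e ->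
  exists k, (F k <= e%:E)%E.
Proof.
move=> /fine_cvgP[fin /cvgrPdistC_le H] e0; have := H _ e0.
move=> /(filterI fin) /filter_ex[k /= [kfin]]; rewrite subr0 => ke; exists k.
by rewrite -(fineK kfin) lee_fin (le_trans (ler_norm _)).
Qed.

Lemma dist2C f g : dist2 f g = dist2 g f.
Proof. by apply: eq_integral => x _; rewrite -sqrrN opprB. Qed.

Definition test_closure (f : rV -> R) := measurable_fun setT f /\
  forall e : R, 0 < e -> exists2 psi, test_function setT psi & (dist2 f psi <= e%:E)%E.

Lemma test_closure_lim (f : rV -> R) : measurable_fun setT f ->
  (forall e : R, 0 < e -> exists2 g, test_closure g & (dist2 f g <= e%:E)%E) ->
  test_closure f.
Proof.
move=> mf H; split=> // e e0; have e40 : 0 < e / 4 by rewrite divr_gt0.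
have [g [mg gP] fg] := H _ e40; have [psi tpsi gpsi] := gP _ e40.
exists psi => //; apply: (le_trans (dist2_triangle mf mg (measurable_test_function tpsi))).
apply: (@le_trans _ _ (2%:E * ((e / 4)%:E + (e / 4)%:E))%E).
  by rewrite lee_pmul2l//= leeD.
by rewrite -EFinD -EFinM lee_fin; lra.
Qed.

Lemma test_closure_dominated (f_ : nat -> rV -> R) (f g : rV -> R) :
  (forall k, test_closure (f_ k)) -> measurable_fun setT f ->
  mu.-integrable setT (EFin \o g) ->
  (forall x, f_ k x @[k --> \oo] --> f x) ->
  (forall k x, (f_ k x - f x) ^+ 2 <= g x) -> test_closure f.
Proof.
move=> tf mf ig f_f fg; apply: test_closure_lim => // e e0.
have mf_ k : measurable_fun setT (f_ k) by have [] := tf k.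
have [k ke] := ecvg0_le (dist2_dominated mf_ mf ig f_f fg) e0.
by exists (f_ k) => //; rewrite dist2C.
Qed.

Lemma test_closure_test (f : rV -> R) : test_function setT f -> test_closure f.
Proof.
move=> tf; split; first exact: measurable_test_function tf.
move=> e e0; exists f => //; rewrite /dist2; under eq_integral do rewrite subrr expr0n/=.
by rewrite integral0 lee_fin ltW.
Qed.

Lemma test_closureZ (c : R) (f : rV -> R) : test_closure f -> test_closure (fun x => c * f x).
Proof.
move=> [mf tf]; split; first exact: measurable_funM.
move=> e e0; have e'0 : 0 < e / (c ^+ 2 + 1) by rewrite divr_gt0// ltr_wpDl// sqr_ge0.
have [psi tpsi fpsi] := tf _ e'0; exists (fun x => c * psi x); first exact: test_functionZ.
rewrite /dist2; under eq_integral do rewrite -mulrBr exprMn EFinM.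
rewrite ge0_integralZl//; last 3 first.
- exact: measurable_dist2 (measurable_test_function tpsi).
- by move=> x _; rewrite lee_fin sqr_ge0.
- by rewrite lee_fin sqr_ge0.
apply: (le_trans (lee_wpmul2l _ fpsi)); first by rewrite lee_fin sqr_ge0.
by rewrite -EFinM lee_fin mulrCA ger_pMr// ler_pdivrMr ?mul1r ?lerDl// ltr_wpDl// sqr_ge0.
Qed.

Lemma test_closureD (f g : rV -> R) : test_closure f -> test_closure g ->
  test_closure (fun x => f x + g x).
Proof.
move=> [mf tf] [mg tg]; split; first exact: measurable_funD.
move=> e e0; have e40 : 0 < e / 4 by rewrite divr_gt0.
have [psi tpsi fpsi] := tf _ e40; have [phi tphi gphi] := tg _ e40.
exists (psi + phi); first exact: test_functionD.
have mpsi := measurable_test_function tpsi; have mphi := measurable_test_function tphi.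
have mpg : measurable_fun setT (fun x => psi x + g x) by exact: measurable_funD.
apply: (le_trans (@dist2_triangle _ (fun x => psi x + g x) _ _ _ _)) => //.
- exact: measurable_funD.
- exact: measurable_funD.
apply: (@le_trans _ _ (2%:E * ((e / 4)%:E + (e / 4)%:E))%E).
  rewrite lee_pmul2l//=; apply: leeD.
    rewrite /dist2; under eq_integral do rewrite opprD addrACA subrr addr0.
    exact: fpsi.
  rewrite /dist2; under eq_integral => x _.
    rewrite (_ : psi x + g x - (psi + phi) x = g x - phi x); first over.
    by rewrite -[(psi + phi) x]/(psi x + phi x); ring.
  exact: gphi.
by rewrite -EFinD -EFinM lee_fin; lra.
Qed.

Lemma test_closureB (f g : rV -> R) : test_closure f -> test_closure g ->
  test_closure (fun x => f x - g x).
Proof.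
move=> tf tg; have := test_closureD tf (test_closureZ (-1) tg).
by under eq_fun do rewrite mulN1r.
Qed.

Lemma test_closure_sum m (F : 'I_m -> rV -> R) : (forall i, test_closure (F i)) ->
  test_closure (fun x => \sum_(i < m) F i x).
Proof.
elim: m F => [|m IH] F tF.
  under eq_fun do rewrite big_ord0.
  apply: test_closure_test; apply: (@test_function_box _ _ _ 0); first exact: smooth_cst.
  by move=> x; rewrite eqxx.
under eq_fun do rewrite big_ord_recr/=.
by apply: test_closureD => //; apply: IH => i; exact: tF.
Qed.

Definition cube (M : R) : set rV := [set x | forall i, `]-M, M[%classic (x ord0 i)].

Lemma measurable_cube M : measurable (cube M).
Proof. by apply: (@measurable_rV_forall _ _ (fun=> `]-M, M[%classic)) => i;
  exact: measurable_itv. Qed.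

Lemma cube_fin M : (mu (cube M) < +oo)%E.
Proof.
rewrite (@lebesgue_rV_box _ _ (fun=> `]-M, M[%classic)); last by move=> i; exact: measurable_itv.
rewrite ltey_eq; apply/orP; left.
elim/big_ind : _ => [//|x y xoo yoo|i _]; first exact: fin_numM.
by rewrite lebesgue_measure_itv/=; case: ifP.
Qed.

Lemma integrable_cube M : mu.-integrable setT (EFin \o \1_(cube M)).
Proof.
apply/integrableP; split; first by apply/measurable_EFinP;
  exact: measurable_indic (measurable_cube M).
under eq_integral do rewrite /= ger0_norm//.
by rewrite integral_indic ?setIT ?cube_fin//; exact: measurable_cube.
Qed.

Lemma indic_sqr_diff_cube (M : R) (A B : set rV) : A `<=` cube M -> B `<=` cube M ->
  forall x, (\1_A x - \1_B x : R) ^+ 2 <= \1_(cube M) x.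
Proof.
move=> AM BM x; rewrite !indicE.
have [xM|xM] := boolP (x \in cube M).
  by case: (x \in A); case: (x \in B); rewrite /= ?subrr ?subr0 ?sub0r ?expr0n ?sqrrN ?expr1n.
have [xA|xA] := boolP (x \in A).
  by move: xM; rewrite notin_setE; move: xA; rewrite inE => /AM.
have [xB|xB] := boolP (x \in B).
  by move: xM; rewrite notin_setE; move: xB; rewrite inE => /BM.
by rewrite subrr expr0n.
Qed.

(** These orthants are stable under intersection and generate the sigma-algebra, and smooth products
    approximate their indicators inside a cube: a starting point for Dynkin's lemma. *)
Definition corner (a : rV) : set rV := [set x | forall i, a ord0 i < x ord0 i].

Lemma test_closure_corner (a : rV) (M : R) : test_closure \1_(corner a `&` cube M).
Proof.
pose b i := Num.max (a ord0 i) (- M).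
(* For large k this rises from 0 to 1 on [b_i, b_i + 1/k] and falls back to 0 on [M - 1/k, M]. It
   vanishes off the open interval, so the products converge from inside to the indicator. *)
pose g (k : nat) (i : 'I_n) (s : R) := step (k%:R * s + - (k%:R * b i)) * step (- k%:R * s +
  k%:R * M).
pose f_ (k : nat) (x : rV) := \prod_(i < n) g k i (x ord0 i).
have AE x : (corner a `&` cube M) x <-> forall i, b i < x ord0 i < M.
  split=> [[xa xM] i|H].
    by have := xM i; rewrite /= in_itv/= /b gt_max => /andP[-> ->]; rewrite xa.
  by split=> i; have := H i; rewrite /b gt_max/= => /andP[/andP[xa xM] xM'];
    rewrite //= in_itv/= xM xM'.
have g0 k i s : ~ (b i < s < M) -> g k i s = 0.
  move=> /negP; rewrite negb_and -!leNgt => /orP[sb|sM]; rewrite /g.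
    rewrite (@step_eq0 _ (_ + _)) ?mul0r// -mulrBr mulr_ge0_le0// ?subr_le0//.
  by rewrite mulrC (@step_eq0 _ (_ + _)) ?mul0r// mulNr addrC -mulrBr mulr_ge0_le0// ?subr_le0.
have f01 k x : 0 <= f_ k x <= 1.
  rewrite /f_; elim/big_ind : _ => [|p q /andP[p0 p1] /andP[q0 q1]|i _];
    first by rewrite ler01 lexx.
    by rewrite mulr_ge0// mulr_ile1.
  by rewrite mulr_ge0 ?step_ge0// mulr_ile1// ?step_ge0// step_le1.
have f0 k x : ~ (corner a `&` cube M) x -> f_ k x = 0.
  move=> /AE/existsNP[i xi]; rewrite /f_ (bigD1 i)//= g0 ?mul0r//.
have mA : measurable (corner a `&` cube M).
  apply: measurableI; last exact: measurable_cube.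
  rewrite (_ : corner a = [set x | forall i, `]a ord0 i, +oo[%classic (x ord0 i)]).
    by apply: (@measurable_rV_forall _ _ (fun i => `]a ord0 i, +oo[%classic)) => i;
      exact: measurable_itv.
  by apply/seteqP; split=> x /= xa i; have := xa i; rewrite /= in_itv/= andbT.
apply: (@test_closure_dominated f_ _ \1_(cube M)).
- move=> k; apply: test_closure_test; apply: (@test_function_box _ _ _ `|M|).
    apply: smooth_coord_prod => i.
    by rewrite /g; apply: (@smoothM _ _ (fun s : R => step (k%:R * s + - (k%:R * b i))) (fun
      s : R => step (- k%:R * s + k%:R * M)));
      apply: smooth_reparam; exact: smooth_step.
  move=> x fx i; have : (corner a `&` cube M) x by apply: contrapT => /(f0 k) /eqP fx0;
    rewrite fx0 in fx.
  move=> /AE /(_ i); rewrite /b gt_max => /andP[/andP[_ xM] xM'].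
  rewrite ler_norml; apply/andP; split.
    by rewrite lerNl (le_trans _ (ler_norm M))// lerNl ltW.
  by rewrite (le_trans (ltW xM')) ?ler_norm.
- exact: measurable_indic.
- exact: integrable_cube.
- move=> x; have [xA|xA] := pselect ((corner a `&` cube M) x); last first.
    rewrite indicE memNset//; under eq_fun do rewrite f0//; exact: cvg_cst.
  rewrite indicE mem_set//; apply: cvg_near_cst.
  have H : \forall k \near \oo, forall i, g k i (x ord0 i) = 1.
    apply: filter_forall => i; have /AE/(_ i)/andP[bx xM] := xA.
    near=> k; rewrite /g !step_eq1 ?mulr1//.
      rewrite mulNr addrC -mulrBr -ler_pdivrMr ?subr_gt0//; near: k; exact: nbhs_infty_ger.
    by rewrite -mulrBr -ler_pdivrMr ?subr_gt0//; near: k; exact: nbhs_infty_ger.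
  by apply: filterS H => k gk; rewrite /f_ big1.
- move=> k x; rewrite indicE; have [xA|xA] := pselect ((corner a `&` cube M) x); last first.
    by rewrite f0// memNset// subrr expr0n.
  rewrite mem_set// indicE mem_set/=; last by case: xA.
  have /andP[f0' f1] := f01 k x.
  by rewrite -sqrrN opprB expr_le1// ?subr_ge0// lerBlDr lerDl.
Unshelve. all: by end_near. Qed.

Let corners : set (set rV) := range corner.

Lemma corner_setI_closed : setI_closed corners.
Proof.
move=> _ _ [a _ <-] [b _ <-]; exists (\row_i Num.max (a ord0 i) (b ord0 i)) => //.
apply/seteqP; split=> x /=.
  by move=> H; split=> i; have := H i; rewrite mxE gt_max => /andP[].
by move=> [xa xb] i; rewrite mxE gt_max xa xb.
Qed.

Lemma measurable_corners (A : set rV) : measurable A -> <<s corners >> A.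
Proof.
have sC : sigma_algebra setT <<s corners >> by exact: smallest_sigma_algebra.
have [C0 CC CU] := sC.
apply: smallest_sub => //; rewrite -bigcup_seq; apply: bigcup_sub => i _ _ [B mB <-].
suff : @measurable _ (measurableTypeR R) `<=` [set B | <<s corners >> (setT `&` rV_coord i
  @^-1` B)].
  by apply.
rewrite [X in X `<=` _](_ : _ = <<s @RGenOInfty.G R >>); last exact: RGenOInfty.measurableE.
apply: smallest_sub.
- split => /=.
  + by rewrite preimage_set0 setI0.
  + move=> D; rewrite !setTI setTD => /CC; by rewrite setTD preimage_setC.
  + move=> F CF; rewrite setTI preimage_bigcup; apply: CU => k; have := CF k; by rewrite setTI.
- move=> _ [a ->] /=; rewrite setTI.
  (* A half-space constrains one coordinate only; it is the union of the orthants whose other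
     thresholds are -k. *)
  rewrite (_ : _ @^-1` _ = \bigcup_(k : nat) corner (\row_j if j == i then a else - k%:R)).
    by apply: CU => k; apply: sub_sigma_algebra; eexists.
  apply/seteqP; split=> x /=; rewrite in_itv/= andbT /rV_coord.
    move=> ax; exists (Num.truncn `|x|).+1 => // j; rewrite mxE; case: eqP => [->//|_].
    rewrite ltrNl (le_lt_trans (ler_norm _))// normrN (le_lt_trans (rV_coord_le_norm _ _))//.
    exact: truncnS_gt.
  by move=> [k _ /(_ i)]; rewrite mxE eqxx.
Qed.

Lemma measurable_indic_cube A M : measurable A ->
  measurable_fun setT (\1_(A `&` cube M) : rV -> R).
Proof. by move=> mA; apply: measurable_indic; apply: measurableI => //;
  exact: measurable_cube. Qed.

(** Dynkin's argument: the sets whose trace on the cube has an approximable indicator form a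
    lambda-system containing the orthants. Keeping the cube fixed provides one integrable majorant
    for all monotone limits. *)
Lemma test_closure_indic (A : set rV) (M : R) : measurable A ->
  test_closure \1_(A `&` cube M).
Proof.
move=> mA; pose H : set (set rV) := [set A | measurable A /\ test_closure \1_(A `&` cube M)].
suff : <<s corners >> `<=` H by move=> /(_ A (measurable_corners mA)) [].
apply: lambda_system_subset.
- exact: corner_setI_closed.
- split=> //.
  + split=> //; have -> : setT `&` cube M = corner (const_mx (- M)) `&` cube M.
      apply/seteqP; split=> x [_ xM]; split=> // i; rewrite mxE.
      by have := xM i; rewrite /= in_itv/= => /andP[].
    exact: test_closure_corner.
  + move=> B C CB [mB tB] [mC tC]; split; first exact: measurableD.
    rewrite (_ : \1_(_ `&` _) = fun x => \1_(B `&` cube M) x - \1_(C `&` cube M) x).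
      exact: test_closureB.
    apply/funext => x; rewrite !indicE.
    have [xC|xC] := pselect (C x).
      rewrite [in LHS]memNset; last by move=> [[_]].
      have [xM|xM] := pselect (cube M x); last by rewrite !memNset ?subrr// => -[].
      by rewrite !mem_set ?subrr//; split=> //; exact: CB.
    rewrite [x \in C `&` _]memNset; last by move=> [].
    rewrite subr0; congr (_%:R); congr nat_of_bool.
    by apply/idP/idP => /set_mem; [move=> [[xB _] xM]|move=> [xB xM]]; apply: mem_set.
  + move=> F ndF HF; have mF k : measurable (F k) by have [] := HF k.
    split; first exact: bigcupT_measurable.
    apply: (@test_closure_dominated (fun k => \1_(F k `&` cube M)) _ \1_(cube M)).
    * by move=> k; have [] := HF k.
    * by apply: measurable_indic_cube; exact: bigcupT_measurable.
    * exact: integrable_cube.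
    * move=> x; rewrite indicE; have [[[k _ Fk] xM]|nx] := pselect ((\bigcup_k F k `&` cube M) x).
        rewrite mem_set; last by split=> //; exists k.
        apply: cvg_near_cst; near=> l; rewrite indicE mem_set//; split=> //.
        have kl : (k <= l)%N by near: l; exact: nbhs_infty_ge.
        by move: x Fk {xM}; exact/subsetPset/ndF.
      rewrite memNset//; apply: cvg_near_cst; apply: nearW => k.
      by rewrite indicE memNset// => -[xk xM]; apply: nx; split=> //; exists k.
    * by move=> k; apply: indic_sqr_diff_cube; exact: subIsetr.
- move=> _ [a _ <-]; split; last exact: test_closure_corner.
  rewrite (_ : corner a = [set x | forall i, `]a ord0 i, +oo[%classic (x ord0 i)]).
    by apply: (@measurable_rV_forall _ _ (fun i => `]a ord0 i, +oo[%classic)) => i;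
      exact: measurable_itv.
  by apply/seteqP; split=> x /= xa i; have := xa i; rewrite /= in_itv/= andbT.
- by [].
Unshelve. all: by end_near. Qed.

Import HBSimple HBNNSimple.

Lemma test_closure_ge0 (f : rV -> R) : measurable_fun setT f -> (forall x, 0 <= f x) ->
  mu.-integrable setT (EFin \o (fun x => f x ^+ 2)) -> test_closure f.
Proof.
move=> mf f0 fi; have mEf : measurable_fun setT (EFin \o f) by exact/measurable_EFinP.
pose p := nnsfun_approx measurableT mEf.
have pf k x : 0 <= p k x <= f x.
  apply/andP; split; first exact: fun_ge0.
  rewrite nnsfun_approxE -lee_fin.
  exact: (@le_approx _ _ _ setT (EFin \o f) k x (fun x _ => f0 x) I).
have pcvg x : p k x @[k --> \oo] --> f x.
  under eq_fun do rewrite nnsfun_approxE.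
  by apply: (@cvg_approx _ _ _ setT (EFin \o f) x (fun x _ => f0 x) I); rewrite ltry.
(* Indicators of level sets are known to be approximable only inside a cube, so the k-th simple
   function is also truncated to the cube of half-side k, which exhausts the space. *)
apply: (@test_closure_dominated (fun k x => p k x * \1_(cube k%:R) x) _ (fun x =>
  f x ^+ 2)) => //.
- move=> k.
  have indM (A B : set rV) x : \1_A x * \1_B x = \1_(A `&` B) x :> R by rewrite indicI.
  under eq_fun => x do rewrite fimfunEord mulr_suml.
  apply: test_closure_sum => i.
  under eq_fun => x do rewrite -mulrA indM.
  apply: test_closureZ; apply: test_closure_indic.
  by rewrite -[X in measurable X]setTI; apply: measurable_funP.
- move=> x; rewrite -[X in _ --> X]mulr1; apply: cvgM => //.
  apply: cvg_near_cst; near=> k; rewrite indicE mem_set// => i /=.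
  rewrite in_itv/= -ltr_norml (le_lt_trans (rV_coord_le_norm _ _))//.
  by near: k; exact: nbhs_infty_gtr.
- move=> k x; have /andP[p0 pfx] := pf k x; rewrite -sqrrN opprB.
  rewrite lerXn2r ?nnegrE//.
    by rewrite subr_ge0 indicE; case: (_ \in _); rewrite ?mulr1 ?mulr0.
  by rewrite lerBlDr lerDl mulr_ge0// indicE.
Unshelve. all: by end_near. Qed.

Lemma test_function_dense_L2 (f : rV -> R) (e : R) : L2 f -> 0 < e ->
  exists2 psi, test_function setT psi & (dist2 f psi <= e%:E)%E.
Proof.
move=> f2; have fi := Lfun2_integrable_sqr f2; have mf := Lfun2_measurable f2.
suff [_] : test_closure f by apply.
have H (g : rV -> R) : measurable_fun setT g -> (forall x, 0 <= g x) ->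
  (forall x, g x <= `|f x|) -> test_closure g.
  move=> mg g0 gf; apply: test_closure_ge0 => //.
  apply: (le_integrable measurableT _ _ fi).
    by apply/measurable_EFinP; exact: measurable_funX.
  move=> x _; rewrite /= lee_fin !ger0_norm ?sqr_ge0// -(real_normK (num_real (f x))).
  by rewrite lerXn2r ?nnegrE.
have -> : f = (fun x => Num.max (f x) 0 - Num.max (- f x) 0).
  apply/funext => x; have [fx|fx] := leP 0 (f x).
    by rewrite max_r ?subr0// oppr_le0.
  by rewrite max_l ?sub0r ?opprK// oppr_ge0 ltW.
apply: test_closureB; apply: H.
- by apply: measurable_maxr => //; exact: measurable_cst.
- by move=> x; rewrite le_max lexx orbT.
- by move=> x; rewrite ge_max normr_ge0 ler_norm.
- by apply: measurable_maxr; [exact: measurableT_comp|exact: measurable_cst].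
- by move=> x; rewrite le_max lexx orbT.
- by move=> x; rewrite ge_max normr_ge0 -normrN ler_norm.
Qed.

End test_function_dense.

(** * Mollification and density of test functions in H^1 *)

Lemma is_diff_quadratic {R : realType} {V : normedModType R} (f df : V -> R) (x : V) (C : R) :
  linear df -> continuous df ->
  (forall h, `|f (x + h) - f x - df h| <= C * `|h| ^+ 2) -> is_diff x f df.
Proof.
move=> ldf cdf fC; pose lM := GRing.isLinear.Build _ _ _ _ _ ldf.
pose L : {linear V -> R} := HB.pack df lM.
have exp : f \o shift x = cst (f x) + (L : V -> R) +o_ 0 id.
  apply: eqaddoE; apply/eqaddoP => e e0.
  have H : \forall h \near (0 : V), C * `|h| <= e.
    have [C0|C0] := leP C 0.
      by apply: nearW => h; rewrite (le_trans _ (ltW e0))// mulr_le0_ge0.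
    have eC : 0 < e / C by rewrite divr_gt0.
    have := nbhsx_ballx (0 : V) _ eC; apply: filterS => h /=.
    by rewrite -ball_normE /ball_/= sub0r normrN [C * _]mulrC -(ler_pdivlMr _ _ C0) => /ltW.
  near=> h; rewrite [X in `|X|](_ : _ = f (x + h) - f x - df h); last first.
    by rewrite /= -[LHS]/(f (h + x) - (f x + df h)) [h + x]addrC; ring.
  rewrite (le_trans (fC h))// expr2 mulrA ler_wpM2r//=.
  by near: h; exact: H.
have dE := @diff_unique _ _ _ f L x cdf exp.
by split; [apply/diff_locallyP; rewrite dE|exact: dE].
Unshelve. all: by end_near. Qed.

Section convolution.
Context {R : realType} {n : nat}.
Local Notation mu := (@lebesgue_rV R n).
Local Notation rV := 'rV[R]_n.
Implicit Types (g h rho psi : rV -> R).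

Definition conv g rho (y : rV) : R := \int[mu]_x (g x * rho (y - x)).

Lemma integrableM_bounded g h (M : R) : mu.-integrable setT (EFin \o g) ->
  measurable_fun setT h -> (forall x, `|h x| <= M) ->
  mu.-integrable setT (EFin \o (fun x => g x * h x)).
Proof.
move=> ig mh hM; have mg : measurable_fun setT g.
  by apply/measurable_EFinP; exact: measurable_int ig.
apply: (le_integrable measurableT _ _ (integrableZl measurableT M (integrable_abse ig))).
  by apply/measurable_EFinP; exact: measurable_funM.
move=> x _; rewrite /= lee_fin !normrM normr_id mulrC ler_wpM2r//.
by rewrite (le_trans (hM x)) ?ler_norm.
Qed.

Lemma test_function_reflect rho (y : rV) : test_function setT rho ->
  test_function setT (fun x => rho (y - x)).
Proof.
move=> tr; have [sr _ _] := tr; have [M M0 rM] := test_function_supp_box tr.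
apply: (@test_function_box _ _ _ (`|y| + M)).
  have -> : (fun x => rho (y - x)) = (fun x => rho (- x + y)).
    by apply/funext => x; rewrite addrC.
  apply: (@smooth_comp_affine _ _ _ (-%R : rV -> rV)) => //.
    by move=> k u v; rewrite opprD scalerN.
  exact: opp_continuous.
move=> x /rM yx i; rewrite (le_trans (rV_coord_le_norm _ _))//.
rewrite -[x](subKr y) (le_trans (ler_normB _ _))// lerD//.
Qed.

Lemma derive_reflect rho (x y v : rV) : smooth rho ->
  'D_v (fun x => rho (y - x)) x = - 'D_v rho (y - x).
Proof.
move=> sr; have -> : (fun x => rho (y - x)) = (fun x => rho (- x + y)).
  by apply/funext => z; rewrite addrC.
rewrite (@derive_comp_affine _ _ _ (-%R : rV -> rV)).
- have dr : differentiable rho (- x + y) by exact: smooth_differentiable.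
  by rewrite [LHS]deriveE// raddfN; congr (- _); rewrite [y - x]addrC deriveE.
- by move=> k u w; rewrite opprD scalerN.
- exact: opp_continuous.
- exact: smooth_differentiable.
Qed.

Lemma integrable_conv g rho y : mu.-integrable setT (EFin \o g) ->
  test_function setT rho ->
  mu.-integrable setT (EFin \o (fun x => g x * rho (y - x))).
Proof.
move=> ig tr; have [M _ rM] := test_function_bounded tr.
apply: (@integrableM_bounded _ _ M) => //.
exact: measurable_test_function (test_function_reflect y tr).
Qed.

Lemma convBl g h rho y : mu.-integrable setT (EFin \o g) ->
  mu.-integrable setT (EFin \o h) -> test_function setT rho ->
  conv (fun x => g x - h x) rho y = conv g rho y - conv h rho y.
Proof.
move=> ig ih tr; rewrite /conv -RintegralB//; try exact: integrable_conv.
by apply: eq_Rintegral => x _; rewrite mulrBl.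
Qed.

Lemma test_derive_bound rho : test_function setT rho ->
  exists2 L, 0 <= L & forall x h : rV, `|'D_h rho x| <= L * `|h|.
Proof.
move=> tf; have [sf _ _] := tf.
have /choice[M MP] : forall i : 'I_n, exists M, 0 <= M /\
    forall x, `|'D_(delta_mx ord0 i) rho x| <= M.
  move=> i; have [M M0 MP] := test_function_bounded (test_function_derive (delta_mx ord0 i) tf).
  by exists M.
exists (\sum_i M i); first by apply: sumr_ge0 => i _; have [] := MP i.
move=> x h; rewrite derive_coordE; last exact: smooth_differentiable.
rewrite mulr_suml (le_trans (ler_norm_sum _ _ _))//; apply: ler_sum => i _.
rewrite normrM mulrC ler_pM//; first by have [] := MP i.
exact: rV_coord_le_norm.
Qed.

(** The Taylor remainder of [rho] is bounded uniformly by C |h|^2. Integrated against |g| it bounds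
    the remainder of the convolution in the same way, so differentiability follows from
    [is_diff_quadratic]. *)
Lemma conv_is_diff g rho (y : rV) : mu.-integrable setT (EFin \o g) ->
  test_function setT rho ->
  is_diff y (conv g rho) (fun h : rV => conv g ('D_h rho) y).
Proof.
move=> ig tr; have [sr _ _] := tr.
have [C C0 CP] := test_function_taylor tr.
have [L L0 LP] := test_derive_bound tr.
pose I := \int[mu]_x `|g x|.
have bound q (M : R) : mu.-integrable setT (EFin \o (fun x => g x * q x)) ->
    (forall x, `|q x| <= M) -> `|\int[mu]_x (g x * q x)| <= M * I.
  move=> igq qM; rewrite (le_trans (le_normr_Rintegral _ igq))//.
  rewrite -RintegralZl//; last exact: integrable_norm ig.
  apply: le_Rintegral => //.
  - exact: integrable_norm igq.
  - have := integrableZl measurableT M (integrable_norm ig).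
    by under eq_fun do rewrite -EFinM.
  - by move=> x _; rewrite normrM mulrC ler_wpM2r.
have iD (h : rV) : mu.-integrable setT (EFin \o (fun x => g x * 'D_h rho (y - x))).
  exact: integrable_conv ig (test_function_derive _ tr).
have lin : linear (fun h : rV => conv g ('D_h rho) y).
  move=> a h k; rewrite /conv /GRing.scale/= -RintegralZl// -RintegralD//.
    apply: eq_Rintegral => x _; rewrite !deriveE; try exact: smooth_differentiable.
    by rewrite linearP/= /GRing.scale/=; ring.
  have := integrableZl measurableT a (iD h).
  by under eq_fun do rewrite -EFinM.
apply: (@is_diff_quadratic _ _ _ _ _ (C * I)) => //.
  pose lM := GRing.isLinear.Build _ _ _ _ _ lin.
  pose Lin : {linear rV -> R} := HB.pack (fun h : rV => conv g ('D_h rho) y) lM.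
  have : continuous (Lin : rV -> R); last by [].
  apply/linear_bounded_continuous; apply/linear_boundedP.
  near=> r => h; rewrite (le_trans (bound _ (L * `|h|) (iD h) (fun x => LP _ _)))//.
  by rewrite mulrAC ler_wpM2r//; near: r; exact: nbhs_pinfty_ge.
move=> h; rewrite /conv -RintegralB//; try exact: integrable_conv.
rewrite -RintegralB//; last first.
  have := integrableB measurableT (integrable_conv (y + h) ig tr) (integrable_conv y ig tr).
  by under eq_fun do rewrite -EFinB.
have E x : g x * rho (y + h - x) - g x * rho (y - x) - g x * 'D_h rho (y - x) =
   g x * (rho (y - x + h) - rho (y - x) - 'D_h rho (y - x)).
  by rewrite [y + h - x]addrAC; ring.
under eq_Rintegral do rewrite E.
rewrite mulrAC; apply: bound; last by move=> x; exact: CP.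
under eq_fun do rewrite -E.
have := integrableB measurableT (integrableB measurableT (integrable_conv (y + h) ig tr)
  (integrable_conv y ig tr)) (iD h).
by under eq_fun do rewrite -!EFinB.
Unshelve. all: by end_near. Qed.

Lemma derive_conv g rho (h : rV) : mu.-integrable setT (EFin \o g) ->
  test_function setT rho -> 'D_h (conv g rho) = conv g ('D_h rho).
Proof.
move=> ig tr; apply/funext => y; have [dc dE] := conv_is_diff y ig tr.
by rewrite deriveE// dE.
Qed.

Lemma smooth_conv g rho : mu.-integrable setT (EFin \o g) ->
  test_function setT rho -> smooth (conv g rho).
Proof.
move=> ig tr; apply: (@smooth_coind _ _ (fun f => exists2 rho, test_function setT rho & f =
  conv g rho)).
- by move=> _ [r tr' ->] x; have [] := conv_is_diff x ig tr'.
- by move=> _ v [r tr' ->]; exists ('D_v r); [exact: test_function_derive|exact: derive_conv].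
- by exists rho.
Qed.

Lemma test_function_conv g rho (M : R) : mu.-integrable setT (EFin \o g) ->
  (forall x, g x != 0 -> `|x| <= M) -> test_function setT rho ->
  test_function setT (conv g rho).
Proof.
move=> ig gM tr; have [N N0 rN] := test_function_supp_box tr.
apply: (@test_function_box _ _ _ (M + N)); first exact: smooth_conv.
move=> y cy i; rewrite (le_trans (rV_coord_le_norm _ _))// leNgt; apply/negP => My.
move/eqP : cy; apply; rewrite /conv; under eq_Rintegral => x _.
  rewrite (_ : g x * rho (y - x) = 0); first over.
  have [->|/gM xM] := eqVneq (g x) 0; first by rewrite mul0r.
  have [->|/rN yxN] := eqVneq (rho (y - x)) 0; first by rewrite mulr0.
  move: My; rewrite ltNge -[y in `|y|](subrK x) (le_trans (ler_normD _ _))//.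
  by rewrite addrC lerD.
by rewrite Rintegral_cst// mul0r.
Qed.

End convolution.

(** * One-dimensional mollifiers *)

Section mollifier.
Context {R : realType}.
Implicit Types eps s y : R.

(** The mass is taken at each scale rather than rescaled from eps = 1; the normalisation then rests
    only on its being positive and finite, without a dilation of the variable. *)
Definition bump_mass eps : R := \int[lebesgue_measure]_s bump (s / eps).

Lemma bump_le1 s : bump s <= 1.
Proof.
have f1 (r : R) : flat 1 r <= 1.
  rewrite /flat; case: ifPn => // r0; rewrite hornerE mul1r expRN invf_le1 ?expR_gt0//.
  by rewrite (le_trans _ (expR_ge1Dx _))// lerDl invr_ge0 ltW.
by rewrite mulr_ile1// flat1_ge0.
Qed.

(** Both 1 - s and 1 + s are at least 1/2, and e^{-1/r} >= e^{-2} for r >= 1/2. *)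
Lemma bump_half s : `|s| <= 2^-1 -> expR (- 4) <= bump s.
Proof.
rewrite ler_norml => /andP[s1 s2].
have f1 (r : R) : 2^-1 <= r -> expR (- 2) <= flat 1 r.
  move=> r2; have r0 : 0 < r by rewrite (lt_le_trans _ r2).
  rewrite /flat r0 hornerE mul1r ler_expR lerN2 -[leRHS]invrK lef_pV2 ?posrE//.
rewrite (_ : - 4 = - 2 + - 2 :> R); last by ring.
by rewrite expRD ler_pM ?expR_ge0// f1//; lra.
Qed.

Lemma continuous_bump_scale eps : continuous (fun s => bump (s / eps)).
Proof.
have -> : (fun s : R => bump (s / eps)) = (fun s => bump (eps^-1 * s + 0)).
  by apply/funext => s; rewrite addr0 mulrC.
exact/smooth_continuous/smooth_reparam/smooth_bump.
Qed.

Lemma measurable_bump_scale eps : measurable_fun setT (fun s => bump (s / eps)).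
Proof. by apply: continuous_measurable_fun; exact: continuous_bump_scale. Qed.

Lemma integral_bump_fin eps : 0 < eps ->
  ((expR (- 4) * eps)%:E <= \int[lebesgue_measure]_s (bump (s / eps))%:E < +oo)%E.
Proof.
move=> e0; have mb := measurable_bump_scale eps.
have e2 : 0 < eps / 2 by rewrite divr_gt0.
have itv (r : R) : 0 < r -> lebesgue_measure (`[- r, r]%classic : set R) = (2 * r)%:E.
  move=> r0; rewrite lebesgue_measure_itv/= lte_fin ifT; last by rewrite gtrN.
  by rewrite -EFinB; congr EFin; ring.
apply/andP; split.
  apply: (@le_trans _ _ (\int[lebesgue_measure]_s ((expR (- 4))%:E * (\1_(`[- (eps / 2),
    eps / 2]%classic) s)%:E))%E).
    rewrite integral_indicZ ?expR_ge0//.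
    rewrite [X in (_ * X)%E](_ : _ = (2 * (eps / 2))%:E); last exact: itv.
    rewrite -EFinM lee_fin.
    by rewrite (_ : 2 * (eps / 2) = eps)//; field.
  apply: ge0_le_integral => //.
  - by apply: measurable_funeM; apply/measurable_EFinP; exact: measurable_indic.
  - exact/measurable_EFinP.
  - move=> s _; rewrite -EFinM lee_fin indicE; have [|_] := boolP (_ \in _);
    last by rewrite mulr0 bump_ge0.
    rewrite inE/= in_itv/= mulr1 -ler_norml => sr; apply: bump_half.
    by rewrite normrM normfV (gtr0_norm e0) ler_pdivrMr// mulrC.
apply: (@le_lt_trans _ _ (\int[lebesgue_measure]_s (\1_(`[- eps, eps]%classic) s)%:E)%E).
  apply: ge0_le_integral => //.
  - by move=> s _; rewrite lee_fin bump_ge0.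
  - exact/measurable_EFinP.
  - by apply/measurable_EFinP; exact: measurable_indic.
  - move=> s _; rewrite lee_fin indicE; have [|sn] := boolP (_ \in _); first by rewrite bump_le1.
    rewrite bump_eq0// normrM normfV (gtr0_norm e0) ler_pdivlMr// mul1r leNgt.
    apply/negP => se; move/negP : sn; apply; rewrite inE/= in_itv/= -ler_norml; exact: ltW.
rewrite integral_indic// setIT.
by rewrite [X in (X < _)%E](_ : _ = (2 * eps)%:E) ?ltry//; exact: itv.
Qed.

Lemma bump_mass_gt0 eps : 0 < eps -> 0 < bump_mass eps.
Proof.
move=> e0; have /andP[l u] := integral_bump_fin e0.
rewrite /bump_mass /Rintegral fine_gt0// u andbT (lt_le_trans _ l)//.
by rewrite lte_fin mulr_gt0 ?expR_gt0.
Qed.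

Definition moll1 eps s := bump (s / eps) / bump_mass eps.

Lemma moll1_ge0 eps s : 0 < eps -> 0 <= moll1 eps s.
Proof. by move=> e0; rewrite divr_ge0 ?bump_ge0// ltW ?bump_mass_gt0. Qed.

Lemma moll1_eq0 eps s : 0 < eps -> eps <= `|s| -> moll1 eps s = 0.
Proof.
move=> e0 es; rewrite /moll1 bump_eq0 ?mul0r//.
by rewrite normrM normfV (gtr0_norm e0) ler_pdivlMr// mul1r.
Qed.

Lemma moll1N eps s : moll1 eps (- s) = moll1 eps s.
Proof. by rewrite /moll1 mulNr bumpN. Qed.

Lemma smooth_moll1 eps : smooth (moll1 eps).
Proof.
have -> : moll1 eps = (fun s => (bump_mass eps)^-1 * bump (eps^-1 * s + 0)).
  by apply/funext => s; rewrite addr0 mulrC /moll1 [s / eps]mulrC.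
exact/smoothZ/smooth_reparam/smooth_bump.
Qed.

Lemma integral_moll1 eps y : 0 < eps ->
  (\int[lebesgue_measure]_s (moll1 eps (s - y))%:E = 1)%E.
Proof.
move=> e0; rewrite integral_shift_continuous; last 2 first.
- exact/smooth_continuous/smooth_moll1.
- by move=> s; exact: moll1_ge0.
rewrite /moll1; under eq_integral do rewrite EFinM.
have /andP[l u] := integral_bump_fin e0.
rewrite ge0_integralZr//.
- rewrite -(@fineK _ (\int[_]_s _)%E); last by rewrite ge0_fin_numE// integral_ge0// => s _;
  rewrite lee_fin bump_ge0.
  by rewrite -EFinM divff// gt_eqF// bump_mass_gt0.
- by apply/measurable_EFinP; exact: measurable_bump_scale.
- by move=> s _; rewrite lee_fin bump_ge0.
- by rewrite lee_fin invr_ge0 ltW// bump_mass_gt0.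
Qed.

End mollifier.

(** * Convergence of mollified functions in L^2 *)

Section mollification.
Context {R : realType} {n : nat}.
Local Notation mu := (@lebesgue_rV R n).
Local Notation rV := 'rV[R]_n.
Implicit Types (g psi : rV -> R) (x y : rV) (eps : R).

Lemma bounded_supp_L2 g (B M : R) : measurable_fun setT g -> (forall x, `|g x| <= B) ->
  (forall x, g x != 0 -> `|x| <= M) -> L2 g /\ mu.-integrable setT (EFin \o g).
Proof.
move=> mg gB gM.
have B0 : 0 <= B by rewrite (le_trans _ (gB 0)).
have gle x : `|g x| <= B * \1_(cube (M + 1)) x.
  rewrite indicE; have [->|/gM xM] := eqVneq (g x) 0; first by rewrite normr0 mulr_ge0.
  rewrite mem_set ?mulr1// => i /=.
  by rewrite in_itv/= -ltr_norml (le_lt_trans (rV_coord_le_norm _ _))// (le_lt_trans xM)// ltrDl.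
have mQ := @measurable_cube R n (M + 1); have Qfin := @cube_fin R n (M + 1).
split; last first.
  apply/integrableP; split; first exact/measurable_EFinP.
  apply: (@le_lt_trans _ _ (\int[mu]_x (B%:E * (\1_(cube (M + 1)) x)%:E))%E).
    apply: ge0_le_integral => //.
    - by apply: measurableT_comp => //; exact/measurable_EFinP.
    - by apply: measurable_funeM; apply/measurable_EFinP; exact: measurable_indic.
    - by move=> x _; rewrite /= -EFinM lee_fin.
  by rewrite integral_indicZ// lte_mul_pinfty.
apply: L2_of_sqr => //.
apply: (@le_lt_trans _ _ (\int[mu]_x ((B ^+ 2)%:E * (\1_(cube (M + 1)) x)%:E))%E).
  apply: ge0_le_integral => //.
  - by move=> x _; rewrite lee_fin sqr_ge0.
  - by apply/measurable_EFinP; exact: measurable_funX.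
  - by apply: measurable_funeM; apply/measurable_EFinP; exact: measurable_indic.
  - move=> x _; rewrite -EFinM lee_fin -(real_normK (num_real _)).
    rewrite (le_trans (lerXn2r 2 _ _ (gle x))) ?nnegrE ?mulr_ge0 ?indicE//.
    by rewrite exprMn; case: (_ \in _); rewrite ?expr1n ?expr0n.
by rewrite integral_indicZ ?sqr_ge0// lte_mul_pinfty// lee_fin sqr_ge0.
Qed.

Lemma test_function_L2 psi : test_function setT psi ->
  L2 psi /\ mu.-integrable setT (EFin \o psi).
Proof.
move=> tp; have [B _ BP] := test_function_bounded tp.
have [M _ MP] := test_function_supp_box tp.
by apply: (@bounded_supp_L2 _ B M) => //; exact: measurable_test_function tp.
Qed.

Definition moll eps x := \prod_(i < n) moll1 eps (x ord0 i).

Lemma moll_ge0 eps x : 0 < eps -> 0 <= moll eps x.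
Proof. by move=> e0; apply: prodr_ge0 => i _; exact: moll1_ge0. Qed.

Lemma moll_neq0 eps x : 0 < eps -> moll eps x != 0 -> `|x| <= eps.
Proof.
move=> e0 mx; apply: rV_norm_le; first exact: ltW.
move=> i; rewrite leNgt; apply/negP => ex; move/eqP : mx; apply.
by rewrite /moll (bigD1 i)//= moll1_eq0 ?mul0r// ltW.
Qed.

Lemma test_function_moll eps : 0 < eps -> test_function setT (moll eps).
Proof.
move=> e0; apply: (@test_function_box _ _ _ eps).
  by apply: (@smooth_coord_prod _ _ (fun=> moll1 eps)) => i; exact: smooth_moll1.
by move=> x /(moll_neq0 e0) xe i; rewrite (le_trans (rV_coord_le_norm _ _)).
Qed.

Lemma integral_moll eps y : 0 < eps -> (\int[mu]_x (moll eps (x - y))%:E = 1)%E.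
Proof.
move=> e0; rewrite /moll.
under eq_integral => x _ do under eq_bigr => i _ do rewrite mxE mxE.
rewrite (@integral_rV_prod _ _ (fun i s => moll1 eps (s - y ord0 i))).
- by rewrite big1// => i _; exact: integral_moll1.
- move=> i; apply: continuous_measurable_fun => s.
  apply: (@continuous_comp _ _ _ (fun s => s - y ord0 i) (moll1 eps)).
    by apply: cvgB; [exact: cvg_id|exact: cvg_cst].
  exact/smooth_continuous/smooth_moll1.
- by move=> i s; exact: moll1_ge0.
Qed.

Lemma mollC eps x y : moll eps (x - y) = moll eps (y - x).
Proof. by apply: eq_bigr => i _; rewrite !mxE -moll1N opprB. Qed.

Let mollM eps y : 0 < eps -> measurable_fun setT (fun x => moll eps (y - x)).
Proof. by move=> e0; exact: measurable_test_function (test_function_reflect y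
  (test_function_moll e0)). Qed.

Lemma integrable_moll eps y : 0 < eps ->
  mu.-integrable setT (EFin \o (fun x => moll eps (y - x))).
Proof.
move=> e0; apply/integrableP; split; first by apply/measurable_EFinP; exact: mollM.
under eq_integral => x _ do rewrite /= ger0_norm ?moll_ge0// mollC.
by rewrite integral_moll// ltry.
Qed.

Lemma Rintegral_moll eps y : 0 < eps -> \int[mu]_x moll eps (y - x) = 1.
Proof.
move=> e0; rewrite /Rintegral; under eq_integral do rewrite mollC.
by rewrite integral_moll.
Qed.

(** Jensen's inequality for the probability density x |-> moll eps (y - x): with c the mean of g,
    expand the nonnegative integral of (g - c)^2 against this density. *)
Lemma conv_moll_sqr_le eps g y : 0 < eps -> L2 g -> mu.-integrable setT (EFin \o g) ->
  conv g (moll eps) y ^+ 2 <= \int[mu]_x (g x ^+ 2 * moll eps (y - x)).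
Proof.
move=> e0 g2 ig; have tm := test_function_moll e0.
have i2 := integrable_conv y (Lfun2_integrable_sqr g2) tm.
have i1 := integrable_conv y ig tm.
have i0 := integrable_moll y e0.
set c := conv g _ y.
have i1' : mu.-integrable setT (EFin \o (fun x => (2 * c) * (g x * moll eps (y - x)))).
  by have := integrableZl measurableT (2 * c) i1; under eq_fun do rewrite -EFinM.
have i0' : mu.-integrable setT (EFin \o (fun x => c ^+ 2 * moll eps (y - x))).
  by have := integrableZl measurableT (c ^+ 2) i0; under eq_fun do rewrite -EFinM.
have i21 : mu.-integrable setT (EFin \o (fun x => g x ^+ 2 * moll eps (y - x) - (2 * c) * (g
  x * moll eps (y - x)))).
  by have := integrableB measurableT i2 i1'; under eq_fun do rewrite -EFinB.
have : 0 <= \int[mu]_x ((g x - c) ^+ 2 * moll eps (y - x)).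
  by apply: Rintegral_ge0 => x _; rewrite mulr_ge0 ?sqr_ge0// moll_ge0.
have E x : (g x - c) ^+ 2 * moll eps (y - x) =
    (g x ^+ 2 * moll eps (y - x) - (2 * c) * (g x * moll eps (y - x))) + c ^+ 2 * moll eps (y
      - x).
  ring.
under eq_Rintegral do rewrite E.
rewrite RintegralD// RintegralB// !RintegralZl// Rintegral_moll//.
rewrite -/(conv g (moll eps) y) -/c mulr1; lra.
Qed.

(** Integrate the pointwise Jensen bound over y and exchange the integrals; the kernel has total
    mass 1 in y as well. This contraction property lets an L^2 function be replaced by a test
    function before mollifying. *)
Lemma conv_moll_L2_le eps g : 0 < eps -> L2 g -> mu.-integrable setT (EFin \o g) ->
  (\int[mu]_y (conv g (moll eps) y ^+ 2)%:E <= \int[mu]_x (g x ^+ 2)%:E)%E.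
Proof.
move=> e0 g2 ig; have tm := test_function_moll e0; have mg := Lfun2_measurable g2.
pose f (p : rV * rV) := (g p.2 ^+ 2 * moll eps (p.1 - p.2))%:E.
have mf : measurable_fun setT f.
  apply/measurable_EFinP; apply: measurable_funM.
    by apply: measurable_funX; apply: measurableT_comp => //; exact: measurable_snd.
  by apply: (measurableT_comp (measurable_test_function tm)); exact: measurable_sub_rV.
have f0 p : (0 <= f p)%E by rewrite lee_fin mulr_ge0 ?sqr_ge0 ?moll_ge0.
apply: (@le_trans _ _ (\int[mu]_y \int[mu]_x f (y, x))%E).
  apply: ge0_le_integral => //.
  - by move=> y _; rewrite lee_fin sqr_ge0.
  - apply/measurable_EFinP; apply: measurable_funX; apply: continuous_measurable_rV.
    exact/smooth_continuous/smooth_conv.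
  - exact: (@measurable_fun_fubini_tonelli_F _ _ _ _ _ mu f mf f0).
  - move=> y _; apply: (@le_trans _ _ (\int[mu]_x (g x ^+ 2 * moll eps (y - x)))%:E).
      by rewrite lee_fin conv_moll_sqr_le.
    rewrite /Rintegral fineK//; apply: integrable_fin_num => //.
    exact: integrable_conv (Lfun2_integrable_sqr g2) tm.
rewrite (@fubini_tonelli _ _ _ _ _ mu mu f mf f0).
apply: ge0_le_integral => //.
- by move=> x _; exact: integral_ge0.
- exact: (@measurable_fun_fubini_tonelli_G _ _ _ _ _ mu f mf f0).
- by apply/measurable_EFinP; exact: measurable_funX.
- move=> x _; rewrite /f/=; under eq_integral do rewrite EFinM.
  rewrite ge0_integralZl//.
  + by rewrite integral_moll// mule1.
  + apply/measurable_EFinP; under eq_fun do rewrite mollC; exact: mollM.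
  + by move=> y _; rewrite lee_fin moll_ge0.
  + by rewrite lee_fin sqr_ge0.
Qed.

Lemma dist2_conv_moll eps g h : 0 < eps -> L2 g -> mu.-integrable setT (EFin \o g) ->
  L2 h -> mu.-integrable setT (EFin \o h) ->
  (dist2 (conv g (moll eps)) (conv h (moll eps)) <= dist2 g h)%E.
Proof.
move=> e0 g2 ig h2 ih; have tm := test_function_moll e0.
rewrite /dist2; under eq_integral do rewrite -convBl//.
apply: conv_moll_L2_le => //.
  exact: Lfun2B.
by have := integrableB measurableT ig ih; under eq_fun do rewrite -EFinB.
Qed.

(** Averaging over distance eps moves a Lipschitz function by at most L eps, and the difference is
    supported in a cube that is the same for all eps <= 1. *)
Lemma conv_moll_test psi : test_function setT psi ->
  exists2 C : R, 0 <= C & forall eps, 0 < eps <= 1 ->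
    (dist2 (conv psi (moll eps)) psi <= (C * eps ^+ 2)%:E)%E.
Proof.
move=> tp; have [L L0 LP] := test_function_lipschitz tp.
have [M M0 MP] := test_function_supp_box tp.
have mp := measurable_test_function tp.
(* For eps <= 1 the function and its mollification vanish beyond M + 1; the cube is open, hence the
   larger half-side. *)
pose Q := cube (M + 2) : set rV.
have mQ : measurable Q by exact: measurable_cube.
have Qfin : mu Q \is a fin_num by rewrite ge0_fin_numE// cube_fin.
have [_ ip] := test_function_L2 tp.
exists (L ^+ 2 * fine (mu Q)); first by rewrite mulr_ge0 ?sqr_ge0// fine_ge0.
move=> eps /andP[e0 e1]; have tm := test_function_moll e0.
have cE y : conv psi (moll eps) y - psi y = \int[mu]_x ((psi x - psi y) * moll eps (y - x)).
  under [RHS]eq_Rintegral do rewrite mulrBl.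
  rewrite RintegralB//; last 2 first.
  - exact: integrable_conv.
  - have := integrableZl measurableT (psi y) (integrable_moll y e0).
    by under eq_fun do rewrite -EFinM.
  by rewrite RintegralZl ?Rintegral_moll ?mulr1//; exact: integrable_moll.
have bnd y : `|conv psi (moll eps) y - psi y| <= L * eps * \1_Q y.
  have mm : measurable_fun setT (fun x => (psi x - psi y) * moll eps (y - x)).
    apply: measurable_funM; first by apply: measurable_funB => //; exact: measurable_cst.
    exact: measurable_test_function (test_function_reflect y tm).
  have key x : `|(psi x - psi y) * moll eps (y - x)| <= L * eps * \1_Q y * moll eps (y - x).
    rewrite normrM (ger0_norm (moll_ge0 _ e0)).
    have [->|/(moll_neq0 e0) yx] := eqVneq (moll eps (y - x)) 0; first by rewrite !mulr0.
    rewrite ler_wpM2r ?moll_ge0// indicE.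
    have [yQ|yQ] := boolP (y \in Q).
      by rewrite mulr1 (le_trans (LP _ _))// ler_wpM2l// distrC.
    have {}yQ : M + 1 < `|y|.
      rewrite ltNge; apply/negP => yM; move/negP : yQ; apply; apply: mem_set => i /=.
      rewrite in_itv/= -ltr_norml (le_lt_trans (rV_coord_le_norm _ _))// (le_lt_trans yM)//.
      by rewrite ltrD2l ltr1n.
    rewrite mulr0; have [->|/MP yM] := eqVneq (psi y) 0; last first.
      by move: (lt_le_trans yQ yM); rewrite gtrDl ltr10.
    have [->|/MP xM] := eqVneq (psi x) 0; first by rewrite subrr normr0.
    move: yQ; rewrite ltNge -[y](subrK x) (le_trans (ler_normD _ _))// addrC lerD//.
    exact: le_trans yx e1.
  have imm : mu.-integrable setT (EFin \o (fun x => L * eps * \1_Q y * moll eps (y - x))).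
    have := integrableZl measurableT (L * eps * \1_Q y) (integrable_moll y e0).
    by under eq_fun do rewrite -EFinM.
  have im : mu.-integrable setT (EFin \o (fun x => (psi x - psi y) * moll eps (y - x))).
    apply: (le_integrable measurableT _ _ imm); first exact/measurable_EFinP.
    by move=> x _; rewrite /= lee_fin (le_trans (key x))// ler_norm.
  rewrite cE (le_trans (le_normr_Rintegral _ im))//.
  apply: (@le_trans _ _ (\int[mu]_x (L * eps * \1_Q y * moll eps (y - x)))).
    by apply: le_Rintegral => //; exact: integrable_norm im.
  by rewrite RintegralZl ?Rintegral_moll ?mulr1//; exact: integrable_moll.
apply: (@le_trans _ _ (\int[mu]_y (((L * eps) ^+ 2)%:E * (\1_Q y)%:E))%E).
  apply: ge0_le_integral => //.
  - by move=> y _; rewrite lee_fin sqr_ge0.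
  - apply: measurable_dist2 => //; apply: continuous_measurable_rV.
    exact/smooth_continuous/smooth_conv.
  - by apply: measurable_funeM; apply/measurable_EFinP; exact: measurable_indic.
  - move=> y _; rewrite -EFinM lee_fin -(real_normK (num_real _)).
    rewrite (le_trans (lerXn2r 2 _ _ (bnd y))) ?nnegrE ?mulr_ge0 ?indicE ?(ltW e0)//.
    by rewrite exprMn; case: (_ \in _); rewrite ?expr1n ?expr0n.
rewrite integral_indicZ ?sqr_ge0// -[X in (_ * X)%E](fineK Qfin) -EFinM lee_fin exprMn mulrAC//.
Qed.

Lemma conv_moll_cvg g (e : R) : L2 g -> mu.-integrable setT (EFin \o g) -> 0 < e ->
  exists2 d, 0 < d & forall eps, 0 < eps <= d ->
    (dist2 (conv g (moll eps)) g <= e%:E)%E.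
Proof.
move=> g2 ig e0; have mg := Lfun2_measurable g2.
(* Two triangle inequalities for squared distances give 2 (e/12 + 2 (e/8 + e/12)) = e, where e/8 is
   the share of the mollified test function. *)
have d0 : 0 < e / 12 by rewrite divr_gt0.
have [psi tp gp] := test_function_dense_L2 g2 d0.
have [C C0 CP] := conv_moll_test tp.
have mp := measurable_test_function tp.
have c0 : 0 < e / (8 * (C + 1)) by rewrite divr_gt0// mulr_gt0// ltr_wpDl.
exists (Num.min 1 (e / (8 * (C + 1)))); first by rewrite lt_min ltr01.
move=> eps /andP[eps0]; rewrite le_min => /andP[eps1 epsC].
have tm := test_function_moll eps0.
have [p2 ip] := test_function_L2 tp.
have mc h : mu.-integrable setT (EFin \o h) -> measurable_fun setT (conv h (moll eps)).
  by move=> ih; apply: continuous_measurable_rV; exact/smooth_continuous/smooth_conv.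
apply: (le_trans (dist2_triangle (mc _ ig) (mc _ ip) mg)).
apply: (@le_trans _ _ (2%:E * ((e / 12)%:E + 2%:E * ((C * eps ^+ 2)%:E + (e / 12)%:E)))%E).
  rewrite lee_pmul2l//=; apply: leeD.
    exact: le_trans (dist2_conv_moll eps0 g2 ig p2 ip) gp.
  apply: (le_trans (dist2_triangle (mc _ ip) mp mg)).
  rewrite lee_pmul2l//=; apply: leeD; first by apply: CP; rewrite eps0.
  by rewrite dist2C.
rewrite -!EFinD -!EFinM lee_fin.
have : C * eps ^+ 2 <= e / 8.
  apply: (@le_trans _ _ ((C + 1) * eps)).
    by rewrite expr2 mulrA ler_wpM2r ?(ltW eps0)// (le_trans (ler_wpM2l C0 eps1))// mulr1 lerDl.
  have C1 : 0 < C + 1 by rewrite ltr_wpDl.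
  rewrite mulrC -ler_pdivlMr// (le_trans epsC)// invfM mulrA lexx//.
lra.
Qed.

End mollification.

(** * Density of test functions in H^1 *)

Section H1_density.
Context {R : realType} {n : nat}.
Local Notation mu := (@lebesgue_rV R n).
Local Notation rV := 'rV[R]_n.

Definition cutoff (k : nat) (x : rV) : R := \prod_(i < n)
  (step (k.+1%:R^-1 * x ord0 i + 2) * step (- k.+1%:R^-1 * x ord0 i + 2)).

Lemma cutoff01 k x : 0 <= cutoff k x <= 1.
Proof.
rewrite /cutoff; elim/big_ind : _ => [|p q /andP[p0 p1] /andP[q0 q1]|i _];
  first by rewrite ler01 lexx.
  by rewrite mulr_ge0// mulr_ile1.
by rewrite mulr_ge0 ?step_ge0// mulr_ile1// ?step_ge0// step_le1.
Qed.

Lemma cutoff_eq1 k x : `|x| <= k.+1%:R -> cutoff k x = 1.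
Proof.
move=> xk; rewrite /cutoff big1// => i _.
have : `|k.+1%:R^-1 * x ord0 i| <= 1.
  rewrite normrM ger0_norm// mulrC ler_pdivrMr// mul1r.
  exact: le_trans (rV_coord_le_norm _ _) xk.
rewrite mulNr; move: (k.+1%:R^-1 * _) => a; rewrite ler_norml => /andP[a1 a2].
by rewrite !step_eq1 ?mulr1//; lra.
Qed.

Lemma cutoff_neq0 k x : cutoff k x != 0 -> forall i, `|x ord0 i| <= 2 * k.+1%:R.
Proof.
move=> cx i; have : 0 < k.+1%:R :> R by []. set K := k.+1%:R => K0.
have : `|K^-1 * x ord0 i| <= 2.
  rewrite leNgt; apply/negP; rewrite lter_normr => H; move/eqP : cx; apply.
  rewrite /cutoff (bigD1 i)//= -/K mulNr; move: (K^-1 * x ord0 i) H => a H.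
  by case/orP : H => H; [rewrite (@step_eq0 _ (- a + 2)) ?mulr0 ?mul0r//; lra|
    rewrite (@step_eq0 _ (a + 2)) ?mul0r//; lra].
by rewrite normrM (@ger0_norm _ K^-1) ?invr_ge0 ?(ltW K0)// mulrC ler_pdivrMr.
Qed.

Lemma test_function_cutoff k : test_function setT (cutoff k).
Proof.
apply: (@test_function_box _ _ _ (2 * k.+1%:R)); last by move=> x; exact: cutoff_neq0.
pose g (s : R) := step (k.+1%:R^-1 * s + 2) * step (- k.+1%:R^-1 * s + 2).
apply: (@smooth_coord_prod _ _ (fun=> g)) => i; rewrite /g.
by apply: (@smoothM _ _ (fun s : R => step (k.+1%:R^-1 * s + 2)) (fun s : R =>
  step (- k.+1%:R^-1 * s + 2)));
  apply: smooth_reparam; exact: smooth_step.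
Qed.

(** All cut-offs are dilations of [cutoff 0], so their derivatives are O(1/k) uniformly in x. *)
Lemma derive_cutoff k x v : 'D_v (cutoff k) x = k.+1%:R^-1 * 'D_v (cutoff 0) (k.+1%:R^-1 *: x).
Proof.
have [s0 _ _] := test_function_cutoff 0.
have -> : cutoff k = (fun x => cutoff 0 (k.+1%:R^-1 *: x + 0)).
  by apply/funext => y; apply: eq_bigr => i _; rewrite addr0 !mxE invr1 !mul1r mulN1r mulNr.
rewrite (@derive_comp_affine _ _ _ ( *:%R k.+1%:R^-1)).
- rewrite addr0; have d0 : differentiable (cutoff 0) (k.+1%:R^-1 *: x)
  by exact: smooth_differentiable.
  by rewrite [LHS]deriveE// linearZ/= deriveE.
- by move=> a u w; exact: linearP.
- exact: scaler_continuous.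
- exact: smooth_differentiable.
Qed.

Lemma cutoff_derive_bound (v : rV) : exists2 C : R, 0 <= C &
  forall k x, `|'D_v (cutoff k) x| <= C / k.+1%:R.
Proof.
have [C C0 CP] := test_function_bounded (test_function_derive v (test_function_cutoff 0)).
exists C => // k x; rewrite derive_cutoff normrM ger0_norm// mulrC.
by rewrite ler_wpM2r.
Qed.

Lemma cutoff_cvg (f : rV -> R) x : cutoff k x * f x @[k --> \oo] --> f x.
Proof.
apply: cvg_near_cst; near=> k; rewrite cutoff_eq1 ?mul1r//.
rewrite ltW// (@lt_trans _ _ k%:R) ?ltr_nat//.
by near: k; exact: nbhs_infty_gtr.
Unshelve. all: by end_near. Qed.

Lemma invr_nat_cvg0 (C : R) : C / k.+1%:R @[k --> \oo] --> 0.
Proof.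
rewrite -[X in _ --> X](mulr0 C); apply: cvgM; first exact: cvg_cst.
exact: cvg_harmonic.
Qed.

(** The weak gradient is tested with x |-> cutoff k x * rho (y - x). The sign from reflecting [rho]
    cancels the sign of the integration by parts, and the derivative falling on the cut-off gives
    the extra term. *)
Lemma derive_cutoff_conv k (f : rV -> R) (Df : rV -> rV) (rho : rV -> R) (i : 'I_n) :
  H1 f Df -> test_function setT rho ->
  'D_(delta_mx ord0 i) (conv (fun x => cutoff k x * f x) rho) =
  conv (fun x => cutoff k x * Df x ord0 i + f x * 'D_(delta_mx ord0 i) (cutoff k) x) rho.
Proof.
move=> [f2 Df2 wf] tr; set v := delta_mx ord0 i.
have [sr _ _] := tr; have tc := test_function_cutoff k; have [sc _ _] := tc.
have cL2 (q h : rV -> R) : L2 q -> test_function setT h ->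
  mu.-integrable setT (EFin \o (fun x => q x * h x)).
  by move=> q2 th; apply: Lfun2_integrableM => //; have [] := test_function_L2 th.
have icf : mu.-integrable setT (EFin \o (fun x => cutoff k x * f x)).
  by under eq_fun do rewrite mulrC; exact: cL2.
rewrite derive_conv//; apply/funext => y; rewrite /conv.
have try' := test_function_reflect y tr.
pose psi := cutoff k * (fun x => rho (y - x)).
have tpsi : test_function setT psi by exact: test_functionM.
have Dpsi x : 'D_v psi x = cutoff k x * (- 'D_v rho (y - x)) + rho (y - x) * 'D_v (cutoff k) x.
  have [sry _ _] := try'.
  rewrite deriveM; last 2 first.
  - exact/diff_derivable/smooth_differentiable.
  - exact/diff_derivable/smooth_differentiable.
  by rewrite derive_reflect.
have := wf i psi tpsi; rewrite -/v.
under eq_Rintegral => x _.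
  rewrite Dpsi (_ : f x * _ = f x * (rho (y - x) * 'D_v (cutoff k) x) - cutoff k x * f x *
    'D_v rho (y - x)); last by ring.
  over.
have i1 : mu.-integrable setT (EFin \o (fun x => f x * (rho (y - x) * 'D_v (cutoff k) x))).
  apply: (cL2 f ((fun x => rho (y - x)) * 'D_v (cutoff k))) => //.
  by apply: test_functionM; [have [] := try'|exact: test_function_derive].
have i2 := integrable_conv y icf (test_function_derive v tr).
have i3 : mu.-integrable setT (EFin \o (fun x => Df x ord0 i * psi x)).
  exact: (cL2 (fun x => Df x ord0 i)).
rewrite RintegralB// => H.
have -> : \int[mu]_x (cutoff k x * f x * 'D_v rho (y - x)) =
    \int[mu]_x (f x * (rho (y - x) * 'D_v (cutoff k) x)) + \int[mu]_x (Df x ord0 i * psi x).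
  by move: H; set p1 := Rintegral _ _ _; set p2 := Rintegral _ _ _;
    set p3 := Rintegral _ _ _; lra.
rewrite -RintegralD//; apply: eq_Rintegral => x _.
by rewrite -[psi x]/(cutoff k x * rho (y - x)); ring.
Qed.

(** Cut off, then mollify. By [derive_cutoff_conv] the derivatives of the approximant are themselves
    mollifications, so the L^2 result applies to f and its n derivatives; being finitely many, they
    share one cut-off and one scale. *)
Lemma test_function_dense_H1 (f : rV -> R) (Df : rV -> rV) (e : R) : H1 f Df -> 0 < e ->
  exists phi, [/\ test_function setT phi, (dist2 f phi <= e%:E)%E &
    forall i, (dist2 (fun x => Df x ord0 i) ('D_(delta_mx ord0 i) phi) <= e%:E)%E].
Proof.
move=> Hf e0; have [f2 Df2 wf] := Hf.
have mf := Lfun2_measurable f2.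
have mDf i := Lfun2_measurable (Df2 i).
pose c (k : nat) : rV -> R := cutoff k.
have tc k : test_function setT (c k) := test_function_cutoff k.
have mc k : measurable_fun setT (c k) := measurable_test_function (tc k).
pose g0 k x := c k x * f x.
pose g i k x := c k x * Df x ord0 i + f x * 'D_(delta_mx ord0 i) (c k) x.
have mg0 k : measurable_fun setT (g0 k) by exact: measurable_funM.
have mDc i k : measurable_fun setT ('D_(delta_mx ord0 i) (c k)).
  exact: measurable_test_function (test_function_derive _ (tc k)).
have mg i k : measurable_fun setT (g i k).
  by apply: measurable_funD; exact: measurable_funM.
have e40 : 0 < e / 4 by rewrite divr_gt0.
have sqr_int q : L2 q -> mu.-integrable setT (EFin \o (fun x => q x ^+ 2))
  by exact: Lfun2_integrable_sqr.
have cle k x (a : R) : (c k x * a - a) ^+ 2 <= a ^+ 2.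
  have /andP[c0 c1] := cutoff01 k x.
  rewrite (_ : _ - _ = (c k x - 1) * a); last by ring.
  by rewrite exprMn ler_piMl ?sqr_ge0// -sqrrN opprB expr_le1// ?subr_ge0// lerBlDr lerDl.
have g0cvg : (dist2 (g0 k) f @[k --> \oo] --> 0)%E.
  apply: (@dist2_dominated _ _ _ _ (fun x => f x ^+ 2)) => //; first exact: sqr_int.
    by move=> x; exact: cutoff_cvg.
  by move=> k x; exact: cle.
have gcvg i : (dist2 (g i k) (fun x => Df x ord0 i) @[k --> \oo] --> 0)%E.
  have [C C0 CP] := cutoff_derive_bound (delta_mx ord0 i).
  (* The difference has two parts, bounded by |Df| (as the cut-off lies in [0, 1]) and by C |f| (as
     its derivative is at most C); the factors 2 come from squaring their sum. *)
  apply: (@dist2_dominated _ _ _ _ (fun x => 2 * Df x ord0 i ^+ 2 + 2 * C ^+ 2 * f x ^+ 2)) => //.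
  - have := integrableD measurableT (integrableZl measurableT 2 (sqr_int _ (Df2 i)))
      (integrableZl measurableT (2 * C ^+ 2) (sqr_int _ f2)).
    by under eq_fun do rewrite -!EFinM -EFinD.
  - move=> x; have L1 := @cutoff_cvg (fun x => Df x ord0 i) x.
    have L2 : f x * 'D_(delta_mx ord0 i) (c k) x @[k --> \oo] --> 0.
      apply: (cvg_dist_le _ (B := fun k => `|f x| * C / k.+1%:R)); last exact: invr_nat_cvg0.
      by move=> k; rewrite subr0 normrM -mulrA ler_wpM2l.
    by have := cvgD L1 L2; rewrite addr0; apply.
  - move=> k x; have := cle k x (Df x ord0 i).
    have : (f x * 'D_(delta_mx ord0 i) (c k) x) ^+ 2 <= C ^+ 2 * f x ^+ 2.
      rewrite exprMn mulrC ler_wpM2r ?sqr_ge0// -(real_normK (num_real _)) lerXn2r ?nnegrE//.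
      by rewrite (le_trans (CP k x))// ler_pdivrMr// ler_peMr// ler1n.
    rewrite /g; set a := c k x * _; set b := f x * _; set d := Df x _ _ => H1' H2'.
    have := sqr_ge0 ((a - d) - b); nra.
have [k [k0 kP]] : exists k, (dist2 (g0 k) f <= (e / 4)%:E)%E /\
    forall i, (dist2 (g i k) (fun x => Df x ord0 i) <= (e / 4)%:E)%E.
  have near_le (F : nat -> \bar R) : (F k @[k --> \oo] --> 0)%E ->
      \forall k \near \oo, (F k <= (e / 4)%:E)%E.
    move=> /fine_cvgP[fin /cvgrPdistC_le H]; have := H _ e40.
    move=> /(filterI fin); apply: filterS => k /= [kfin]; rewrite subr0 => ke.
    by rewrite -(fineK kfin) lee_fin (le_trans (ler_norm _)).
  have H0 := near_le _ g0cvg.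
  have Hi : \forall k \near \oo, forall i, (dist2 (g i k) (fun x => Df x ord0 i) <= (e / 4)%:E)%E.
    by apply: filter_forall => i; exact: near_le.
  have [k [k0 kP]] := filter_ex (filterI H0 Hi); by exists k.
have gL2 (q h : rV -> R) : L2 q -> test_function setT h ->
    L2 (fun x => h x * q x) /\ mu.-integrable setT (EFin \o (fun x => h x * q x)).
  move=> q2 th; have [h2 _] := test_function_L2 th.
  split; last by under eq_fun do rewrite mulrC; exact: Lfun2_integrableM.
  have [B _ BP] := test_function_bounded th.
  exact: L2_bounded_mul (measurable_test_function th) BP q2.
have [g02 ig0] := gL2 f (c k) f2 (tc k).
have [g2 ig] : (forall i, L2 (g i k)) /\ forall i, mu.-integrable setT (EFin \o g i k).
  have Hi i : L2 (g i k) /\ mu.-integrable setT (EFin \o g i k).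
    have [a2 ia] := gL2 (fun x => Df x ord0 i) (c k) (Df2 i) (tc k).
    have [b2 ib] := gL2 f ('D_(delta_mx ord0 i) (c k)) f2 (test_function_derive _ (tc k)).
    have E : g i k = (fun x => 1 * (c k x * Df x ord0 i) + 'D_(delta_mx ord0 i) (c k) x * f x).
      by apply/funext => x; rewrite /g mul1r [f x * _]mulrC.
    split; first by rewrite E; exact: Lfun2_lin.
    have := integrableD measurableT ia ib; rewrite E.
    by under eq_fun do rewrite -EFinD; under [in X in _ -> X]eq_fun do rewrite mul1r.
  by split=> i; have [] := Hi i.
have [d [d0 dP dPi]] : exists d : R, [/\ 0 < d,
    (dist2 (conv (g0 k) (moll d)) (g0 k) <= (e / 4)%:E)%E &
    forall i, (dist2 (conv (g i k) (moll d)) (g i k) <= (e / 4)%:E)%E].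
  have [d1 d10 d1P] := conv_moll_cvg g02 ig0 e40.
  have /choice[d2 d2P] : forall i : 'I_n, exists d : R, 0 < d /\ forall eps, 0 < eps <= d ->
      (dist2 (conv (g i k) (moll eps)) (g i k) <= (e / 4)%:E)%E.
    by move=> i; have [d d0 dP] := conv_moll_cvg (g2 i) (ig i) e40; exists d.
  pose d := \big[Num.min/d1]_i d2 i.
  have d0 : 0 < d.
    by rewrite /d; elim/big_ind : _ => // [a b a0 b0|i _]; [rewrite lt_min a0|have [] := d2P i].
  exists d; split=> //.
    by apply: d1P; rewrite d0 bigmin_le_id.
  by move=> i; have [_] := d2P i; apply; rewrite d0 bigmin_le.
have tm := test_function_moll (n := n) d0.
exists (conv (g0 k) (moll d)); split.
- apply: (@test_function_conv _ _ _ _ (2 * k.+1%:R)) => //.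
  move=> x; rewrite mulf_eq0 negb_or => /andP[cx _]; apply: rV_norm_le => //.
  exact: cutoff_neq0.
- have mcv : measurable_fun setT (conv (g0 k) (moll d)).
    by apply: continuous_measurable_rV; exact/smooth_continuous/smooth_conv.
  apply: (le_trans (dist2_triangle mf (mg0 k) mcv)).
  apply: (@le_trans _ _ (2%:E * ((e / 4)%:E + (e / 4)%:E))%E).
    by rewrite lee_pmul2l//= leeD// dist2C.
  by rewrite -EFinD -EFinM lee_fin; lra.
- move=> i; rewrite (derive_cutoff_conv _ _ Hf tm) -/(g i k).
  have mcv : measurable_fun setT (conv (g i k) (moll d)).
    by apply: continuous_measurable_rV; exact/smooth_continuous/smooth_conv.
  apply: (le_trans (dist2_triangle (mDf i) (mg i k) mcv)).
  apply: (@le_trans _ _ (2%:E * ((e / 4)%:E + (e / 4)%:E))%E).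
    by rewrite lee_pmul2l//= leeD// dist2C.
  by rewrite -EFinD -EFinM lee_fin; lra.
Qed.

End H1_density.

(** * The weak form of the equation *)

Section constant_on_half_line.
Context {R : realType}.
Implicit Types (f F : R -> R).

Lemma flat1_homo (x y : R) : x <= y -> flat 1 x <= flat 1 y.
Proof.
move=> xy; have [x0|x0] := ltP 0 x; last by rewrite flat_eq0 ?flat1_ge0.
have y0 := lt_le_trans x0 xy.
by rewrite /flat x0 y0 !hornerE ?mul1r ler_expR lerN2 lef_pV2.
Qed.

Lemma step_homo (x y : R) : x <= y -> step x <= step y.
Proof.
move=> xy; have D (z : R) : 0 < flat 1 z + flat 1 (1 - z).
  have [z0|z0] := ltP 0 z; first by rewrite ltr_pwDl ?flat1_gt0 ?flat1_ge0.
  by rewrite ltr_wpDl ?flat1_gt0 ?flat1_ge0//; lra.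
rewrite /step ler_pdivrMr// mulrAC ler_pdivlMr// !mulrDr [flat 1 x * flat 1 y]mulrC lerD2l.
by rewrite ler_pM ?flat1_ge0 ?flat1_homo// lerD2l lerN2.
Qed.

Lemma is_derive_homo_ge0 f (x d : R) : is_derive x 1 f d ->
  (forall y z, y <= z -> f y <= f z) -> 0 <= d.
Proof.
move=> /is_derive1_slope fd fh; rewrite -(cvg_lim _ fd)//; apply: limr_ge;
  first by apply: cvgP fd.
near=> s; have [sx|sx|->] := ltrgtP s x.
- by rewrite mulr_le0// ?invr_le0 ?subr_le0 ?fh// ltW.
- by rewrite mulr_ge0// ?invr_ge0 ?subr_ge0 ?fh// ltW.
- by rewrite [f x - _]subrr mulr0.
Unshelve. all: by end_near. Qed.

Lemma is_derive1M f g (x a b : R) : is_derive x 1 f a -> is_derive x 1 g b ->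
  is_derive x 1 (fun x => f x * g x) (a * g x + f x * b).
Proof.
move=> d1 d2; have -> : (fun x => f x * g x) = f * g by [].
by apply: is_derive_eq; rewrite /GRing.scale/=; ring.
Qed.

Lemma is_derive1_lin (c d : R) f g (x a b : R) : is_derive x 1 f a -> is_derive x 1 g b ->
  is_derive x 1 (fun x => c * f x + d * g x) (c * a + d * b).
Proof.
move=> d1 d2; have -> : (fun x => c * f x + d * g x) = c \*: f + d \*: g by [].
by apply: is_derive_eq.
Qed.

Lemma smooth_is_derive f (x : R) : smooth f -> is_derive x 1 f ('D_1 f x).
Proof.
by move=> sf; apply: derivableP; apply/derivable1_diffP; exact: smooth_differentiable.
Qed.

Lemma derive_neq0_segment f (v a b : R) : (forall x, f x != 0 -> a <= x <= b) ->
  forall x, 'D_v f x != 0 -> a <= x <= b.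
Proof.
move=> fab x Dx; have sf : supp f `<=` `[a, b]%classic.
  by apply: supp_closed_sub; [exact: interval_closed|].
by have /sf := @supp_derive R R f v x (@supp_neq0 R R ('D_v f) x Dx); rewrite /= in_itv.
Qed.

Lemma derive_ge0_le F f (a b : R) : a <= b ->
  (forall x, a <= x <= b -> is_derive x 1 F (f x)) ->
  (forall x, a <= x <= b -> 0 <= f x) -> F a <= F b.
Proof.
move=> ab Fd f0.
have [||c + E] := @MVT_segment R F f a b ab.
- move=> x; rewrite in_itv/= => /andP[ax xb]; apply: Fd; rewrite (ltW ax) (ltW xb)//.
- apply: derivable_within_continuous => x; rewrite in_itv/= => /Fd[].
  by [].
by rewrite in_itv/= => /f0 fc; rewrite -subr_ge0 E mulr_ge0// subr_ge0.
Qed.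

Lemma Rintegral_half_line F f (c d : R) : 0 < c -> c < d -> continuous f ->
  (forall x : R, 0 < x -> is_derive x 1 F (f x)) ->
  (forall x, f x != 0 -> c <= x <= d) ->
  \int[lebesgue_measure]_(t in `]0, +oo[) f t = F d - F c.
Proof.
move=> c0 cd cf Fd fcd.
have -> : \int[lebesgue_measure]_(t in `]0, +oo[) f t =
    \int[lebesgue_measure]_(t in `[c, d]) f t.
  rewrite [LHS]Rintegral_mkcond [RHS]Rintegral_mkcond; congr (Rintegral _ _ _).
  apply/funext => x; rewrite /patch; have [fx|/fcd/andP[cx xd]] := eqVneq (f x) 0.
    by rewrite fx !if_same.
  by rewrite !mem_set//= in_itv/= ?andbT ?cx// (lt_le_trans c0).
rewrite /Rintegral (@continuous_FTC2 R f F c d)//.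
- by apply: continuous_subspaceT.
- split.
  + by move=> x; rewrite in_itv/= => /andP[cx _]; have [] := Fd _ (lt_trans c0 cx).
  + apply/cvg_at_right_filter; apply: differentiable_continuous; apply/derivable1_diffP.
    by have [] := Fd _ c0.
  + apply/cvg_at_left_filter; apply: differentiable_continuous; apply/derivable1_diffP.
    by have [] := Fd _ (lt_trans c0 cd).
- move=> x; rewrite in_itv/= => /andP[cx _]; rewrite derive1E.
  by have [_] := Fd _ (lt_trans c0 cx).
Qed.

(** [S1] and [S2] rise from 0 to 1, so [dS1] and [dS2] act as probability densities, and H d = H c
    says that r has the same average for both. Each average is within eta of r1 or r2. The averages
    are compared through monotone functions instead of integrals. *)
Lemma weighted_average (H S1 S2 dS1 dS2 r : R -> R) (c d r1 r2 eta : R) : c <= d ->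
  (forall x, c <= x <= d -> is_derive x 1 H ((dS1 x - dS2 x) * r x)) ->
  (forall x, c <= x <= d -> is_derive x 1 S1 (dS1 x)) ->
  (forall x, c <= x <= d -> is_derive x 1 S2 (dS2 x)) ->
  (forall x, 0 <= dS1 x) -> (forall x, 0 <= dS2 x) ->
  (forall x, dS1 x != 0 -> `|r x - r1| <= eta) ->
  (forall x, dS2 x != 0 -> `|r x - r2| <= eta) ->
  S1 c = 0 -> S2 c = 0 -> S1 d = 1 -> S2 d = 1 -> H d = H c ->
  `|r1 - r2| <= eta * 2.
Proof.
move=> cd Hd S1d S2d dS10 dS20 r1P r2P S1c S2c S1d1 S2d1 HE.
have key (k : R) : `|k| = 1 -> k * (r1 - r2) <= eta * 2.
  (* J' is dS1 (r - r1) - dS2 (r - r2), so k J + eta (S1 + S2) is nondecreasing; comparing its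
     values at c and d gives the claim. The signs k = 1 and k = -1 yield the two halves of the
     absolute value. *)
  move=> k1; pose J x := 1 * H x + 1 * (- r1 * S1 x + r2 * S2 x).
  have Jd x : c <= x <= d -> is_derive x 1 (fun x => k * J x + eta * (1 * S1 x + 1 * S2 x))
      (k * (dS1 x * (r x - r1) - dS2 x * (r x - r2)) + eta * (dS1 x + dS2 x)).
    move=> xcd; have d3 := is_derive1_lin 1 1 (Hd x xcd) (is_derive1_lin (- r1) r2 (S1d x
      xcd) (S2d x xcd)).
    apply: is_derive_eq (is_derive1_lin k eta d3 (is_derive1_lin 1 1 (S1d x xcd) (S2d x xcd))) _.
    ring.
  have pos (D : R -> R) q x : (forall x, 0 <= D x) -> (forall x, D x != 0 -> `|r x - q| <= eta) ->
      `|D x * (r x - q)| <= eta * D x.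
    move=> D0 Dq; have [->|Dx] := eqVneq (D x) 0; first by rewrite mul0r normr0 mulr0.
    by rewrite normrM ger0_norm// mulrC ler_wpM2r// Dq.
  have := derive_ge0_le cd Jd; rewrite /J HE S1c S2c S1d1 S2d1 => h.
  suff /h {h}h : forall x, c <= x <= d ->
      0 <= k * (dS1 x * (r x - r1) - dS2 x * (r x - r2)) + eta * (dS1 x + dS2 x) by lra.
  move=> x _; have h1 := pos dS1 r1 x dS10 r1P; have h2 := pos dS2 r2 x dS20 r2P.
  move: h1 h2; move: (dS1 x * (r x - r1)) (dS2 x * (r x - r2)) => A B h1 h2.
  have : `|k * (A - B)| <= `|A| + `|B| by rewrite normrM k1 mul1r ler_normB.
  by rewrite ler_norml => /andP[h3 _]; lra.
rewrite ler_norml; have := key 1 (normr1 _); have := key (-1) (normrN1 _).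
by rewrite mulN1r mul1r => ? ?; apply/andP; split; lra.
Qed.

(* Testing with [step ((. - s) / e) - step ((. - t) / e)] shows that p + m + Q,
   for a primitive Q of q, takes the same value at s and t. *)
Lemma dubois_reymond (m p q : R -> R) :
  continuous m -> continuous p -> continuous q ->
  (forall t : R, 0 < t -> is_derive t 1 m (p t)) ->
  (forall theta, test_function [set t : R | 0 < t] theta ->
    \int[lebesgue_measure]_(t in `]0, +oo[)
      ('D_1 ('D_1 theta) t * m t - 'D_1 theta t * m t + theta t * q t) = 0) ->
  forall t : R, 0 < t -> is_derive t 1 p (- q t - p t).
Proof.
move=> cm cp cq md Hth.
have [Q Qd] := @primitive_exists R q (-1) cq.
have QdP (x : R) : 0 < x -> is_derive x 1 Q (q x) by move=> x0; apply: Qd; lra.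
(* [Q] is differentiable only to the right of -1; the absolute value makes [r] continuous on the
   whole line without changing it at positive times. *)
pose r t := p t + m t + Q `|t|.
have cr : continuous r.
  move=> x; apply: cvgD; first by apply: cvgD; [exact: cp|exact: cm].
  apply: continuous_comp; first exact: norm_continuous.
  apply: differentiable_continuous; apply/derivable1_diffP.
  by have [] := Qd `|x| (lt_le_trans _ (normr_ge0 x)).
suff rC (s t : R) : 0 < s -> 0 < t -> r s = r t.
  move=> t t0; pose c := r t.
  have D : is_derive t 1 (fun t => c - m t - Q t) (- q t - p t).
    have d1 := md _ t0; have d2 := QdP _ t0.
    have -> : (fun t => c - m t - Q t) = cst c - m - Q by [].
    by apply: is_derive_eq; rewrite sub0r addrC.
  apply: (near_eq_is_derive _ D).
  near=> s; have s0 : 0 < s by near: s; exact: lt_nbhsr.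
  have := rC s t s0 t0; rewrite /c /r gtr0_norm// => <-; lra.
move=> s0 t0; apply/eqP; rewrite -subr_eq0 -normr_le0; apply/ler_addgt0Pr => eta eta0.
rewrite add0r.
have [e e0 [rs rt]] : exists2 e : R, 0 < e &
    (forall x, s <= x <= s + e -> `|r x - r s| <= eta / 2) /\
    (forall x, t <= x <= t + e -> `|r x - r t| <= eta / 2).
  have eta20 : 0 < eta / 2 by lra.
  have /cvgrPdist_le/(_ _ eta20)/nbhs_ballP[e1 /= e10 H1] := cr s.
  have /cvgrPdist_le/(_ _ eta20)/nbhs_ballP[e2 /= e20 H2] := cr t.
  have e0 : 0 < Num.min e1 e2 by rewrite lt_min e10.
  have e1m : Num.min e1 e2 <= e1 by rewrite ge_min lexx.
  have e2m : Num.min e1 e2 <= e2 by rewrite ge_min lexx orbT.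
  exists (Num.min e1 e2 / 2); first by lra.
  split=> x /andP[sx xs]; rewrite distrC; [apply: H1|apply: H2]; rewrite /ball/= ltr_norml;
    apply/andP; split; lra.
pose S (s x : R) := step (e^-1 * x + - (e^-1 * s)).
have sS s' : smooth (S s') by apply: smooth_reparam; exact: smooth_step.
have Sh s' (y z : R) : y <= z -> S s' y <= S s' z.
  by move=> yz; apply: step_homo; rewrite lerD2r ler_wpM2l// invr_ge0 ltW.
have dS0 s' x : 0 <= 'D_1 (S s') x.
  exact: (is_derive_homo_ge0 (smooth_is_derive x (sS s')) (Sh s')).
have SE s' x : e^-1 * x + - (e^-1 * s') = (x - s') / e by rewrite -mulrBr mulrC.
have S0 (s' x : R) : x <= s' -> S s' x = 0.
  move=> xs; apply: step_eq0; rewrite SE; apply: mulr_le0_ge0;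
    [by rewrite subr_le0|by rewrite invr_ge0 ltW].
have S1 (s' x : R) : s' + e <= x -> S s' x = 1.
  by move=> xs; apply: step_eq1; rewrite SE ler_pdivlMr//; lra.
pose a := Num.min s t; pose b := Num.max s t + e.
have [a0 a_s a_t] : [/\ 0 < a, a <= s & a <= t] by rewrite lt_min s0 !ge_min !lexx orbT.
have [bs bt] : s + e <= b /\ t + e <= b by rewrite /b !lerD2r !le_max !lexx orbT.
pose theta x := 1 * S s x + -1 * S t x.
have sth : smooth theta by apply: smoothD; apply: smoothZ; exact: sS.
have th0 x : theta x != 0 -> a <= x <= b.
  apply: contraNT; rewrite negb_and -!ltNge => /orP[xc|dx]; rewrite /theta.
    by rewrite !S0 ?mulr0 ?addr0//; lra.
  by rewrite !S1//; [apply/eqP; ring|lra|lra].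
have tth : test_function [set t : R | 0 < t] theta.
  apply: (@test_function_sub _ _ _ `[a, b]%classic) => //.
  - exact: segment_compact.
  - exact: interval_closed.
  - move=> x /=; rewrite in_itv/= => /andP[ax _]; lra.
have th'0 := @derive_neq0_segment theta 1 a b th0.
have th''0 := @derive_neq0_segment ('D_1 theta) 1 a b th'0.
have sth' := @smooth_derive R R theta 1 sth.
have sth'' := @smooth_derive R R ('D_1 theta) 1 sth'.
have cth := @smooth_continuous R R _ sth; have cth' := @smooth_continuous R R _ sth'.
have cth'' := @smooth_continuous R R _ sth''.
have ctr : continuous (fun x => 'D_1 theta x * r x).
  by move=> x; apply: cvgM; [exact: cth'|exact: cr].
have [H Hd] := @primitive_exists R _ 0 ctr.
pose c := a / 2; pose d := b + 1.
have [c0 cd ca bd] : [/\ 0 < c, c < d, c <= a & b <= d] by rewrite /c /d; split; lra.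
(* The integrand of the hypothesis is the derivative of theta' m + theta Q minus theta' r, and H is
   a primitive of theta' r. At c and d both theta and theta' vanish, so the hypothesis reduces to H
   d = H c. *)
pose F x := 1 * (1 * ('D_1 theta x * m x) + 1 * (theta x * Q x)) + -1 * H x.
have Fd (x : R) : 0 < x -> is_derive x 1 F ('D_1 ('D_1 theta) x * m x - 'D_1 theta x * m x +
  theta x * q x).
  move=> x0; have d1 := smooth_is_derive x sth; have d2 := smooth_is_derive x sth'.
  have d12 := is_derive1_lin 1 1 (is_derive1M d2 (md x x0)) (is_derive1M d1 (QdP x x0)).
  apply: is_derive_eq (is_derive1_lin 1 (-1) d12 (Hd x x0)) _; rewrite /r gtr0_norm//.
  move: ('D_1 ('D_1 theta) x) ('D_1 theta x) (theta x) => A B C; ring.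
have := Hth theta tth; rewrite (Rintegral_half_line c0 cd _ Fd); last 2 first.
- move=> x; apply: cvgD; first apply: cvgB.
  + by apply: cvgM; [exact: cth''|exact: cm].
  + by apply: cvgM; [exact: cth'|exact: cm].
  + by apply: cvgM; [exact: cth|exact: cq].
- move=> x; apply: contraNT => ncd; have nab : ~~ (a <= x <= b).
    by apply: contra ncd => /andP[ax xb]; apply/andP; split; rewrite /c/d; lra.
  have z (g : R -> R) : (forall x, g x != 0 -> a <= x <= b) -> g x = 0.
    by move=> gP; apply/eqP; apply: contraNT nab => /gP.
  by rewrite (z _ th0) (z _ th'0) (z _ th''0) !mul0r subrr addr0.
have nab x : x < a \/ b < x -> theta x = 0 /\ 'D_1 theta x = 0.
  move=> xab; have z (g : R -> R) : (forall x, g x != 0 -> a <= x <= b) -> g x = 0.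
    by move=> gP; apply/eqP; apply: contraPT xab => /gP/andP[ax xb]; lra.
  by split; [exact: (z theta th0)|exact: (z ('D_1 theta) th'0)].
have [thc th'c] : theta c = 0 /\ 'D_1 theta c = 0 by apply: nab; left; rewrite /c; lra.
have [thd th'd] : theta d = 0 /\ 'D_1 theta d = 0 by apply: nab; right; rewrite /d; lra.
rewrite /F thc th'c thd th'd !(mul0r, mulr0, addr0, add0r) -mulrBr => /eqP;
  rewrite mulf_eq0 oppr_eq0 oner_eq0/= subr_eq0 => /eqP HE.
have dS s' x : 'D_1 (S s') x != 0 -> s' <= x <= s' + e.
  move=> Sx.
  apply: contraNT Sx; rewrite negb_and -!ltNge => /orP[xs|sx]; apply/eqP.
    rewrite (@near_eq_derive _ _ _ _ (fun=> 0)) ?derive_cst//.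
    near=> y; apply: S0; apply: ltW; near: y; exact: lt_nbhsl.
  rewrite (@near_eq_derive _ _ _ _ (fun=> 1%R : R)) ?derive_cst//.
  near=> y; apply: S1; apply: ltW; near: y; exact: lt_nbhsr.
have dthE x : 'D_1 theta x = 'D_1 (S s) x - 'D_1 (S t) x.
  rewrite -['D_1 (S s) x]mul1r -mulN1r.
  by have [_] := is_derive1_lin 1 (-1) (smooth_is_derive x (sS s)) (smooth_is_derive x (sS t)).
rewrite -[eta]divr1 -(divff (_ : 2 != 0 :> R)) ?pnatr_eq0// invfM invrK mulrA.
apply: (@weighted_average H (S s) (S t) ('D_1 (S s)) ('D_1 (S t)) r c d) => //.
- exact: ltW.
- by move=> x /andP[cx _]; rewrite -dthE; apply/Hd/(lt_le_trans c0).
- by move=> x _; exact: smooth_is_derive.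
- by move=> x _; exact: smooth_is_derive.
- by move=> x /dS; exact: rs.
- by move=> x /dS; exact: rt.
- by apply: S0; apply: (le_trans ca).
- by apply: S0; apply: (le_trans ca).
- by apply: S1; apply: (le_trans _ bd).
- by apply: S1; apply: (le_trans _ bd).
Unshelve. all: by end_near. Qed.

End constant_on_half_line.

(** * Product test functions and the weak form at a fixed spatial test function *)

Section tensor_test_function.
Context {R : realType} {n : nat}.
Local Notation rV := 'rV[R]_n.
Implicit Types (theta : R -> R) (psi : rV -> R).

Definition tensor theta psi (z : R * rV) : R := theta z.1 * psi z.2.

Let lin_fst : linear (@fst R rV). Proof. by move=> k []. Qed.
Let lin_snd : linear (@snd R rV). Proof. by move=> k []. Qed.
Let cont_fst : continuous (@fst R rV). Proof. by move=> z; exact: cvg_fst. Qed.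
Let cont_snd : continuous (@snd R rV). Proof. by move=> z; exact: cvg_snd. Qed.

Let fstE theta : (fun z : R * rV => theta z.1) = (fun z : R * rV => theta (z.1 + 0)).
Proof. by apply/funext => z; rewrite addr0. Qed.
Let sndE psi : (fun z : R * rV => psi z.2) = (fun z : R * rV => psi (z.2 + 0)).
Proof. by apply/funext => z; rewrite addr0. Qed.

Lemma smooth_fst theta : smooth theta -> smooth (fun z : R * rV => theta z.1).
Proof.
by move=> st; rewrite fstE; exact: (smooth_comp_affine 0 lin_fst cont_fst st).
Qed.

Lemma smooth_snd psi : smooth psi -> smooth (fun z : R * rV => psi z.2).
Proof.
by move=> st; rewrite sndE; exact: (smooth_comp_affine 0 lin_snd cont_snd st).
Qed.

Lemma derive_tensor theta psi (v : R * rV) : smooth theta -> smooth psi ->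
  'D_v (tensor theta psi) =
  (fun z => theta z.1 * 'D_(v.2) psi z.2 + 'D_(v.1) theta z.1 * psi z.2).
Proof.
move=> st sp; apply/funext => z.
have d1 : 'D_v (fun z : R * rV => theta z.1) z = 'D_(v.1) theta z.1.
  rewrite fstE (@derive_comp_affine _ _ _ (@fst R rV) 0 theta) ?addr0//.
  exact: smooth_differentiable.
have d2 : 'D_v (fun z : R * rV => psi z.2) z = 'D_(v.2) psi z.2.
  rewrite sndE (@derive_comp_affine _ _ _ (@snd R rV) 0 psi) ?addr0//.
  exact: smooth_differentiable.
rewrite -d1 -d2.
have -> : tensor theta psi = (fun z => theta z.1) * (fun z => psi z.2) by [].
rewrite deriveM; last 2 first.
- by apply: diff_derivable; apply: smooth_differentiable; exact: smooth_fst.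
- by apply: diff_derivable; apply: smooth_differentiable; exact: smooth_snd.
by rewrite /GRing.scale/= [psi z.2 * _]mulrC.
Qed.

Lemma dt_tensor theta psi : smooth theta -> smooth psi ->
  dt (tensor theta psi) = tensor ('D_1 theta) psi.
Proof.
move=> st sp; rewrite /dt derive_tensor//; apply/funext => z /=.
by rewrite derive0 mulr0 add0r.
Qed.

Lemma dx_tensor i theta psi : smooth theta -> smooth psi ->
  dx i (tensor theta psi) = tensor theta ('D_(delta_mx ord0 i) psi).
Proof.
move=> st sp; rewrite /dx derive_tensor//; apply/funext => z /=.
by rewrite derive0 mul0r addr0.
Qed.

Lemma test_function_tensor (D : set R) theta psi :
  test_function D theta -> test_function setT psi ->
  test_function [set z : R * rV | D z.1] (tensor theta psi).
Proof.
move=> [st ct tD] [sp cp _].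
apply: (@test_function_sub _ _ _ (supp theta `*` supp psi)).
- by apply: smoothM; [exact: smooth_fst|exact: smooth_snd].
- exact: compact_setX.
- by apply: compact_closed; [exact: norm_hausdorff|exact: compact_setX].
- move=> z; rewrite /tensor mulf_eq0 negb_or => /andP[z1 z2].
  by split; exact: supp_neq0.
- by move=> z [/tD].
Qed.

End tensor_test_function.

Section weak_form.
Context {R : realType} {n : nat}.
Local Notation rV := 'rV[R]_n.
Local Notation mu := (@lebesgue_rV R n).

Lemma Rintegral_lin (c d : R) (f g : rV -> R) : mu.-integrable setT (EFin \o f) ->
  mu.-integrable setT (EFin \o g) ->
  mu.-integrable setT (EFin \o (fun x => c * f x + d * g x)) /\
  \int[mu]_x (c * f x + d * g x) = c * \int[mu]_x f x + d * \int[mu]_x g x.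
Proof.
move=> fi gi; have Zi (k : R) h : mu.-integrable setT (EFin \o h) ->
    mu.-integrable setT (EFin \o (fun x => k * h x)).
  by move=> hi; have := integrableZl measurableT k hi; under eq_fun do rewrite -EFinM.
have [cfi dgi] := (Zi c f fi, Zi d g gi).
split; first by have := integrableD measurableT cfi dgi; under eq_fun do rewrite -EFinD.
by rewrite RintegralD// !RintegralZl.
Qed.

Lemma Rintegral_sum_ord (k : nat) (f : 'I_k -> rV -> R) :
  (forall i, mu.-integrable setT (EFin \o f i)) ->
  mu.-integrable setT (EFin \o (fun x => \sum_(i < k) f i x)) /\
  \int[mu]_x (\sum_(i < k) f i x) = \sum_(i < k) \int[mu]_x f i x.
Proof.
elim: k f => [|k IH] f fi.
  split; last by under eq_Rintegral do rewrite big_ord0; rewrite big_ord0 Rintegral_cst// mul0r.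
  apply: eq_integrable (integrable0 _ _) => // x _.
  by rewrite /= big_ord0.
have [gi gE] := IH _ (fun i => fi (lift ord0 i)).
have [hi hE] := Rintegral_lin 1 1 (fi ord0) gi.
have E x : \sum_(i < k.+1) f i x = 1 * f ord0 x + 1 * \sum_(i < k) f (lift ord0 i) x.
  by rewrite big_ord_recl !mul1r.
split; last by under eq_Rintegral do rewrite E; rewrite hE gE big_ord_recl !mul1r.
by apply: eq_integrable hi => // x _; rewrite /= E.
Qed.

Variables (V : rV -> R) (M : R).
Hypotheses (mV : measurable_fun setT V) (VM : forall x, `|V x| <= M).

(** On a product theta(t) psi(x) the space-time identity becomes a scalar one in t. One derivative
    of the Laplacian is moved onto u by testing its weak gradient with the partial derivatives of
    psi. *)
Lemma weak_form_tensor (u : R -> rV -> R) (Du : R -> rV -> rV) :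
  damped_wave_distr V u -> (forall t, 0 < t -> H1 (u t) (Du t)) ->
  forall theta psi, test_function [set t : R | 0 < t] theta -> test_function setT psi ->
  \int[lebesgue_measure]_(t in `]0, +oo[)
    ('D_1 ('D_1 theta) t * \int[mu]_x (u t x * psi x)
     - 'D_1 theta t * \int[mu]_x (u t x * psi x)
     + theta t * (\sum_i \int[mu]_x (Du t x ord0 i * 'D_(delta_mx ord0 i) psi x)
                  + \int[mu]_x (V x * (u t x * psi x)))) = 0.
Proof.
move=> uV uH theta psi tt tp; have [st _ _] := tt; have [sp _ _] := tp.
have st' : smooth ('D_1 theta) by exact: smooth_derive.
rewrite -[RHS](uV _ (test_function_tensor tt tp)); apply: eq_Rintegral => t.
rewrite inE/= in_itv/= andbT => /uH[u2 Du2 uDu].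
have [p2 _] := test_function_L2 tp.
have tpi i := test_function_derive (delta_mx ord0 i) tp.
have spi i : smooth ('D_(delta_mx ord0 i) psi) by exact: smooth_derive.
have tpii i := test_function_derive (delta_mx ord0 i) (tpi i).
rewrite !dt_tensor//; have -> : laplacian (tensor theta psi) =
    (fun z => \sum_i tensor theta ('D_(delta_mx ord0 i) ('D_(delta_mx ord0 i) psi)) z).
  by apply/funext => z; apply: eq_bigr => i _; rewrite !dx_tensor.
have up := Lfun2_integrableM u2 p2.
have Vup := Lfun2_integrableM (L2_bounded_mul mV VM u2) p2.
have [si sE] := Rintegral_sum_ord (fun i => Lfun2_integrableM u2 (test_function_L2 (tpii i)).1).
have [i1 E1] := Rintegral_lin 1 (-1) Vup si.
have [_ E2] := Rintegral_lin ('D_1 ('D_1 theta) t - 'D_1 theta t) (theta t) up i1.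
have <- : \int[mu]_x (V x * u t x * psi x) = \int[mu]_x (V x * (u t x * psi x)).
  by apply: eq_Rintegral => x _; rewrite mulrA.
have DE : \sum_i \int[mu]_x (Du t x ord0 i * 'D_(delta_mx ord0 i) psi x) =
    - \sum_i \int[mu]_x (u t x * 'D_(delta_mx ord0 i) ('D_(delta_mx ord0 i) psi) x).
  by rewrite -sumrN; apply: eq_bigr => i _; rewrite (uDu i _ (tpi i)) opprK.
have alg (A B c m P Q W : R) : P = - Q ->
    A * m - B * m + c * (P + W) = (A - B) * m + c * (1 * W + -1 * Q) by move=> ->; ring.
transitivity (('D_1 ('D_1 theta) t - 'D_1 theta t) * \int[mu]_x (u t x * psi x) +
  theta t * (1 * \int[mu]_x (V x * u t x * psi x) + -1 *
   \sum_i \int[mu]_x (u t x * 'D_(delta_mx ord0 i) ('D_(delta_mx ord0 i) psi) x))).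
  exact: alg DE.
rewrite -sE -E1 -E2; apply: eq_Rintegral => x _; rewrite /tensor/= -!mulr_sumr.
have alg2 (A B c p v q S : R) : (A - B) * (q * p) + c * (1 * (v * q * p) + -1 * (q * S)) =
    q * (A * p - c * S + v * (c * p) - B * p) by ring.
exact: alg2.
Qed.

End weak_form.

(** * From test functions to limits of test functions *)

Lemma MVT_ball {R : realType} (g q : R -> R) (s t : R) :
  (forall c, `|c - t| <= `|s - t| -> is_derive c 1 g (q c)) ->
  exists2 c, `|c - t| <= `|s - t| & g s - g t = q c * (s - t).
Proof.
move=> gd; have cont (a b : R) : (forall c, a <= c <= b -> is_derive c 1 g (q c)) ->
    a <= b -> exists2 c, a <= c <= b & g b - g a = q c * (b - a).
  move=> gab ab; have [||c] := @MVT_segment R g q a b ab.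
  - by move=> x; rewrite in_itv/= => /andP[ax xb]; apply: gab; rewrite !ltW.
  - by apply: derivable_within_continuous => x; rewrite in_itv/= => /gab[].
  by rewrite in_itv/= => cab E; exists c.
have [st|ts] := leP s t.
  have E c : s <= c <= t -> `|c - t| <= `|s - t|.
    by move=> /andP[sc ct]; rewrite !ler0_norm ?subr_le0// lerN2 lerD2r.
  have [c /E ct gE] := cont s t (fun c h => gd c (E c h)) st.
  by exists c => //; rewrite -opprB gE; ring.
have E c : t <= c <= s -> `|c - t| <= `|s - t|.
  by move=> /andP[tc cs]; rewrite !ger0_norm ?subr_ge0 ?lerD2r// ltW.
have [c /E ct gE] := cont t s (fun c h => gd c (E c h)) (ltW ts).
by exists c.
Qed.

(** Derivatives do not pass to limits by themselves. For an approximant W' the mean value theorem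
    controls the increment from t to s by continuity of U and v alone, uniformly in W'; with s
    fixed, W' tends to W, and only afterwards s tends to t. *)
Lemma wave_of_dense {R : realType} {X Y : lmodType R} (ip : X -> X -> R) (a : Y -> Y -> R)
    (iota : Y -> X) (U : R -> Y) (v : R -> X) (S : set Y) :
  semi_inner ip -> semi_inner a ->
  (forall t, snorm a (U s - U t) @[s --> t] --> 0) ->
  (forall t, snorm ip (v s - v t) @[s --> t] --> 0) ->
  (forall W, S W -> forall s : R, 0 < s ->
    is_derive s 1 (fun s => ip (v s) (iota W)) (- a (U s) W - ip (v s) (iota W))) ->
  forall W, (forall e : R, 0 < e -> exists2 W', S W' &
    snorm a (W - W') <= e /\ snorm ip (iota W - iota W') <= e) ->
  forall s : R, 0 < s ->
    is_derive s 1 (fun s => ip (v s) (iota W)) (- a (U s) W - ip (v s) (iota W)).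
Proof.
move=> sip sa Uc vc SW W dense t t0; apply/is_derive1_slope/cvgrPdistC_le => e e0.
have frac (x k : R) : 0 <= x -> 0 < k -> k / (x + 1) * x <= k.
  by move=> x0 k0; rewrite mulrAC ler_pdivrMr ?ltr_wpDl// ler_pM2l// lerDl.
pose N := snorm a W + snorm ip (iota W).
have N0 : 0 <= N by rewrite addr_ge0// snorm_ge0.
pose eta := e / (N + 1).
have eta0 : 0 < eta by rewrite divr_gt0// ltr_wpDl.
have etaN : eta * N <= e by exact: frac.
have /cvgrPdistC_le/(_ _ eta0)/nbhs_ballP[r1 /= r10 H1] := Uc t.
have /cvgrPdistC_le/(_ _ eta0)/nbhs_ballP[r2 /= r20 H2] := vc t.
(* The bound by [t] keeps every intermediate point positive, where the equation holds. *)
pose r := Num.min t (Num.min r1 r2).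
have r0 : 0 < r by rewrite !lt_min t0 r10.
have [rt rr1 rr2] : [/\ r <= t, r <= r1 & r <= r2] by rewrite !ge_min !lexx !orbT.
apply/nbhs_ballP; exists r => // s; rewrite /ball/= => st /eqP/eqP sNt.
have {}st : `|s - t| < r by rewrite distrC.
have s_t : 0 < `|s - t| by rewrite normr_gt0 subr_eq0.
rewrite -(ler_pM2r s_t) -normrM mulrBl mulrAC mulVf ?subr_eq0// mul1r.
apply: (@le_trans _ _ (eta * N * `|s - t|)); last by rewrite ler_wpM2r.
(* From here on [s] is fixed; e' pays for replacing W by W', and the constant [C], which may depend
   on [s], collects all coefficients of the approximation error d. *)
apply/ler_addgt0Pr => e' e'0.
pose C := 2 * eta * `|s - t| + (snorm ip (v s) + snorm ip (v t) + (snorm a (U t) + snorm ip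
  (v t)) * `|s - t|).
have C0 : 0 <= C.
  by rewrite /C; repeat first [exact: snorm_ge0|exact: ltW|apply: addr_ge0|apply: mulr_ge0] => //.
pose d := e' / (C + 1).
have d0 : 0 < d by rewrite divr_gt0// ltr_wpDl.
have dC : d * C <= e' by exact: frac.
have [W' W'S [W1 W2]] := dense d d0.
have near_t c : `|c - t| <= `|s - t| -> [/\ 0 < c, snorm a (U c - U t) <= eta & snorm ip (v c
  - v t) <= eta].
  move=> ct; have {}ct := le_lt_trans ct st.
  split.
  - by move: (lt_le_trans ct rt); rewrite ltr_norml => /andP[+ _]; lra.
  - rewrite -[leLHS]ger0_norm ?snorm_ge0// -[snorm _ _]subr0; apply: H1.
    by rewrite /ball/= distrC (lt_le_trans ct).
  - rewrite -[leLHS]ger0_norm ?snorm_ge0// -[snorm _ _]subr0; apply: H2.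
    by rewrite /ball/= distrC (lt_le_trans ct).
have [c ct gE] := MVT_ball (fun c h => SW W' W'S c (let: And3 c0 _ _ := near_t c h in c0)).
have [_ Uct vct] := near_t c ct.
have b1 : `|ip (v s) (iota W - iota W')| <= snorm ip (v s) * d.
  by rewrite (le_trans (cauchy_schwarz sip _ _))// ler_wpM2l// snorm_ge0.
have b2 : `|ip (v t) (iota W - iota W')| <= snorm ip (v t) * d.
  by rewrite (le_trans (cauchy_schwarz sip _ _))// ler_wpM2l// snorm_ge0.
have b3 : `|a (U t) (W - W')| <= snorm a (U t) * d.
  by rewrite (le_trans (cauchy_schwarz sa _ _))// ler_wpM2l// snorm_ge0.
have W'n : snorm a W' <= snorm a W + d.
  rewrite -[W' in leLHS](subrK W) addrC (le_trans (ler_snormD sa _ _))// lerD2l.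
  by rewrite snorm_distC.
have w'n : snorm ip (iota W') <= snorm ip (iota W) + d.
  rewrite -[iota W' in leLHS](subrK (iota W)) addrC (le_trans (ler_snormD sip _ _))// lerD2l.
  by rewrite snorm_distC.
have b4 : `|a (U c - U t) W'| <= eta * (snorm a W + d).
  by rewrite (le_trans (cauchy_schwarz sa _ _))// ler_pM ?snorm_ge0.
have b5 : `|ip (v c - v t) (iota W')| <= eta * (snorm ip (iota W) + d).
  by rewrite (le_trans (cauchy_schwarz sip _ _))// ler_pM ?snorm_ge0.
(* The terms with W - W' are small with d. What is left is the increment for W', rewritten by the
   mean value theorem, whose error involves only U c - U t and v c - v t. *)
have E : ip (v s) (iota W) - ip (v t) (iota W) - (- a (U t) W - ip (v t) (iota W)) * (s - t) =
   ip (v s) (iota W - iota W') - ip (v t) (iota W - iota W') +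
   (a (U t) (W - W') + ip (v t) (iota W - iota W')) * (s - t)
   - (a (U c - U t) W' + ip (v c - v t) (iota W')) * (s - t).
  rewrite (siBl sip) (siBl sa) !(siBr sip) !(siBr sa).
  move: gE; set g1 := ip (v s) (iota W'); set g2 := ip (v t) (iota W') => gE.
  have -> : g1 = g2 + (- a (U c) W' - ip (v c) (iota W')) * (s - t) by rewrite -gE; ring.
  ring.
rewrite E; apply: (@le_trans _ _ (snorm ip (v s) * d + snorm ip (v t) * d +
  (snorm a (U t) * d + snorm ip (v t) * d) * `|s - t| +
  (eta * (snorm a W + d) + eta * (snorm ip (iota W) + d)) * `|s - t|)).
  rewrite (le_trans (ler_normB _ _))// lerD//.
    rewrite (le_trans (ler_normD _ _))// lerD//.
      by rewrite (le_trans (ler_normB _ _))// lerD.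
    by rewrite normrM ler_wpM2r// (le_trans (ler_normD _ _))// lerD.
  by rewrite normrM ler_wpM2r// (le_trans (ler_normD _ _))// lerD.
apply: le_trans (_ : eta * N * `|s - t| + d * C <= _); last by rewrite lerD2l.
by rewrite /N /C le_eqVlt; apply/orP; left; apply/eqP; ring.
Qed.

(** * The energy space *)

Section energy_space.
Context {R : realType} {n : nat}.
Local Notation rV := 'rV[R]_n.
Local Notation mu := (@lebesgue_rV R n).
Local Notation X := (LfunType mu (lee1n 2)).
Local Notation Y := (X * {ffun 'I_n -> X})%type.
Local Notation ip := (@L2ip _ _ R mu).
Implicit Types f g : rV -> R.

(** A total map into [LfunType]: outside L^2 it returns 0, so the lemmas on it carry [L2]
    hypotheses. *)
Definition L2_pack f : X := insubd (0 : X) f.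

Lemma L2_packE f : L2 f -> (L2_pack f : rV -> R) = f.
Proof. by move=> f2; rewrite -[LHS]/(val (L2_pack f)) insubdK. Qed.

Lemma L2ip_pack f g : L2 f -> L2 g -> L2ip (L2_pack f) (L2_pack g) = \int[mu]_x (f x * g x).
Proof. by move=> f2 g2; rewrite /L2ip !L2_packE. Qed.

Lemma L2_packB f g : L2 f -> L2 g -> L2_pack f - L2_pack g = L2_pack (fun x => f x - g x).
Proof.
move=> f2 g2; apply/LfuneqP => x; rewrite (L2_packE (Lfun2B f2 g2)).
by rewrite -[LHS]/((L2_pack f : rV -> R) x - (L2_pack g : rV -> R) x) !L2_packE.
Qed.

Lemma L2Z (c : R) f : L2 f -> L2 (fun x => c * f x).
Proof.
move=> f2; have := Lfun2_lin c f2 (LfunP (0 : X)).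
rewrite (_ : (fun x => _) = (fun x => c * f x))//.
by apply/funext => x; rewrite -[X in _ + X]/(0 : R) addr0.
Qed.

Lemma L2_packZ (c : R) f : L2 f -> c *: L2_pack f = L2_pack (fun x => c * f x).
Proof.
move=> f2; apply/LfuneqP => x; rewrite (L2_packE (L2Z c f2)).
by rewrite -[LHS]/(c * (L2_pack f : rV -> R) x) !L2_packE.
Qed.

Lemma snorm_pack f : L2 f -> (L2norm f = (snorm ip (L2_pack f))%:E)%E.
Proof. by move=> f2; rewrite /L2norm Lnorm2E// /snorm L2ip_pack. Qed.

Variables (V : rV -> R) (M : R).
Hypotheses (mV : measurable_fun setT V) (VM : forall x, `|V x| <= M) (V0 : forall x, 0 <= V x).

Definition grad_ip (W W' : Y) : R := \sum_i L2ip (W.2 i) (W'.2 i).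
Definition pot_ip (f g : X) : R := \int[mu]_x (V x * (f x * g x)).
(** The form a, defined on all pairs: that the second component is the gradient of the first is not
    built into [Y], and enters through [H1] when the equation is tested. *)
Definition energy_ip (W W' : Y) : R := grad_ip W W' + pot_ip W.1 W'.1.

Lemma grad_ip_semi_inner : semi_inner grad_ip.
Proof.
have s := L2ip_semi_inner mu; split.
- by move=> W W'; apply: eq_bigr => i _; exact: (semi_innerC s).
- move=> c W1 W2 W'; rewrite /grad_ip mulr_sumr -big_split/=; apply: eq_bigr => i _.
  by rewrite !ffunE (semi_inner_lin s).
- by move=> W; apply: sumr_ge0 => i _; exact: (semi_inner_ge0 s).
Qed.

Let Vint (f g : X) : mu.-integrable setT (EFin \o (fun x => V x * (f x * g x))).
Proof.
have := Lfun2_integrableM (L2_bounded_mul mV VM (LfunP f)) (LfunP g).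
by under eq_fun do rewrite -mulrA.
Qed.

Lemma pot_ip_semi_inner : semi_inner pot_ip.
Proof.
split.
- by move=> f g; apply: eq_Rintegral => x _; rewrite [f x * _]mulrC.
- move=> c f g h; rewrite /pot_ip.
  have [_] := Rintegral_lin c 1 (Vint f h) (Vint g h); rewrite mul1r => <-.
  by apply: eq_Rintegral => x _; rewrite mulrDl mulrDr mul1r -mulrA mulrCA.
- by move=> f; apply: Rintegral_ge0 => x _; rewrite mulr_ge0// -expr2 sqr_ge0.
Qed.

Lemma energy_ip_semi_inner : semi_inner energy_ip.
Proof.
have [s1 s2] := (grad_ip_semi_inner, pot_ip_semi_inner).
split.
- by move=> W W'; rewrite /energy_ip (semi_innerC s1) (semi_innerC s2).
- by move=> c W1 W2 W'; rewrite /energy_ip (semi_inner_lin s1) (semi_inner_lin s2 c W1.1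
  W2.1); ring.
- by move=> W; rewrite addr_ge0 ?(semi_inner_ge0 s1) ?(semi_inner_ge0 s2).
Qed.

Lemma pot_ip_le (f : X) : pot_ip f f <= M * L2ip f f.
Proof.
rewrite /pot_ip /L2ip -RintegralZl//; last by apply: Lfun2_integrableM; exact: LfunP.
apply: le_Rintegral => //.
- have := integrableZl measurableT M (Lfun2_integrableM (LfunP f) (LfunP f)).
  by under eq_fun do rewrite -EFinM.
- move=> x _; rewrite ler_wpM2r// -?expr2 ?sqr_ge0//.
  exact: le_trans (ler_norm _) (VM x).
Qed.

Definition sobolev_pack f (Df : rV -> rV) : Y :=
  (L2_pack f, [ffun i => L2_pack (fun x => Df x ord0 i)]).

Lemma sobolev_packB f g Df Dg : H1 f Df -> H1 g Dg ->
  sobolev_pack f Df - sobolev_pack g Dg = sobolev_pack (f \- g) (Df \- Dg).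
Proof.
move=> [f2 Df2 _] [g2 Dg2 _]; congr pair; first by rewrite /= L2_packB.
apply/ffunP => i; rewrite !ffunE L2_packB//; congr L2_pack.
by apply/funext => x; rewrite !mxE.
Qed.

Lemma L2_euclid (Df : rV -> rV) : (forall i, L2 (fun x => Df x ord0 i)) ->
  L2 (euclid \o Df) /\
  \int[mu]_x (euclid (Df x) * euclid (Df x)) =
  \sum_i \int[mu]_x (Df x ord0 i * Df x ord0 i).
Proof.
move=> Df2.
have [si sE] := Rintegral_sum_ord (fun i => Lfun2_integrableM (Df2 i) (Df2 i)).
have eE x : euclid (Df x) * euclid (Df x) = \sum_i Df x ord0 i * Df x ord0 i.
  rewrite -expr2 sqr_sqrtr; last by apply: sumr_ge0 => i _; exact: sqr_ge0.
  by apply: eq_bigr => i _; rewrite expr2.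
split; last by rewrite -sE; apply: eq_Rintegral => x _; exact: eE.
apply: L2_of_sqr.
  have -> : euclid \o Df = (fun x => (\sum_i Df x ord0 i ^+ 2) `^ 2^-1).
    by apply/funext => x; rewrite powR12_sqrt//; apply: sumr_ge0 => i _; exact: sqr_ge0.
  apply: (@measurableT_comp _ _ _ _ _ _ (fun y : R => y `^ 2^-1)); first exact: measurable_powR.
  by apply: measurable_sum => i; apply: measurable_funX; exact: Lfun2_measurable (Df2 i).
move/integrableP : si => [_]; apply: le_lt_trans; rewrite le_eqVlt; apply/orP; left.
apply/eqP; apply: eq_integral => x _; rewrite /= expr2 eE ger0_norm ?sumr_ge0// => i _.
by rewrite -expr2 sqr_ge0.
Qed.

Lemma H1normE f (Df : rV -> rV) : L2 f -> (forall i, L2 (fun x => Df x ord0 i)) ->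
  (H1norm f Df = (Num.sqrt (ip (sobolev_pack f Df).1 (sobolev_pack f Df).1 +
    grad_ip (sobolev_pack f Df) (sobolev_pack f Df)))%:E)%E.
Proof.
move=> f2 Df2; have [e2 eE] := L2_euclid Df2; have s := L2ip_semi_inner mu.
rewrite /H1norm !snorm_pack//.
rewrite -!EFin_expe -EFinD poweR_EFin !(sqr_snorm s) powR12_sqrt ?addr_ge0 ?(semi_inner_ge0 s)//.
congr (Num.sqrt (_ + _))%:E; rewrite L2ip_pack// eE; apply: eq_bigr => i _.
by rewrite !ffunE L2ip_pack.
Qed.

Let M0 : 0 <= M. Proof. by rewrite (le_trans _ (VM 0)). Qed.

Lemma energy_ip_le W : energy_ip W W <= (1 + M) * (ip W.1 W.1 + grad_ip W W).
Proof.
have g0 := semi_inner_ge0 grad_ip_semi_inner W.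
have h0 := semi_inner_ge0 (L2ip_semi_inner mu) W.1.
have := pot_ip_le W.1; have := mulr_ge0 M0 g0; rewrite /energy_ip.
by move: (grad_ip W W) (pot_ip _ _) (L2ip _ _) h0 {g0} => *; lra.
Qed.

Lemma snorm_energy_le f (Df : rV -> rV) : L2 f -> (forall i, L2 (fun x => Df x ord0 i)) ->
  ((snorm energy_ip (sobolev_pack f Df))%:E <= (Num.sqrt (1 + M))%:E * H1norm f Df)%E.
Proof.
move=> f2 Df2; rewrite H1normE// -EFinM lee_fin -sqrtrM ?addr_ge0// ler_sqrt ?energy_ip_le//.
by rewrite mulr_ge0 ?addr_ge0 ?(semi_inner_ge0 grad_ip_semi_inner) ?(semi_inner_ge0
  (L2ip_semi_inner mu)).
Qed.

Lemma dist2_pack f g e : L2 f -> L2 g -> 0 <= e -> (dist2 f g <= (e ^+ 2)%:E)%E ->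
  snorm ip (L2_pack f - L2_pack g) <= e.
Proof.
move=> f2 g2 e0 fg; have fg2 := Lfun2B f2 g2.
rewrite L2_packB// /snorm L2ip_pack// -[e]ger0_norm// -sqrtr_sqr ler_sqrt ?sqr_ge0//.
rewrite -lee_fin; apply: le_trans fg; rewrite /Rintegral fineK.
  by rewrite /dist2; under eq_integral do rewrite -expr2.
by apply: integrable_fin_num => //; exact: Lfun2_integrableM.
Qed.

Lemma sobolev_dense f Df e : H1 f Df -> 0 < e -> exists2 phi, test_function setT phi &
  snorm energy_ip (sobolev_pack f Df -
    sobolev_pack phi (fun x => \row_i 'D_(delta_mx ord0 i) phi x)) <= e /\
  snorm ip (L2_pack f - L2_pack phi) <= e.
Proof.
move=> hf e0; have [f2 Df2 _] := hf.
(* The squared energy seminorm of the difference is at most (1 + M)(1 + n) d^2, one d^2 for the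
   function and one for each derivative; this is at most e^2. *)
pose d := e / ((1 + M) * (1 + n%:R)).
have K1 : 1 <= (1 + M) * (1 + n%:R).
  by rewrite -[leLHS]mulr1 ler_pM// lerDl.
have K0 : 0 < (1 + M) * (1 + n%:R) by rewrite (lt_le_trans _ K1).
have d0 : 0 < d by rewrite divr_gt0.
have de : d <= e by rewrite ler_pdivrMr// ler_peMr// ltW.
have dd0 : 0 < d ^+ 2 by rewrite exprn_gt0.
have [phi [tp pf pD]] := test_function_dense_H1 hf dd0.
have [p2 _] := test_function_L2 tp.
have D2 i : L2 ('D_(delta_mx ord0 i) phi).
  by have [] := test_function_L2 (test_function_derive (delta_mx ord0 i) tp).
have s := L2ip_semi_inner mu.
have H0 := dist2_pack f2 p2 (ltW d0) pf.
have Hi i := dist2_pack (Df2 i) (D2 i) (ltW d0) (pD i).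
exists phi => //; split; last exact: le_trans H0 de.
have sq (w : X) : snorm ip w <= d -> ip w w <= d ^+ 2.
  move=> wd; rewrite -(sqr_snorm s); apply: lerXn2r => //; rewrite nnegrE;
    [exact: snorm_ge0|exact: ltW].
set W := _ - _; have W1 : ip W.1 W.1 <= d ^+ 2 by exact: sq.
have W2 : grad_ip W W <= n%:R * d ^+ 2.
  have -> : n%:R * d ^+ 2 = \sum_(i < n) d ^+ 2 by rewrite sumr_const card_ord mulr_natl.
  apply: ler_sum => i _; apply: sq.
  rewrite !ffunE /=; under [X in _ - L2_pack X]eq_fun do rewrite mxE.
  exact: Hi.
rewrite -[leRHS]ger0_norm ?(ltW e0)// -sqrtr_sqr /snorm ler_sqrt ?sqr_ge0//.
apply: le_trans (energy_ip_le W) _.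
apply: (@le_trans _ _ ((1 + M) * ((1 + n%:R) * d ^+ 2))).
  by rewrite ler_wpM2l ?addr_ge0// mulrDl mul1r lerD.
rewrite mulrA /d expr_div_n mulrCA ger_pMr ?exprn_gt0//.
by rewrite expr2 invfM mulrA divff ?gt_eqF// mul1r invf_le1.
Qed.

(** f - g is orthogonal to all test functions, hence by density to itself, and has seminorm zero.
    The conclusion is stated for norms because f and g may still differ on a null set. *)
Lemma L2_pairing_eq f g : L2 f -> L2 g ->
  (forall psi, test_function setT psi -> \int[mu]_x (f x * psi x) = \int[mu]_x (g x * psi x)) ->
  \int[mu]_x (f x * f x) = \int[mu]_x (g x * g x).
Proof.
move=> f2 g2 fg; have s := L2ip_semi_inner mu; rewrite -!L2ip_pack//.
pose h := L2_pack f - L2_pack g.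
have h0 psi : test_function setT psi -> ip h (L2_pack psi) = 0.
  move=> tp; have [p2 _] := test_function_L2 tp.
  by rewrite (siBl s) !L2ip_pack// fg// subrr.
have hn : snorm ip h = 0.
  apply/eqP; rewrite -sqrf_eq0 (sqr_snorm s) -normr_le0; apply/ler_addgt0Pr => e e0.
  rewrite add0r; pose d := e / (snorm ip h + 1).
  have n1 : 0 < snorm ip h + 1 by rewrite ltr_wpDl// snorm_ge0.
  have d0 : 0 < d by rewrite divr_gt0.
  have dd0 : 0 < d ^+ 2 by rewrite exprn_gt0.
  have fg2 := Lfun2B f2 g2.
  have [psi tp pd] := test_function_dense_L2 fg2 dd0.
  have [p2 _] := test_function_L2 tp.
  have -> : ip h h = ip h (h - L2_pack psi) by rewrite (siBr s h (L2_pack psi) h) h0// subr0.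
  apply: le_trans (cauchy_schwarz s _ _) _.
  apply: (@le_trans _ _ (snorm ip h * d)).
    rewrite ler_wpM2l ?snorm_ge0// /h L2_packB//.
    exact: dist2_pack (ltW d0) pd.
  by rewrite /d mulrCA ger_pMr// ler_pdivrMr// mul1r lerDl.
apply/eqP; rewrite -subr_eq0 -normr_le0.
have -> : ip (L2_pack f) (L2_pack f) - ip (L2_pack g) (L2_pack g) = ip h (L2_pack f + L2_pack g).
  by rewrite (siBl s) !(siDr s) (semi_innerC s (L2_pack g) (L2_pack f)); ring.
by rewrite (le_trans (cauchy_schwarz s _ _))// hn mul0r.
Qed.

End energy_space.

(** * Weak solutions as curves in the energy space *)

Lemma cvg_abs_within {R : realType} (g : R -> \bar R) (h : R -> R) (t : R) :
  g s @[s --> within `[0, +oo[ (nbhs `|t|)] --> 0%E ->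
  (forall s, 0 <= s -> g s = (h s)%:E) -> h `|s| @[s --> t] --> 0.
Proof.
move=> g0 gh.
have absw : `|s| @[s --> t] --> within `[0, +oo[ (nbhs `|t|).
  move=> A; rewrite /within/= => hA.
  have {}hA : nbhs `|t| [set x | `[0, +oo[%classic x -> A x] := hA.
  have := @norm_continuous R R t _ hA; rewrite /nbhs/=;
    apply: (@filterS R (nbhs t) _ _ (fun s => A `|s|)) => s /= As.
  by apply: As; rewrite in_itv/= normr_ge0.
suff /fine_cvgP[] : (h `|s|)%:E @[s --> t] --> 0%:E by [].
have := cvg_comp _ _ absw g0; apply: cvg_trans; apply: near_eq_cvg.
by apply: nearW => s /=; rewrite gh.
Qed.

Section solution.
Context {R : realType} {n : nat}.
Local Notation rV := 'rV[R]_n.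
Local Notation mu := (@lebesgue_rV R n).
Local Notation X := (LfunType mu (lee1n 2)).
Local Notation Y := (X * {ffun 'I_n -> X})%type.
Local Notation ip := (@L2ip _ _ R mu).

Variables (V : rV -> R) (M : R).
Hypotheses (mV : measurable_fun setT V) (VM : forall x, `|V x| <= M) (V0 : forall x, 0 <= V x).
Local Notation a := (energy_ip V).
Variables (u ut : R -> rV -> R) (Du : R -> rV -> rV).
Hypotheses (uH1 : continuous_H1 u Du) (uC1 : C1_L2 u ut) (uV : damped_wave_distr V u).

(** Even extension in time: one-sided continuity at 0 becomes continuity on the whole line, as the
    abstract argument requires, while derivatives are taken at positive times, where nothing
    changes. *)
Definition state (t : R) : Y := sobolev_pack (u `|t|) (Du `|t|).
Definition velocity (t : R) : X := L2_pack (ut `|t|).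

Let sip := L2ip_semi_inner mu.
Let sa := energy_ip_semi_inner mV VM V0.
Let uh t : 0 <= t -> H1 (u t) (Du t). Proof. by move=> /uH1[]. Qed.
Let u2 t : 0 <= t -> L2 (u t). Proof. by move=> /uh[]. Qed.
Let ut2 t : 0 <= t -> L2 (ut t). Proof. by move=> t0; have [_ /(_ t t0)[]] := uC1. Qed.
Let Du2 t i : 0 <= t -> L2 (fun x => Du t x ord0 i). Proof. by move=> /uh[]. Qed.

Lemma pack_continuous (w : R -> rV -> R) (t : R) : continuous_L2 w ->
  snorm ip (L2_pack (w `|s|) - L2_pack (w `|t|)) @[s --> t] --> 0.
Proof.
move=> wc; have [wt wcv] := wc `|t| (normr_ge0 t).
apply: (@cvg_abs_within R _ (fun s => snorm ip (L2_pack (w s) - L2_pack (w `|t|))) t wcv).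
move=> s s0; have [ws _] := wc s s0.
by rewrite L2_packB// -snorm_pack//; exact: Lfun2B.
Qed.

Lemma velocity_continuous t : snorm ip (velocity s - velocity t) @[s --> t] --> 0.
Proof. by have [_ c _] := uC1; exact: pack_continuous. Qed.

Lemma position_continuous t : snorm ip ((state s).1 - (state t).1) @[s --> t] --> 0.
Proof. by have [c _ _] := uC1; exact: pack_continuous. Qed.

Lemma state_continuous t : snorm a (state s - state t) @[s --> t] --> 0.
Proof.
have t0 := normr_ge0 t; have [_ cv] := uH1 t0.
pose W s : Y := sobolev_pack (u s \- u `|t|) (Du s \- Du `|t|).
pose h s := Num.sqrt (ip (W s).1 (W s).1 + grad_ip (W s) (W s)).
have W2 s : 0 <= s -> L2 (u s \- u `|t|) /\ forall i, L2 (fun x => (Du s \- Du `|t|) x ord0 i).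
  move=> s0; split=> [|i]; first by apply: Lfun2B; exact: u2.
  by under eq_fun do rewrite !mxE; apply: Lfun2B; exact: Du2.
have hE s : 0 <= s -> H1norm (u s \- u `|t|) (Du s \- Du `|t|) = (h s)%:E.
  by move=> /W2[? ?]; exact: H1normE.
have h0 := cvg_abs_within cv hE.
apply: (@cvg_dist_le R _ _ _ _ (fun s => Num.sqrt (1 + M) * h `|s|)).
  move=> s; have s0 := normr_ge0 s; have [w1 w2] := W2 _ s0.
  rewrite subr0 ger0_norm ?snorm_ge0// /state sobolev_packB; [|exact: uh|exact: uh].
  by rewrite -lee_fin EFinM -hE//; exact: snorm_energy_le.
by rewrite -[X in _ --> X](mulr0 (Num.sqrt (1 + M))); apply: cvgMr.
Qed.

Lemma position_derivative (t : R) : 0 < t ->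
  snorm ip ((s - t)^-1 *: ((state s).1 - (state t).1) - velocity t) @[s --> t^'] --> 0.
Proof.
move=> t0; have [_ _ /(_ t (ltW t0)) cv] := uC1.
have cv' : L2norm (fun x => (s - t)^-1 * (u s x - u t x) - ut t x) @[s --> t^'] --> 0%E.
  apply: cvg_trans cv; apply: cvg_app => A; rewrite /within/= => hA.
  have {}hA : (t^') [set x : R | `[0, +oo[%classic x -> A x] := hA.
  have pos : (t^') [set s : R | 0 < s] by apply: nbhs_dnbhs; exact: lt_nbhsr.
  have hpos : (t^') ([set s : R | 0 < s] `&` [set x : R | `[0, +oo[%classic x -> A x])
    by exact: filterI.
  rewrite -[nbhs _ A]/((t^') A); apply: filterS hpos => s [s0]; apply.
  by rewrite /= in_itv/= ltW.
suff /fine_cvgP[] : (snorm ip ((s - t)^-1 *: ((state s).1 - (state t).1) - velocity t))%:E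
   @[s --> t^'] --> 0%:E by [].
apply: cvg_trans cv'; apply: near_eq_cvg.
have : \forall s \near t^', 0 < s by apply: nbhs_dnbhs; exact: lt_nbhsr.
apply: filterS => s s0; have d2 := Lfun2B (u2 (ltW s0)) (u2 (ltW t0)).
have e2 := L2Z (s - t)^-1 d2.
rewrite /state /velocity /= !gtr0_norm// L2_packB ?L2_packZ ?L2_packB ?snorm_pack//.
all: try exact: u2 (ltW _); try exact: ut2 (ltW _).
by apply: Lfun2B => //; exact: ut2 (ltW _).
Qed.

(** This is [dubois_reymond] with m = (u, phi), p = (u_t, phi) and q = a(u, phi); its integral
    hypothesis is the weak form for the products theta(t) phi(x). *)
Lemma wave_test phi (t : R) : test_function setT phi -> 0 < t ->
  let W := sobolev_pack phi (fun x => \row_i 'D_(delta_mx ord0 i) phi x) in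
  is_derive t 1 (fun s => ip (velocity s) W.1) (- a (state t) W - ip (velocity t) W.1).
Proof.
move=> tp t0 W.
have [p2 _] := test_function_L2 tp.
have Dp2 i : L2 ('D_(delta_mx ord0 i) phi).
  by have [] := test_function_L2 (test_function_derive (delta_mx ord0 i) tp).
have cst0 (Z : lmodType R) (b : Z -> Z -> R) (sb : semi_inner b) (w : Z) (s : R) :
    snorm b ((fun=> w) r - w) @[r --> s] --> 0.
  rewrite (_ : (fun _ => _) = fun=> 0); first exact: cvg_cst.
  by apply/funext => r; rewrite subrr /snorm (si0l sb) sqrtr0.
have := @dubois_reymond R (fun s => ip (state s).1 W.1) (fun s => ip (velocity s) W.1)
  (fun s => a (state s) W).
apply => //.
- move=> s; apply: (@ip_cvg _ _ _ sip _ _ _ _ _ _ _ (@position_continuous s)); exact: cst0.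
- move=> s; apply: (@ip_cvg _ _ _ sip _ _ _ _ _ _ _ (@velocity_continuous s)); exact: cst0.
- move=> s; apply: (@ip_cvg _ _ _ sa _ _ _ _ _ _ _ (@state_continuous s)); exact: cst0.
- move=> s s0; apply/is_derive1_slope.
  rewrite (_ : (fun r => _) = fun r => ip ((r - s)^-1 *: ((state r).1 - (state s).1)) W.1).
    apply: (@ip_cvg _ _ _ sip _ _ _ _ _ _ _ (position_derivative s0)).
    by apply: cvg_within_filter; exact: cst0.
  by apply/funext => r; rewrite (siZl sip) (siBl sip).
- move=> theta tt.
  rewrite -[RHS](weak_form_tensor mV VM uV (fun s s0 => uh (ltW s0)) tt tp).
  apply: eq_Rintegral => s; rewrite inE/= in_itv/= andbT => s0.
  have s0' := ltW s0; rewrite /state gtr0_norm//= L2ip_pack//; last exact: u2.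
  congr (_ - _ + _ * _); rewrite /energy_ip /grad_ip /pot_ip /= !L2_packE//; last exact: u2.
  congr (_ + _); apply: eq_bigr => i _; rewrite !ffunE L2ip_pack; [|exact: Du2|].
    by apply: eq_Rintegral => x _; rewrite mxE.
  by under eq_fun do rewrite mxE.
Qed.

Lemma wave_H1 f Df (t : R) : H1 f Df -> 0 < t ->
  is_derive t 1 (fun s => ip (velocity s) (L2_pack f))
    (- a (state t) (sobolev_pack f Df) - ip (velocity t) (L2_pack f)).
Proof.
move=> hf t0.
apply: (@wave_of_dense R X Y ip a fst state velocity [set W | exists2 phi,
  test_function setT phi & W = sobolev_pack phi (fun x => \row_i 'D_(delta_mx ord0 i) phi x)]
  sip sa state_continuous velocity_continuous _ (sobolev_pack f Df)) => //.
- by move=> _ [phi tp ->] s s0; exact: wave_test.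
- move=> e e0; have [phi tp pe] := sobolev_dense mV VM hf e0.
  by eexists; [exists phi|].
Qed.

End solution.

(** * Initial data, Young's inequality and the energy as a real number *)

Section data.
Context {R : realType} {n : nat}.
Local Notation rV := 'rV[R]_n.
Local Notation mu := (@lebesgue_rV R n).
Local Notation X := (LfunType mu (lee1n 2)).
Local Notation ip := (@L2ip _ _ R mu).
Implicit Types f g : rV -> R.

Lemma L2norm_sqr f : L2 f -> (L2norm f ^+ 2 = (\int[mu]_x (f x * f x))%:E)%E.
Proof.
by move=> f2; rewrite snorm_pack// -EFin_expe (sqr_snorm (L2ip_semi_inner mu)) L2ip_pack.
Qed.

Lemma ae_eq_Rintegral (F : R -> rV -> R) f g :
  measurable_fun setT (fun x => F (f x) x) -> measurable_fun setT (fun x => F (g x) x) ->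
  f = g %[ae mu] -> \int[mu]_x F (f x) x = \int[mu]_x F (g x) x.
Proof.
move=> mf mg fg; congr fine; apply: ae_eq_integral => //; try exact/measurable_EFinP.
by apply: filterS fg => x fgx _ /=; rewrite fgx.
Qed.

Lemma ae_eq_L2ip f g h : L2 f -> L2 g -> L2 h -> f = g %[ae mu] ->
  \int[mu]_x (f x * h x) = \int[mu]_x (g x * h x).
Proof.
move=> f2 g2 h2; apply: (@ae_eq_Rintegral (fun y x => y * h x)).
- exact: measurable_funM (Lfun2_measurable f2) (Lfun2_measurable h2).
- exact: measurable_funM (Lfun2_measurable g2) (Lfun2_measurable h2).
Qed.

Lemma ae_eq_L2sqr f g : L2 f -> L2 g -> f = g %[ae mu] ->
  \int[mu]_x (f x * f x) = \int[mu]_x (g x * g x).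
Proof.
move=> f2 g2; apply: (@ae_eq_Rintegral (fun y x => y * y)).
- exact: measurable_funM (Lfun2_measurable f2) (Lfun2_measurable f2).
- exact: measurable_funM (Lfun2_measurable g2) (Lfun2_measurable g2).
Qed.

(** u(0) and u_0 agree only almost everywhere and come with separately given representatives of
    their gradients; uniqueness of weak gradients makes the norms equal. *)
Lemma weak_gradient_ae_sqr f g Df Dg : H1 f Df -> H1 g Dg -> f = g %[ae mu] ->
  \sum_i \int[mu]_x (Df x ord0 i * Df x ord0 i) =
  \sum_i \int[mu]_x (Dg x ord0 i * Dg x ord0 i).
Proof.
move=> [f2 Df2 fD] [g2 Dg2 gD] fg; apply: eq_bigr => i _.
apply: L2_pairing_eq => // psi tp; apply: oppr_inj; rewrite -fD// -gD//.
apply: ae_eq_L2ip => //.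
by have [] := test_function_L2 (test_function_derive (delta_mx ord0 i) tp).
Qed.

Variables (V : rV -> R) (M : R).
Hypotheses (mV : measurable_fun setT V) (mV1 : measurable_fun setT (fun x => (V x)^-1))
  (VM : forall x, `|V x| <= M) (V0 : forall x, 0 < V x).

(** Pointwise, the gap between the two integrands is (P - V f)^2 / (2 V) >= 0. *)
Lemma K0_duality (P f : rV -> R) : L2 P -> L2 f ->
  (\int[mu]_x (P x ^+ 2 / V x)%:E < +oo)%E ->
  \int[mu]_x (P x * f x) - 2^-1 * \int[mu]_x (V x * (f x * f x)) <=
  2^-1 * fine (\int[mu]_x (P x ^+ 2 / V x)%:E)%E.
Proof.
move=> P2 f2 Pfin; have mP := Lfun2_measurable P2.
have mPV : measurable_fun setT (fun x => P x ^+ 2 / V x).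
  by apply: measurable_funM; [exact: measurable_funX|exact: mV1].
have PVi : mu.-integrable setT (EFin \o (fun x => P x ^+ 2 / V x)).
  apply/integrableP; split; first exact/measurable_EFinP.
  apply: le_lt_trans Pfin; rewrite le_eqVlt; apply/orP; left; apply/eqP.
  apply: eq_integral => x _; rewrite /= ger0_norm// divr_ge0 ?sqr_ge0// ltW//.
have Vfi : mu.-integrable setT (EFin \o (fun x => V x * (f x * f x))).
  have := Lfun2_integrableM (L2_bounded_mul mV VM f2) f2.
  by under eq_fun do rewrite -mulrA.
have [i1 E1] := Rintegral_lin 1 (- 2^-1) (Lfun2_integrableM P2 f2) Vfi.
(* The zero coefficient turns the rule for linear combinations into one for a scalar multiple. *)
have [i2 E2] := Rintegral_lin 2^-1 0 PVi Vfi.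
rewrite -mulNr -[X in X + _]mul1r -E1 -[leRHS]addr0 -[X in _ <= _ + X](mul0r (\int[mu]_x (V x
  * (f x * f x)))) -E2.
apply: le_Rintegral => // x _; rewrite mul1r mul0r addr0 -subr_ge0.
have Vx := V0 x; have -> : 2^-1 * (P x ^+ 2 / V x) - (P x * f x + - 2^-1 * (V x * (f x * f x))) =
    2^-1 * ((P x - V x * f x) ^+ 2 / V x) by field; rewrite gt_eqF.
by rewrite mulr_ge0 ?invr_ge0// divr_ge0 ?sqr_ge0// ltW.
Qed.

Lemma energyE (u ut : R -> rV -> R) (Du : R -> rV -> rV) (t : R) : 0 <= t ->
  L2 (u t) -> L2 (ut t) -> (forall i, L2 (fun x => Du t x ord0 i)) ->
  energy V u ut Du t = (2^-1 * (energy_ip V (state u Du t) (state u Du t) +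
    ip (velocity ut t) (velocity ut t)))%:E.
Proof.
move=> t0 u2 ut2 Du2; have [e2 eE] := L2_euclid Du2.
have Vi : mu.-integrable setT (EFin \o (fun x => V x * (u t x * u t x))).
  have := Lfun2_integrableM (L2_bounded_mul mV VM u2) u2.
  by under eq_fun do rewrite -mulrA.
have [i1 E1] := Rintegral_lin 1 1 (Lfun2_integrableM e2 e2) Vi.
have [i2 E2] := Rintegral_lin 1 1 (Lfun2_integrableM ut2 ut2) i1.
rewrite /energy EFinM; congr (_ * _)%E.
transitivity (\int[mu]_x (1 * (ut t x * ut t x) + 1 *
    (1 * (euclid (Du t x) * euclid (Du t x)) + 1 * (V x * (u t x * u t x))))%R)%:E.
  rewrite /Rintegral fineK; last exact: integrable_fin_num.
  by apply: eq_integral => x _; rewrite !mul1r !expr2 addrA.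
congr EFin; rewrite E2 E1 eE !mul1r /energy_ip /grad_ip /pot_ip /state /velocity.
rewrite ger0_norm// L2ip_pack// addrC; congr (_ + _ + _).
  by apply: eq_bigr => i _; rewrite !ffunE L2ip_pack.
by rewrite /= L2_packE.
Qed.

End data.

Theorem theorem1p3 (R : realType) (n : nat) (n_ge1 : (1 <= n)%N)
    (V : 'rV[R]_n -> R) (V_bounded : bounded_fun V) (V_cont : continuous V)
    (V_gt0 : forall x, 0 < V x) :
  exists2 C : R, 0 < C &
  forall (u0 u1 : 'rV[R]_n -> R) (Du0 : 'rV[R]_n -> 'rV[R]_n),
    H1 u0 Du0 -> L2 u1 -> (K0_sq V u0 u1 < +oo)%E ->
  forall (u ut : R -> 'rV[R]_n -> R) (Du : R -> 'rV[R]_n -> 'rV[R]_n),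
    weak_solution V u0 u1 u ut Du ->
  forall t : R, 0 <= t ->
    (((1 + t) ^+ 2)%:E * energy V u ut Du t <= C%:E * data_sq V u0 u1 Du0)%E /\
    ((1 + t)%:E * L2norm (u t) ^+ 2 <= C%:E * data_sq V u0 u1 Du0)%E.
Proof.
have [M VM] : exists M, forall x, `|V x| <= M.
  have [M0 [_ MP]] := V_bounded; exists (M0 + 1) => x.
  by apply: MP => //; rewrite ltrDl.
have M0 : 0 <= M by rewrite (le_trans _ (VM 0)).
have mV : measurable_fun setT V by exact: continuous_measurable_rV.
have mV1 : measurable_fun setT (fun x => (V x)^-1).
  apply: continuous_measurable_rV => x; apply: continuousV; last exact: V_cont.
  by rewrite gt_eqF.
have V_ge0 x : 0 <= V x by exact: ltW.
(* 30 is the constant of the abstract decay; 1 + M absorbs the initial potential energy, which is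
   not part of [data_sq], into the norm of u_0. *)
exists (30 * (1 + M)) => [|u0 u1 Du0 h0 u12 K0fin u ut Du]; first by rewrite mulr_gt0// ltr_pwDl.
case=> uH1 uC1 uV uu0 utu1 t t0.
pose mu := @lebesgue_rV R n; pose ip := @L2ip _ _ R mu.
have sip : semi_inner ip := L2ip_semi_inner mu.
have sa := energy_ip_semi_inner mV VM V_ge0.
have uh s : 0 <= s -> H1 (u s) (Du s) by move=> /uH1[].
have u2 s : 0 <= s -> L2 (u s) by move=> /uh[].
have ut2 s : 0 <= s -> L2 (ut s) by move=> s0; have [_ /(_ s s0)[]] := uC1.
have Du2 s i : 0 <= s -> L2 (fun x => Du s x ord0 i) by move=> /uh[].
have [u20 ut20 Du20] := And3 (u2 0 (lexx _)) (ut2 0 (lexx _)) (fun i => Du2 0 i (lexx _)).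
have [u2t ut2t Du2t] := And3 (u2 t t0) (ut2 t t0) (fun i => Du2 t i t0).
have [u02 Du02 _] := h0; have [e2 eE] := L2_euclid Du02.
pose K := fine (K0_sq V u0 u1).
have K_ge0' : (0 <= K0_sq V u0 u1)%E.
  by apply: integral_ge0 => x _; rewrite lee_fin divr_ge0// sqr_ge0.
have KE : K0_sq V u0 u1 = K%:E by rewrite fineK// ge0_fin_numE.
have K_ge0 : 0 <= K by rewrite fine_ge0.
(* [P] is formed from the solution at time 0, which equals the data only almost everywhere; [PE]
   identifies the weighted integrals. *)
pose P x := ut 0 x + u 0 x.
have P2 : L2 P.
  have := Lfun2_lin 1 (ut2 0 (lexx _)) (u2 0 (lexx _)).
  by under eq_fun do rewrite mul1r.
have PE : (\int[mu]_x (P x ^+ 2 / V x)%:E = K0_sq V u0 u1)%E.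
  apply: ae_eq_integral => //.
  - apply/measurable_EFinP; apply: measurable_funM => //; apply: measurable_funX.
    exact: Lfun2_measurable P2.
  - apply/measurable_EFinP; apply: measurable_funM => //; apply: measurable_funX.
    exact: measurable_funD (Lfun2_measurable u12) (Lfun2_measurable u02).
  - by apply: filterS2 uu0 utu1 => x ux utx _; rewrite /P ux// utx.
have Kdual (y : LfunType mu (lee1n 2) * {ffun 'I_n -> LfunType mu (lee1n 2)}) :
    ip (velocity ut 0 + (state u Du 0).1) y.1 - 2^-1 * energy_ip V y y <= 2^-1 * K.
  have := K0_duality mV mV1 VM V_gt0 P2 (LfunP y.1); rewrite PE => /(_ K0fin); apply: le_trans.
  have -> : ip (velocity ut 0 + (state u Du 0).1) y.1 = \int[mu]_x (P x * y.1 x).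
    apply: eq_Rintegral => x _; congr (_ * _).
    rewrite -[LHS]/((velocity ut 0 : _ -> _) x + ((state u Du 0).1 : _ -> _) x).
    by rewrite /velocity /state normr0 /= !L2_packE.
  (* [K0_duality] gives the bound with the potential part of the form alone; subtracting the
     nonnegative gradient part as well only lowers the left-hand side. *)
  rewrite lerD2l lerN2 ler_wpM2l ?invr_ge0// /energy_ip lerDr.
  exact: (semi_inner_ge0 (@grad_ip_semi_inner R n)).
have wave (s tau : R) : 0 < s -> 0 <= tau ->
    is_derive s 1 (fun s => ip (velocity ut s) (state u Du tau).1)
    (- energy_ip V (state u Du s) (state u Du tau) - ip (velocity ut s) (state u Du tau).1).
  by move=> s0 _; apply: (wave_H1 mV VM V_ge0 uH1 uC1 uV) => //; exact: uh.
have [] := damped_wave_decay sip sa (fun _ _ _ => erefl) (state_continuous mV VM uH1)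
  (position_continuous Du uC1) (velocity_continuous uC1) (position_derivative uH1 uC1)
  wave K_ge0 Kdual t0.
set D := _ + K => decay1 decay2.
pose A := \int[mu]_x (u0 x * u0 x) + \int[mu]_x (u1 x * u1 x) +
  \sum_i \int[mu]_x (Du0 x ord0 i * Du0 x ord0 i) + K.
have dataE : data_sq V u0 u1 Du0 = A%:E.
  by rewrite /data_sq !L2norm_sqr// KE eE -!EFinD.
have DA : D <= (1 + M) * A.
  have H0 := uh 0 (lexx _).
  have E1 : ip (state u Du 0).1 (state u Du 0).1 = \int[mu]_x (u0 x * u0 x).
    by rewrite /ip /state normr0 L2ip_pack//; exact: ae_eq_L2sqr.
  have E2 : ip (velocity ut 0) (velocity ut 0) = \int[mu]_x (u1 x * u1 x).
    by rewrite /ip /velocity normr0 L2ip_pack//; exact: ae_eq_L2sqr.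
  have E3 : grad_ip (state u Du 0) (state u Du 0) =
      \sum_i \int[mu]_x (Du0 x ord0 i * Du0 x ord0 i).
    rewrite -(weak_gradient_ae_sqr H0 h0 uu0) /grad_ip /state normr0.
    by apply: eq_bigr => i _; rewrite !ffunE L2ip_pack.
  have := pot_ip_le mV VM (state u Du 0).1.
  rewrite /D /energy_ip /A E1 E2 E3 -E1 -E2 -E3.
  have := semi_inner_ge0 sip (velocity ut 0).
  have := semi_inner_ge0 (@grad_ip_semi_inner R n) (state u Du 0).
  have := semi_inner_ge0 sip (state u Du 0).1; rewrite -/ip.
  move: (ip _ _) (ip _ _) (grad_ip _ _) (pot_ip _ _ _) => a b c d a0 c0 b0 da.
  have := mulr_ge0 M0 b0; have := mulr_ge0 M0 c0; have := mulr_ge0 M0 K_ge0; lra.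
rewrite dataE -EFinM; split.
  rewrite (energyE mV VM)//.
  rewrite -EFinM lee_fin mulrCA; apply: (@le_trans _ _ (30 * D)).
    apply: le_trans decay1; apply: ler_piMl; last by rewrite invf_le1// ler1n.
    by rewrite mulr_ge0 ?sqr_ge0// addr_ge0 ?(semi_inner_ge0 sa) ?(semi_inner_ge0 sip).
  by rewrite -mulrA ler_wpM2l.
rewrite L2norm_sqr// -EFinM lee_fin -mulrA; apply: le_trans (_ : 30 * D <= _).
  apply: le_trans decay2; rewrite le_eqVlt; apply/orP; left; apply/eqP.
  by rewrite /ip /state ger0_norm// L2ip_pack.
by rewrite ler_wpM2l.
Qed.
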